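(* Let $d\ge 1$, $b\ge 2$ be integers and let $\{P_m(\mathbf t):\mathbf t\in[0,1]^d\}_{m\ge 0}$ be a sequence of independent stochastic processes with $P_m(\mathbf t)\ge 0$ and $\mathbb E[P_m(\mathbf t)]= 1$ for all $m,\mathbf t$. Suppose Assumptions 1, 2 and 3 of the context hold, with parameters $p_0\in(1,2]$ and $\alpha_0\in(0,1]$. Then almost surely on $\{\mu_\infty\ne 0\}$, the multiplicative chaos measure $\mu_\infty$ has polynomial Fourier decay with $$\dim_F(\mu_\infty)\ \ge\ \min\Big\{2\alpha_0,\ \sup_{1<p\le p_0}\frac{2\,\Theta(p)}{p\log b}\Big\}>0,$$ where $$\Theta(p)=d(p-1)\log b-\log\Big(\limsup_{j\to\infty}\sup_{\mathbf t\in[0,1)^d}\mathbb E[P_j(\mathbf t)^p]\Big).$$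
   Context: Processes are jointly measurable. For $m\ge0$ let $\mu_m(d\mathbf t)=\big[\prod_{j=0}^m P_j(\mathbf t)\big]d\mathbf t$ on $[0,1]^d$. Almost surely $\mu_m$ converges weakly as $m\to\infty$ to a random finite measure $\mu_\infty$ on $[0,1]^d$ (Kahane's $T$-martingale theory), called the multiplicative chaos measure. $b$-adic cubes: $\mathscr D_m^b$ is the family of cubes $\mathbf I=\prod_{\beta=1}^d[\frac{h_\beta-1}{b^m},\frac{h_\beta}{b^m})$ with $h_\beta\in\{1,\dots,b^m\}$. For a process $P$ and a cube $\mathbf I$, $P^{\mathbf I}=\{P(\mathbf t):\mathbf t\in\mathbf I\}$. Assumption 1. There is an integer $k_0\ge 0$ with $P_k\not\equiv 1$ for every $k>k_0$, and there are positive integers $(N_m)_{m\ge0}$ with $N_m=o(b^{m\varepsilon})$ as $m\to\infty$ for every $\varepsilon>0$, and for each $m\ge 0$ a partition $\mathscr D_m^b=\bigsqcup_{i=1}^{N_m}\mathscr D_{m,i}^b$, such that for all $k>k_0$ and $1\le i\le N_{k-1}$ the processes $\{P_k^{\mathbf I}:\mathbf I\in\mathscr D_{k-1,i}^b\}$ are jointly independent. Assumption 2. $\sup_{\mathbf t\in[0,1)^d}\mathbb E[P_j(\mathbf t)^{p_0}]<\infty$ for all $j\ge0$ and $\limsup_{j\to\infty}\sup_{\mathbf t\in[0,1)^d}\mathbb E[P_j(\mathbf t)^{p_0}]<b^{d(p_0-1)}$. Assumption 3. $\displaystyle\sup_{j\ge 0}\ \sup_{\mathbf I\in\mathscr D_j^b}\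 \sup_{\mathbf t,\mathbf s\in\mathbf I,\ \mathbf t\ne\mathbf s}\mathbb E\Big[\Big|\frac{P_j(\mathbf t)-P_j(\mathbf s)}{b^{j\alpha_0}|\mathbf t-\mathbf s|^{\alpha_0}}\Big|^{p_0}\Big]<\infty$, with $|\cdot|$ the Euclidean norm. Fourier dimension: for a finite Borel measure $\nu$ on $[0,1]^d$, $\widehat\nu(\mathbf x)=\int e^{-2\pi i\mathbf x\cdot\mathbf t}\nu(d\mathbf t)$, $\mathbf x\in\mathbb R^d$, and $\dim_F(\nu)=\sup\{D\in[0,d):|\widehat\nu(\mathbf x)|^2=O(|\mathbf x|^{-D})\text{ as }|\mathbf x|\to\infty\}$. A non-zero $\nu$ has polynomial Fourier decay if $|\widehat\nu(\mathbf x)|^2=O(|\mathbf x|^{-D})$ for some $D>0$. *)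

(* Defs.v *)
From HB Require Import structures.
From mathcomp Require Import all_boot all_order all_algebra finmap complex.
From mathcomp Require Import all_classical all_reals all_analysis.
Set Implicit Arguments.
Unset Strict Implicit.
Unset Printing Implicit Defensive.
Import Order.TTheory GRing.Theory Num.Theory numFieldNormedType.Exports.
Local Open Scope classical_set_scope.
Local Open Scope ring_scope.

Section lebesgue_tuple.
Context {R : realType}.
Local Open Scope ereal_scope.

Section lebesgue_cons.
Variables (n : nat) (m : {sigma_finite_measure set (n.-tuple R) -> \bar R}).

Let consT (z : measurableTypeR R * n.-tuple R) : n.+1.-tuple R :=
  [tuple of z.1 :: z.2].

Let measurable_consT : measurable_fun setT consT.
Proof.
by apply: measurable_cons; [exact: measurable_fst|exact: measurable_snd].
Qed.

(* The product of Lebesgue measure on R and [m], seen on R^(n+1). *)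
Definition lebesgue_cons : set (n.+1.-tuple R) -> \bar R :=
  pushforward (lebesgue_measure \x m) consT.

Let lebesgue_cons0 : lebesgue_cons set0 = 0.
Proof. by rewrite /lebesgue_cons /pushforward preimage_set0 measure0. Qed.

Let lebesgue_cons_ge0 A : 0 <= lebesgue_cons A.
Proof. exact: measure_ge0. Qed.

Let lebesgue_cons_sigma_additive : semi_sigma_additive lebesgue_cons.
Proof.
move=> F mF tF mUF; rewrite /lebesgue_cons /pushforward preimage_bigcup.
have mp k : measurable (consT @^-1` F k).
  by rewrite -[X in measurable X]setTI; apply: measurable_consT.
apply: measure_semi_sigma_additive => //.
- apply/trivIsetP => i j _ _ ij; rewrite -preimage_setI.
  move/trivIsetP : tF => /(_ i j Logic.I Logic.I ij) ->.
  by rewrite preimage_set0.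
- exact: bigcup_measurable.
Qed.

HB.instance Definition _ := isMeasure.Build _ _ _ lebesgue_cons
  lebesgue_cons0 lebesgue_cons_ge0 lebesgue_cons_sigma_additive.

Let lebesgue_cons_sigma_finite : sigma_finite setT lebesgue_cons.
Proof.
pose unc (t : n.+1.-tuple R) : measurableTypeR R * n.-tuple R :=
  (thead t, [tuple of behead t]).
have unconsK z : unc (consT z) = z.
  by case: z => x t; rewrite /unc /consT theadE; congr pair; exact: val_inj.
have munc : measurable_fun setT unc.
  apply/measurable_fun_pairP; split.
    exact: (@measurable_tnth _ R n.+1 ord0).
  exact: (@measurable_behead _ R n).
(* The library's sigma-finite instance of [\x] is shadowed. *)
have [F [FT Ffin]] : sigma_finite setT (lebesgue_measure \x m).
  have /sigma_finiteP[F [TF ndF Foo]] :=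
    sigma_finiteT (@lebesgue_measure R : {sigma_finite_measure set _ -> \bar R}).
  have /sigma_finiteP[G [TG ndG Goo]] := sigma_finiteT m.
  exists (fun k => F k `*` G k).
    rewrite -setXTT TF TG predeqE => -[x y]; split.
      move=> [/= [i _ Fix] [j _ Gjy]]; exists (maxn i j) => //; split.
        by move: x Fix; exact/subsetPset/ndF/leq_maxl.
      by move: y Gjy; exact/subsetPset/ndG/leq_maxr.
    by move=> [k _ []/= ? ?]; split; exists k.
  move=> k; have [? ?] := Foo k; have [? ?] := Goo k.
  split; first exact: measurableX.
  by rewrite product_measure1E// lte_mul_pinfty// ge0_fin_numE.
exists (fun k => unc @^-1` F k).
  by rewrite -preimage_bigcup -FT preimage_setT.
move=> k; have [mF Foo] := Ffin k; split.
  by rewrite -[X in measurable X]setTI; exact: munc.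
rewrite /lebesgue_cons /pushforward (_ : _ @^-1` _ = F k)//.
by apply/seteqP; split => z /=; rewrite unconsK.
Qed.

HB.instance Definition _ := Measure_isSigmaFinite.Build _ _ _ lebesgue_cons
  lebesgue_cons_sigma_finite.
End lebesgue_cons.

Fixpoint lebesgue_tuple n : {sigma_finite_measure set (n.-tuple R) -> \bar R} :=
  match n with
  | 0 => \d_([tuple] : 0.-tuple R)
  | n'.+1 => lebesgue_cons (lebesgue_tuple n')
  end.
End lebesgue_tuple.

Section cubes.
Context {R : realType} (d : nat).
Implicit Types t s x : d.-tuple R.

Definition ccube : set (d.-tuple R) := [set t | forall i, 0 <= tnth t i <= 1].

Definition hcube : set (d.-tuple R) := [set t | forall i, 0 <= tnth t i < 1].

(* The b-adic cubes of generation m are indexed by h : {0, ..., b^m - 1}^d: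
   the index here is h - 1 in the usual 1-based numbering. *)
Definition bindex (b m : nat) := {ffun 'I_d -> 'I_(b ^ m)}.

Definition bcube (b m : nat) (h : bindex b m) : set (d.-tuple R) :=
  [set t | forall i,
     (h i)%:R / (b ^ m)%:R <= tnth t i < (h i).+1%:R / (b ^ m)%:R].

Definition dotp x t : R := \sum_(i < d) tnth x i * tnth t i.

(* The norm of the library on 'rV[R]_d is the sup norm; these are Euclidean. *)
Definition euclid_norm x : R := Num.sqrt (\sum_(i < d) tnth x i ^+ 2).

Definition euclid_dist t s : R :=
  Num.sqrt (\sum_(i < d) (tnth t i - tnth s i) ^+ 2).

Definition row_of_tuple t : 'rV[R]_d := \row_i tnth t i.

(* Weak convergence on [0,1]^d. Tuples carry the product sigma-algebra but no
   topology, so continuity of the test functions is read on row vectors. *)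
Definition weakly_cvg (nu_ : nat -> set (d.-tuple R) -> \bar R)
    (nu : set (d.-tuple R) -> \bar R) : Prop :=
  forall f : 'rV[R]_d -> R,
    {within row_of_tuple @` ccube, continuous f} ->
    (\int[nu_ m]_(t in ccube) (f (row_of_tuple t))%:E)%E @[m --> \oo] -->
    (\int[nu]_(t in ccube) (f (row_of_tuple t))%:E)%E.

Definition nonzero_measure (nu : {measure set (d.-tuple R) -> \bar R}) : Prop :=
  exists2 A, measurable A & nu A != 0%E.

Definition fourier (nu : {measure set (d.-tuple R) -> \bar R}) x : R[i] :=
  let theta t : R := - (2 * pi * dotp x t) in
  (\int[nu]_(t in ccube) cos (theta t) +i*
   \int[nu]_(t in ccube) sin (theta t))%C.

Definition fourier_bigO (nu : {measure set (d.-tuple R) -> \bar R}) (D : R) : Prop :=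
  exists C M : R, 0 < M /\
    forall x, M <= euclid_norm x ->
      ComplexField.Normc.normc (fourier nu x) ^+ 2 <= C * euclid_norm x `^ (- D).

Definition polynomial_fourier_decay
    (nu : {measure set (d.-tuple R) -> \bar R}) : Prop :=
  nonzero_measure nu /\ exists2 D : R, 0 < D & fourier_bigO nu D.

Definition fourier_dim (nu : {measure set (d.-tuple R) -> \bar R}) : \bar R :=
  ereal_sup [set D%:E | D in [set D : R | 0 <= D < d%:R /\ fourier_bigO nu D]].

End cubes.
Arguments ccube {R}.
Arguments hcube {R}.

Section independence.
Context {dO : measure_display} {Omega : measurableType dO} {R : realType}.
Variable Pr : probability Omega R.

Definition mutually_independent {I : choiceType} (A : set I)
    (F : I -> set (set Omega)) : Prop :=
  forall (J : {fset I}) (E : I -> set Omega),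
    (forall i, i \in J -> A i /\ F i (E i)) ->
    Pr (\bigcap_(i in [set` J]) E i) = (\prod_(i <- J) fine (Pr (E i)))%:E.

(* The sigma-algebra generated by the variables X t, t in A. *)
Definition process_sigma {T : Type} (A : set T) (X : T -> Omega -> R) :
    set (set Omega) :=
  <<s [set X t @^-1` B | t in A & B in measurable] >>.

Definition independent_processes {I : choiceType} (A : set I) {T : Type}
    (S : I -> set T) (X : I -> T -> Omega -> R) : Prop :=
  mutually_independent A (fun i => process_sigma (S i) (X i)).

End independence.

Section multiplicative_chaos.
Context {dO : measure_display} {Omega : measurableType dO} {R : realType}.
Variables (Pr : probability Omega R) (d b : nat).
Variable P : nat -> d.-tuple R -> Omega -> R.

(* mu_m; a set function suffices for [\int]. It is a measure at [w] since
   [P] is nonnegative and jointly measurable on the cube. *)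
Definition chaos_approx (m : nat) (w : Omega) : set (d.-tuple R) -> \bar R :=
  fun A => (\int[lebesgue_tuple d]_(t in A `&` ccube d)
              (\prod_(j < m.+1) P j t w)%:E)%E.

(* [mu] is a version of the almost sure weak limit of the measures
   [chaos_approx m]; [R.-ftker] makes it a random finite measure. *)
Definition is_multiplicative_chaos (mu : R.-ftker Omega ~> d.-tuple R) : Prop :=
  (forall w, mu w (~` ccube d) = 0%E) /\
  {ae Pr, forall w, weakly_cvg (chaos_approx ^~ w) (mu w)}.

Definition sup_moment (p : R) (j : nat) : \bar R :=
  ereal_sup [set 'E_Pr[fun w => (P j t w `^ p)%R]%E | t in hcube d].

(* P_k is not identically 1, processes being identified up to modification *)
Definition nontrivial_process (k : nat) : Prop :=
  ~ (forall t, ccube d t -> {ae Pr, forall w, P k t w = 1}).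

Definition assumption1 : Prop :=
  exists (k0 : nat) (N : nat -> nat)
         (D : forall m, 'I_(N m) -> {set bindex d b m}),
    [/\ (forall k, (k0 < k)%N -> nontrivial_process k),
        (forall m, (0 < N m)%N),
        (forall eps : R, 0 < eps ->
           (N m)%:R / b%:R `^ (m%:R * eps) @[m --> \oo] --> (0 : R)),
        (forall m h, exists! i, h \in D m i)
      & (forall k, (k0 < k)%N -> forall i : 'I_(N k.-1),
           independent_processes Pr [set h | h \in D k.-1 i]
             (fun h => bcube h) (fun=> P k))].

Definition assumption2 (p0 : R) : Prop :=
  (forall j, (sup_moment p0 j < +oo)%E) /\
  (limn_esup (sup_moment p0) < (b%:R `^ (d%:R * (p0 - 1)))%:E)%E.

Definition assumption3 (p0 alpha0 : R) : Prop :=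
  let increment j t s w :=
    (P j t w - P j s w) / (b%:R `^ (j%:R * alpha0) * euclid_dist t s `^ alpha0) in
  (ereal_sup (range (fun j : nat =>
     ereal_sup (range (fun h : bindex d b j =>
       ereal_sup [set 'E_Pr[fun w => (`|increment j ts.1 ts.2 w| `^ p0)%R]
         | ts in [set ts | [/\ bcube h ts.1, bcube h ts.2 & ts.1 != ts.2]]]))))
   < +oo)%E.

Definition Theta (p : R) : \bar R :=
  ((d%:R * (p - 1) * ln b%:R)%:E - lne (limn_esup (sup_moment p)))%E.

Definition fourier_dim_bound (p0 alpha0 : R) : \bar R :=
  Order.min (2 * alpha0)%:E
    (ereal_sup [set ((2 / (p * ln b%:R))%:E * Theta p)%E
                | p in [set p : R | 1 < p <= p0]]).

End multiplicative_chaos.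

(* Main.v *)
(* The Fourier transform of the chaos measure at x is the sum over m of the transforms of
   the martingale differences f_m = P_0 ... P_m - P_0 ... P_(m-1). Assumption 1 splits the
   b-adic cubes of level m into b^o(m) classes within which the contributions of the cubes are
   independent, centred given the past, so that for 1 <= p <= 2 a p-smooth approximation of
   the maximum (log-sum-exp) bounds the maximum of |hat f_m| over the b^O(n) points of a mesh
   b^-n of the frequencies of size b^n, at a cost polynomial in n, by the sum over the cubes of
   p-th moments. Summation by parts against the wave and Assumption 3 give the contribution of
   a cube a factor b^(s(m-n)), s < alpha0. With s < Theta(p)/(p log b) the resulting
   probabilities are summable over (m, n); Borel-Cantelli bounds hat mu by b^(-ns) on the mesh,
   and the Lipschitz continuity of hat mu extends the bound to all frequencies. *)

Require Import Defs.
From HB Require Import structures.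
From mathcomp Require Import all_boot all_order all_algebra finmap complex.
From mathcomp Require Import all_classical all_reals all_analysis measurable_realfun.
From mathcomp Require Import ring lra zify.
Set Implicit Arguments.
Unset Strict Implicit.
Unset Printing Implicit Defensive.
Import Order.TTheory GRing.Theory Num.Theory numFieldNormedType.Exports.
Local Open Scope classical_set_scope.
Local Open Scope ring_scope.

(** * Powers, soft maxima and oscillating sums *)

(** Only moments of order [p <= 2] are at hand, so a union bound over the mesh would lose a factor
    exponential in n; the soft maximum pays a power of the logarithm of the number of mesh points
    instead. Its gradient, the Gibbs weights, depends on the past only, so weighting an increment by
    it keeps the increment centred. No conditional expectation is formed: an increment is the
    difference of two nonnegative sums, each pairing one of the two densities with the positive part
    of the wave and the other with the negative part, and their Gibbs-weighted expectations agree.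
    Measurability forces a detour through Riemann sums: independence is applied on grids refined by
    a factor kappa, the bounds there are uniform in kappa, and kappa is chosen last, for each (m,
    n), so that passing to integrals costs a summable probability. All subexponential factors
    (classes, entropy of the mesh, polynomials in m) are paid from the gaps between three exponents
    s0 < s < tau: the decay to be proved, the one used on cubes, and the one allowed by the
    moments. *)

Section power_means.
Context {R : realType}.
Implicit Types a p : R.

(** Young's inequality for the product of [a] and 1 with conjugate exponents [p] and [p / (p - 1)];
    [p = 1] is apart because the second exponent degenerates. *)
Lemma powR_bernoulli a p : 0 <= a -> 1 <= p -> 1 + p * (a - 1) <= a `^ p.
Proof.
move=> a0 p1; have [->|p1'] := eqVneq p 1.
  by rewrite powRr1// mul1r addrC subrK.
have pgt1 : 1 < p by rewrite lt_neqAle eq_sym p1'.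
have p0 : 0 < p by lra.
have := @conjugate_powR R a 1 p (p / (p - 1)) a0 ler01 p0.
have q0 : 0 < p / (p - 1) by rewrite divr_gt0//; lra.
rewrite powR1 mulr1 => /(_ q0) h0.
have {h0} := h0 ltac:(by field; apply/andP; split; lra).
have -> : 1 / (p / (p - 1)) = (p - 1) / p by field; apply/andP; split; lra.
rewrite -mulrDl ler_pdivlMr// => h; nra.
Qed.

Lemma le_powR a b p : 0 <= p -> 0 <= a -> a <= b -> a `^ p <= b `^ p.
Proof.
by move=> p0 a0 ab; apply: ge0_ler_powR => //; rewrite nnegrE// (le_trans a0).
Qed.

(** Jensen's inequality for weights of arbitrary mass [C]: each power lies above its tangent at the
    mean [m = S / C], and the linear terms cancel in the weighted sum. *)
Lemma powR_mean (I : finType) (c z : I -> R) p : 1 <= p ->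
  (forall i, 0 <= c i) -> (forall i, 0 <= z i) ->
  (\sum_i c i * z i) `^ p <= (\sum_i c i) `^ (p - 1) * \sum_i c i * z i `^ p.
Proof.
move=> p1 c0 z0; set C := \sum_i c i; set S := \sum_i _.
have C0 : 0 <= C by exact: sumr_ge0.
have S0 : 0 <= S by apply: sumr_ge0 => i _; exact: mulr_ge0.
have rhs0 : 0 <= C `^ (p - 1) * \sum_i c i * z i `^ p.
  by rewrite mulr_ge0 ?powR_ge0// sumr_ge0// => i _; rewrite mulr_ge0// powR_ge0.
have [->|Sn0] := eqVneq S 0; first by rewrite powR0//; lra.
have Sp : 0 < S by rewrite lt_neqAle eq_sym Sn0.
have Cp : 0 < C.
  rewrite lt_neqAle C0 andbT; apply: contraNneq Sn0 => /esym C00.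
  rewrite /S big1// => i _.
  by have /eqP := C00; rewrite psumr_eq0// => /allP/(_ i (mem_index_enum _))/eqP ->; rewrite mul0r.
pose m := S / C; have mp : 0 < m by exact: divr_gt0.
have SE : S = C * m by rewrite /m mulrCA divff ?mulr1// gt_eqF.
have tang i : m `^ p * (1 + p * (z i / m - 1)) <= z i `^ p.
  have -> : z i `^ p = m `^ p * (z i / m) `^ p.
    rewrite -powRM; [|exact: ltW|by rewrite divr_ge0// ltW].
    by rewrite mulrCA divff ?mulr1// gt_eqF.
  by rewrite ler_pM2l ?powR_gt0//; apply: powR_bernoulli => //; rewrite divr_ge0// ltW.
have -> : S `^ p = C `^ (p - 1) * (C * m `^ p).
  by rewrite SE powRM// ?(ltW mp)// mulrA [_ * C]mulrC mulr_powRB1//; lra.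
rewrite ler_pM2l ?powR_gt0//.
have -> : C * m `^ p = \sum_i c i * (m `^ p * (1 + p * (z i / m - 1))).
  transitivity (m `^ p * ((1 - p) * C + p / m * S)).
    rewrite SE; field; lra.
  rewrite /C /S !mulr_sumr -big_split/= mulr_sumr; apply: eq_bigr => i _; field; lra.
by apply: ler_sum => i _; apply: ler_wpM2l.
Qed.

Lemma powR_sum_le (I : finType) (z : I -> R) p : 1 <= p ->
  (forall i, 0 <= z i) ->
  (\sum_i z i) `^ p <= #|I|%:R `^ (p - 1) * \sum_i z i `^ p.
Proof.
move=> p1 z0; have := @powR_mean I (fun=> 1) z p p1 (fun=> ler01) z0.
under eq_bigr do rewrite mul1r.
under [X in _ <= _ * X]eq_bigr do rewrite mul1r.
by rewrite sumr_const.
Qed.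

Lemma powRD_le a b p : 1 <= p -> 0 <= a -> 0 <= b ->
  (a + b) `^ p <= 2 `^ (p - 1) * (a `^ p + b `^ p).
Proof.
move=> p1 a0 b0; have := @powR_sum_le bool (fun i => if i then a else b) p p1.
by rewrite !big_bool card_bool/=; apply; case.
Qed.

Lemma powR_le1D a p q : 0 <= a -> 0 <= p <= q -> a `^ p <= 1 + a `^ q.
Proof.
move=> a0 /andP[p0 pq]; have [a1|a1] := leP 1 a.
  by rewrite (le_trans (ler_powR a1 pq))// lerDr.
rewrite (@le_trans _ _ 1)// ?lerDl ?powR_ge0//.
have -> : 1 = (1 : R) `^ p by rewrite powR1.
by apply: le_powR => //; exact: ltW.
Qed.

End power_means.

Section softmax.
Context {R : realType} {X : finType}.
Implicit Types u v : X -> R.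

Definition sexp u : R := \sum_x expR (u x).
Definition lse u : R := ln (sexp u).
(** The gradient of [lse] at [u]. *)
Definition gibbs u (x : X) : R := expR (u x) / sexp u.

Lemma sexp_gt0 u : (0 < #|X|)%N -> 0 < sexp u.
Proof.
move=> /card_gt0P[x0 _]; rewrite /sexp (bigD1 x0)//= ltr_pwDl ?expR_gt0//.
by apply: sumr_ge0 => x _; exact: expR_ge0.
Qed.

Lemma gibbs_ge0 u x : 0 <= gibbs u x.
Proof.
by rewrite divr_ge0 ?expR_ge0//; apply: sumr_ge0 => y _; exact: expR_ge0.
Qed.

Lemma gibbs_sum u : (0 < #|X|)%N -> \sum_x gibbs u x = 1.
Proof.
by move=> X0; rewrite /gibbs -mulr_suml divff// gt_eqF// sexp_gt0.
Qed.

Lemma gibbs_le1 u x : (0 < #|X|)%N -> gibbs u x <= 1.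
Proof.
move=> X0; rewrite -(gibbs_sum u X0) (bigD1 x)//= lerDl.
by apply: sumr_ge0 => y _; exact: gibbs_ge0.
Qed.

(** Since [1 - v <= expR (- v)], it suffices that [(1 + v + 2 * v ^+ 2) * (1 - v)], which equals
    [1 + v ^+ 2 * (1 - 2 * v)], be at least 1; hence the threshold 1/2. *)
Lemma expR_quadratic (v : R) : `|v| <= 2^-1 -> expR v <= 1 + v + 2 * v ^+ 2.
Proof.
rewrite ler_norml => /andP[v1 v2].
have h : 1 - v <= expR (- v) by exact: expR_ge1Dx.
have -> : expR v = (expR (- v))^-1 by rewrite expRN invrK.
rewrite -[leLHS]mul1r ler_pdivrMr ?expR_gt0//.
apply: (@le_trans _ _ ((1 + v + 2 * v ^+ 2) * (1 - v))); last first.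
  by apply: ler_wpM2l => //; nra.
nra.
Qed.

(* The log-sum-exp is 1-Lipschitz and has bounded Hessian for the sup norm;
   interpolating the two bounds gives smoothness of power type [p]. *)
Lemma lse_step u v (W p : R) : (0 < #|X|)%N -> 1 <= p <= 2 ->
  (forall x, `|v x| <= W) ->
  lse (fun x => u x + v x) <=
  lse u + \sum_x gibbs u x * v x + 4 * W `^ p.
Proof.
move=> X0 /andP[p1 p2] vW.
have W0 : 0 <= W by have /card_gt0P[x _] := X0; exact: le_trans (vW x).
have su := sexp_gt0 u X0.
have suv := sexp_gt0 (fun x => u x + v x) X0.
have mean_le : \sum_x gibbs u x * v x <= W.
  rewrite -[leRHS]mul1r -(gibbs_sum u X0) mulr_suml; apply: ler_sum => x _.
  by rewrite ler_wpM2l ?gibbs_ge0// (le_trans (ler_norm _)).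
have mean_ge : - W <= \sum_x gibbs u x * v x.
  rewrite -[leLHS]mul1r -(gibbs_sum u X0) mulr_suml; apply: ler_sum => x _.
  rewrite ler_wpM2l ?gibbs_ge0// lerNl (le_trans (ler_norm _))// normrN.
  exact: vW.
(* For [W > 1/2] the Lipschitz bound exceeds the linear term by at most [2 * W], which the last term
   absorbs: through [W <= W ^ p] if [W >= 1], otherwise through [W <= 2 * W ^+ 2] and
   [W ^+ 2 <= W ^ p]. *)
have [Wle|Wgt] := leP W 2^-1; last first.
  have lip : lse (fun x => u x + v x) <= lse u + W.
    rewrite -ler_expR expRD /lse !lnK ?posrE//.
    rewrite /sexp mulr_suml; apply: ler_sum => x _.
    by rewrite expRD ler_wpM2l ?expR_ge0// ler_expR (le_trans (ler_norm _)).
  suff : 2 * W <= 4 * W `^ p by lra.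
  have [W1|W1] := leP 1 W.
    have := le1r_powR W1 p1; lra.
  have : W `^ 2%:R <= W `^ p by apply: ger_powR => //; apply/andP; split; lra.
  rewrite powR_mulrn// => h; nra.
pose M := \sum_x gibbs u x * v x + 2 * W ^+ 2.
have step : sexp (fun x => u x + v x) <= sexp u * (1 + M).
  rewrite /M addrA mulrDr.
  have -> : sexp u * (1 + \sum_x gibbs u x * v x) + sexp u * (2 * W ^+ 2) =
      \sum_x expR (u x) * (1 + v x + 2 * W ^+ 2).
    rewrite mulrDr mulr1 mulr_sumr /sexp mulr_suml -!big_split/=.
    apply: eq_bigr => x _; rewrite -/(sexp u) /gibbs; field; lra.
  rewrite /sexp; apply: ler_sum => x _; rewrite expRD ler_wpM2l ?expR_ge0//.
  apply: (le_trans (expR_quadratic (le_trans (vW x) Wle))).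
  rewrite lerD2l ler_wpM2l// -[_ ^+ 2]real_normK ?num_real//.
  by rewrite ler_pXn2r ?nnegrE.
have M1 : 0 < 1 + M.
  by rewrite -(pmulr_rgt0 _ su); exact: lt_le_trans step.
have : lse (fun x => u x + v x) <= lse u + M.
  rewrite /lse; apply: (@le_trans _ _ (ln (sexp u * (1 + M)))).
    by rewrite ler_ln// ?posrE// mulr_gt0.
  by rewrite lnM ?posrE// lerD2l le_ln1Dx//; lra.
suff : 2 * W ^+ 2 <= 4 * W `^ p by rewrite /M; lra.
have [->|Wn0] := eqVneq W 0; first by rewrite expr0n/= mulr0 mulr_ge0// powR_ge0.
have : W `^ 2%:R <= W `^ p.
  by apply: ger_powR => //; apply/andP; split; [rewrite lt_neqAle eq_sym Wn0|lra].
by rewrite powR_mulrn// => h; have := powR_ge0 W p; lra.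
Qed.

Lemma lse_ge_max u x : u x <= lse u.
Proof.
have X0 : (0 < #|X|)%N by apply/card_gt0P; exists x.
rewrite -ler_expR /lse lnK ?posrE ?sexp_gt0// /sexp (bigD1 x)//= lerDl.
by apply: sumr_ge0 => y _; exact: expR_ge0.
Qed.

(** By [1 + u x <= expR (u x)]. For balanced families the excess of [lse] over its value at 0 is
    therefore nonnegative, and Markov's inequality applies to it. *)
Lemma lse_ge_card u : (0 < #|X|)%N -> \sum_x u x = 0 -> ln #|X|%:R <= lse u.
Proof.
move=> X0 u0; rewrite /lse ler_ln ?posrE ?sexp_gt0 ?ltr0n//.
have -> : #|X|%:R = \sum_(x : X) (1 + u x) by rewrite big_split/= u0 addr0 sumr_const.
by rewrite /sexp; apply: ler_sum => x _; exact: expR_ge1Dx.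
Qed.

Lemma lse0 : lse (fun=> 0) = ln #|X|%:R.
Proof. by rewrite /lse /sexp expR0 sumr_const. Qed.

End softmax.

Section oscillating_sum.
Context {R : realType} {T : finType}.
Variables (s s' : T -> T) (f g gp gm : T -> R) (c : R) (B B' : pred T).
Hypotheses (sK : cancel s s') (s'K : cancel s' s) (c1 : c <= 1).
Hypotheses (g1 : forall k, `|g k| <= 1) (gp1 : forall k, `|gp k| <= 1)
  (gm1 : forall k, `|gm k| <= 1).
Hypothesis gE : forall k, gp k + gm k = 2 * c * g k.
Hypotheses (gpE : forall k, ~~ B k -> gp k = g (s k))
  (gmE : forall k, ~~ B' k -> gm k = g (s' k)).
Hypothesis BB' : forall k, B' (s k) = B k.

Let reindex_s' (F : T -> R) : \sum_k F (s' k) = \sum_k F k.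
Proof.
by rewrite [RHS](reindex_inj (can_inj s'K)).
Qed.

Let reindex_s (F : T -> R) : \sum_k F (s k) = \sum_k F k.
Proof. by rewrite [RHS](reindex_inj (can_inj sK)). Qed.

(* Summation by parts: the wave [g] is an eigenvector of the second difference
   along [s], up to the boundary [B], [B'] where [s] wraps around. *)
Lemma oscillating_sum : (2 - 2 * c) * `|\sum_k f k * g k| <=
  2 * (\sum_(k | ~~ B k) `|f k - f (s k)|) +
  4 * (\sum_(k | B k) `|f k|) + 4 * (\sum_(k | B' k) `|f k|).
Proof.
have c0 : 0 <= 2 - 2 * c by have := c1; lra.
pose D := \sum_k `|f k - f (s k)|.
have DE : D = \sum_(k | ~~ B k) `|f k - f (s k)| + \sum_(k | B k) `|f k - f (s k)|.
  by rewrite /D (bigID B)/= addrC.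
have SB' : \sum_(k | B k) `|f (s k)| = \sum_(k | B' k) `|f k|.
  rewrite [RHS](reindex_inj (can_inj sK)).
  by apply: eq_bigl => k; rewrite BB'.
have DB : \sum_(k | B k) `|f k - f (s k)| <=
    \sum_(k | B k) `|f k| + \sum_(k | B' k) `|f k|.
  by rewrite -SB' -big_split/=; apply: ler_sum => k _; exact: ler_normB.
have bound2 (Q : pred T) (h k' : T -> R) : (forall k, ~~ Q k -> h k = k' k) ->
    (forall k, `|h k| <= 1) -> (forall k, `|k' k| <= 1) ->
    `|\sum_k f k * (h k - k' k)| <= 2 * \sum_(k | Q k) `|f k|.
  move=> hk h1 k1; apply: (le_trans (ler_norm_sum _ _ _)).
  rewrite (bigID Q)/= [X in _ + X]big1 ?addr0; last first.
    by move=> k Qk; rewrite hk// subrr mulr0 normr0.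
  rewrite mulr_sumr; apply: ler_sum => k _; rewrite normrM mulrC.
  rewrite ler_wpM2r//; apply: (le_trans (ler_normB _ _)).
  by have := h1 k; have := k1 k; lra.
(* By [gE] the factor [(2 - 2 * c) * g] is [2 * g - gp - gm]. Replacing [gp] and [gm] by the shifts
   of [g] lets a reindexing move the shifts onto [f], and leaves corrections supported on [B] and
   [B']. *)
have eqS : (2 - 2 * c) * (\sum_k f k * g k) =
   (\sum_k g k * (f k - f (s' k)) + \sum_k g k * (f k - f (s k)))
   - \sum_k f k * (gp k - g (s k)) - \sum_k f k * (gm k - g (s' k)).
  have e1 : \sum_k g k * f (s' k) = \sum_k g (s k) * f k.
    by rewrite -(reindex_s (fun k => g k * f (s' k))); under eq_bigr do rewrite sK.
  have e2 : \sum_k g k * f (s k) = \sum_k g (s' k) * f k.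
    by rewrite -(reindex_s' (fun k => g k * f (s k))); under eq_bigr do rewrite s'K.
  under [X in X + _ - _ - _]eq_bigr do rewrite mulrBr.
  under [X in _ + X - _ - _]eq_bigr do rewrite mulrBr.
  rewrite !sumrB e1 e2 mulr_sumr -!sumrB -big_split/= -!sumrB.
  apply: eq_bigr => k _; have := gE k => h.
  have -> : gm k = 2 * c * g k - gp k by rewrite -h; ring.
  ring.
have n1 : `|\sum_k g k * (f k - f (s k))| <= D.
  apply: (le_trans (ler_norm_sum _ _ _)); apply: ler_sum => k _.
  by rewrite normrM -[leRHS]mul1r ler_wpM2r.
have n2 : `|\sum_k g k * (f k - f (s' k))| <= D.
  apply: (le_trans (ler_norm_sum _ _ _)).
  rewrite /D -(reindex_s' (fun k => `|f k - f (s k)|)); apply: ler_sum => k _.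
  by rewrite normrM -[leRHS]mul1r ler_pM// s'K distrC.
have n3 := @bound2 B gp (fun k => g (s k)) gpE gp1 (fun k => g1 (s k)).
have n4 := @bound2 B' gm (fun k => g (s' k)) gmE gm1 (fun k => g1 (s' k)).
rewrite -[X in X * _]ger0_norm// -normrM eqS.
apply: (le_trans (ler_normB _ _)).
have h1 := ler_normB (\sum_k g k * (f k - f (s' k)) + \sum_k g k * (f k - f (s k)))
  (\sum_k f k * (gp k - g (s k))).
have h2 := ler_normD (\sum_k g k * (f k - f (s' k))) (\sum_k g k * (f k - f (s k))).
rewrite DE in n1 n2; lra.
Qed.

End oscillating_sum.

(** * Expectations and independence *)

Local Notation Ex := expectation.

Section nonneg_expectation.
Context {dO : measure_display} {Omega : measurableType dO} {R : realType}.
Variable Pr : probability Omega R.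
Implicit Types X Y : Omega -> R.

Lemma ExZ (c : R) X : measurable_fun setT X -> (forall w, 0 <= X w) -> 0 <= c ->
  Ex Pr (fun w => c * X w) = (c%:E * Ex Pr X)%E.
Proof.
move=> mX X0 c0; rewrite unlock.
have mX' : measurable_fun setT (EFin \o X) by exact/measurable_EFinP.
have X0' : forall w, setT w -> (0 <= (EFin \o X) w)%E.
  by move=> w _; rewrite lee_fin.
have c0' : (0 <= c%:E)%E by rewrite lee_fin.
by have := ge0_integralZl Pr measurableT mX' X0' c0'.
Qed.

Lemma ExD X Y : measurable_fun setT X -> (forall w, 0 <= X w) ->
  measurable_fun setT Y -> (forall w, 0 <= Y w) ->
  Ex Pr (fun w => X w + Y w) = (Ex Pr X + Ex Pr Y)%E.
Proof.
move=> mX X0 mY Y0; rewrite unlock; under eq_integral do rewrite EFinD.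
by apply: ge0_integralD => //; [move=> w _; rewrite lee_fin|exact/measurable_EFinP|
  move=> w _; rewrite lee_fin|exact/measurable_EFinP].
Qed.

Lemma Ex_sum (I : Type) (r : seq I) (Q : pred I) (X : I -> Omega -> R) :
  (forall i, Q i -> measurable_fun setT (X i)) ->
  (forall i, Q i -> forall w, 0 <= X i w) ->
  Ex Pr (fun w => \sum_(i <- r | Q i) X i w) = (\sum_(i <- r | Q i) Ex Pr (X i))%E.
Proof.
move=> mX X0; rewrite unlock big_mkcond.
pose X' i w := if Q i then X i w else 0.
have mX' i : measurable_fun setT (EFin \o X' i).
  apply/measurable_EFinP; rewrite /X'; case: (boolP (Q i)) => [Qi|_] //.
  exact: mX.
have X0' i w : setT w -> (0 <= (EFin \o X' i) w)%E.
  by rewrite lee_fin /X'; case: (boolP (Q i)) => // Qi _; exact: X0.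
under eq_integral do rewrite big_mkcond -sumEFin.
rewrite (ge0_integral_sum Pr measurableT mX' X0').
apply: eq_bigr => i _; rewrite /X'; case: (Q i) => //=.
by rewrite integral0.
Qed.

Lemma Ex_le X Y : measurable_fun setT X -> (forall w, 0 <= X w) ->
  measurable_fun setT Y -> (forall w, X w <= Y w) -> (Ex Pr X <= Ex Pr Y)%E.
Proof.
move=> mX X0 mY XY; rewrite unlock; apply: ge0_le_integral => //.
- by move=> w _; rewrite lee_fin.
- exact/measurable_EFinP.
- exact/measurable_EFinP.
- by move=> w _; rewrite lee_fin.
Qed.

Lemma Ex_markov (c : R) X : measurable_fun setT X -> (forall w, 0 <= X w) -> 0 <= c ->
  (c%:E * Pr [set w | (c <= X w)%R] <= Ex Pr X)%E.
Proof.
move=> mX X0 c0.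
have mS : measurable [set w | c <= X w].
  rewrite -[X in measurable X]setTI (_ : [set w | _] = X @^-1` `[c, +oo[%classic).
    exact: mX.
  by apply/seteqP; split => w /=; rewrite in_itv/= andbT.
rewrite unlock -[leLHS](_ : \int[Pr]_(w in [set w | (c <= X w)%R]) c%:E = _)%E; last first.
  by rewrite integral_cst.
apply: (@le_trans _ _ (\int[Pr]_(w in [set w | (c <= X w)%R]) (X w)%:E)%E).
  have mX' : measurable_fun [set w | (c <= X w)%R] (EFin \o X).
    by apply/measurable_EFinP; exact: measurable_funTS.
  exact: ge0_le_integral.
apply: ge0_subset_integral => //.
  exact/measurable_EFinP.
by move=> w _; rewrite lee_fin.
Qed.

End nonneg_expectation.

Section independence_integral.
Context {dO : measure_display} {Omega : measurableType dO} {R : realType}.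
Variable Pr : probability Omega R.
Variable G : set (set Omega).
Hypotheses (Gm : G `<=` measurable) (GI : setI_closed G) (GT : G setT).

Let GO : measurableType _ := g_sigma_algebraType G.

Lemma sub_sigma_algebra_measurable : <<s G >> `<=` measurable.
Proof. exact: (smallest_sub (@sigma_algebra_measurable _ Omega) Gm). Qed.

Lemma measurable_fun_sub {d'} {T' : measurableType d'} (X : Omega -> T') :
  measurable_fun (setT : set GO) X -> measurable_fun setT X.
Proof.
move=> mX _ B mB; apply: sub_sigma_algebra_measurable.
exact: (mX measurableT B mB).
Qed.

(** Uniqueness of measures on a pi-system, for the restriction of [Pr] to [B] and the multiple of
    [Pr] by [Pr B]. *)
Lemma independent_sigma (B : set Omega) : measurable B ->
  (forall A, G A -> Pr (A `&` B) = (Pr A * Pr B)%E) ->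
  forall A, <<s G >> A -> Pr (A `&` B) = (Pr A * Pr B)%E.
Proof.
move=> mB indep A sA.
have PBfin : Pr B \is a fin_num by exact: fin_num_measure.
have PB0 : 0 <= fine (Pr B) by rewrite fine_ge0.
pose m1 : {measure set Omega -> \bar R} := mrestr Pr mB.
pose m2 : {measure set Omega -> \bar R} := mscale (NngNum PB0) Pr.
have := @g_sigma_algebra_measure_unique _ _ _ G Gm (fun=> setT) (fun=> GT)
  _ m1 m2 GI.
have -> : \bigcup_(_ : nat) [set: Omega] = setT.
  by rewrite -subTset => x _; exists 0%N.
move=> /(_ erefl) h; have := h _ _ A sA.
have m1E C : m1 C = Pr (C `&` B) by [].
have m2E C : m2 C = (Pr C * Pr B)%E by rewrite muleC -[X in (X * _)%E](fineK PBfin).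
rewrite -m1E -m2E; apply.
  by move=> C GC; rewrite m1E m2E indep.
by move=> _; rewrite m1E setTI ltey_eq PBfin.
Qed.

(** The law of the pair formed by the identity into the sub-sigma-algebra and [Z] is a product
    measure, so Tonelli's theorem factors the integral. Taking the identity rather than [X] allows
    independence to be tested on [G] alone. *)
Lemma independent_integralM (X Z : Omega -> R) :
  measurable_fun (setT : set GO) X -> (forall w, 0 <= X w) ->
  measurable_fun setT Z -> (forall w, 0 <= Z w) ->
  (forall A B, G A -> measurable B ->
     Pr (A `&` Z @^-1` B) = (Pr A * Pr (Z @^-1` B))%E) ->
  Ex Pr (fun w => X w * Z w) = (Ex Pr X * Ex Pr Z)%E.
Proof.
move=> mX X0 mZ Z0 indep.
have mid : measurable_fun setT (id : Omega -> GO).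
  move=> _ B mB; rewrite setTI preimage_id.
  exact: sub_sigma_algebra_measurable.
pose idm : {mfun Omega >-> GO} := mfun_Sub (mem_set mid).
pose Zm : {mfun Omega >-> R} := mfun_Sub (mem_set mZ).
have mJ : measurable_fun setT (fun w => (w, Z w) : GO * R).
  by apply/measurable_fun_pairP; split.
pose Jm : {mfun Omega >-> (GO * R)%type} := mfun_Sub (mem_set mJ).
pose mu1 : probability GO R := distribution Pr idm.
pose mu2 : probability (R) R := distribution Pr Zm.
pose mu12 : probability _ R := distribution Pr Jm.
have mu12E : forall C, measurable C -> (mu1 \x mu2)%E C = mu12 C.
  apply: product_measure_unique => A B mA mB.
  change (Pr (A `&` Z @^-1` B) = Pr A * Pr (Z @^-1` B))%E.
  apply: independent_sigma => //.
    by rewrite -[X in measurable X]setTI; exact: (mZ measurableT B mB).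
  by move=> C GC; exact: indep.
pose GOR : measurableType _ := (GO * (R : measurableType _))%type.
(* Tonelli's theorem wants an integrand that is nonnegative on the whole product, while [Z] is
   nonnegative only along its values; hence the maximum with 0. *)
pose h (z : GOR) : \bar R := (X z.1 * Num.max z.2 0)%:E.
have h0 z : (0 <= h z)%E by rewrite lee_fin mulr_ge0// le_max lexx orbT.
have mh : measurable_fun setT h.
  apply/measurable_EFinP; apply: measurable_funM.
    exact: (measurableT_comp mX measurable_fst).
  by apply: measurable_maxr => //; exact: measurable_snd.
rewrite {1}unlock; transitivity (\int[mu12]_z h z)%E.
  rewrite /mu12 /distribution ge0_integral_pushforward//.
  by apply: eq_integral => w _ /=; rewrite /h/= max_l.
transitivity (\int[mu1 \x mu2]_z h z)%E.
  by apply: eq_measure_integral => C mC _; exact/esym/mu12E.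
rewrite fubini_tonelli1//= /fubini_F.
have EZ : forall x, (\int[mu2]_y h (x, y) = (X x)%:E * Ex Pr Z)%E.
  move=> x; rewrite /mu2 /distribution ge0_integral_pushforward//; last first.
    exact: (measurableT_comp mh (pair1_measurable x)).
  by rewrite -ExZ// unlock preimage_setT; apply: eq_integral => w _; rewrite /h/= max_l.
under eq_integral do rewrite EZ.
have mXe : measurable_fun (setT : set GO) (EFin \o X) by exact/measurable_EFinP.
have X0e : forall x, setT x -> (0 <= (EFin \o X) x)%E by move=> x _; rewrite lee_fin.
have := ge0_integralZr mu1 measurableT mXe X0e (expectation_ge0 Pr Z0).
rewrite /= => ->; congr (_ * _)%E.
rewrite /mu1 /distribution (ge0_integral_pushforward mid Pr measurableT mXe).
  by rewrite preimage_id unlock.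
by move=> x _; rewrite lee_fin.
Qed.

End independence_integral.

Section measurable_softmax.
Context {d : measure_display} {T : measurableType d} {R : realType} {X : finType}.
Variable u : X -> T -> R.
Hypothesis mu : forall x, measurable_fun setT (u x).

Lemma measurable_lse : measurable_fun setT (fun w => lse (u ^~ w)).
Proof.
apply: (measurableT_comp (@measurable_ln R)).
by apply: measurable_sum => x; exact: measurableT_comp.
Qed.

Lemma measurable_gibbs x : measurable_fun setT (fun w => gibbs (u ^~ w) x).
Proof.
have X0 : (0 < #|X|)%N by apply/card_gt0P; exists x.
rewrite (_ : (fun w => _) = fun w => expR (u x w - lse (u ^~ w))); last first.
  by apply/funext => w; rewrite expRB /lse lnK ?posrE ?sexp_gt0.
by apply: measurableT_comp => //; apply: measurable_funB => //; exact: measurable_lse.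
Qed.
End measurable_softmax.

(** * A maximal inequality for independent sums *)

Section maximal_inequality.
Context {dO : measure_display} {Omega : measurableType dO} {R : realType}.
Variables (Pr : probability Omega R) (X : finType) (p : R) (n : nat).
Variables (Y1 Y2 : nat -> X -> Omega -> R) (W : nat -> Omega -> R).
Hypotheses (X0 : (0 < #|X|)%N) (p12 : 1 <= p <= 2).
Hypotheses (mY1 : forall i x, (i < n)%N -> measurable_fun setT (Y1 i x))
  (mY2 : forall i x, (i < n)%N -> measurable_fun setT (Y2 i x))
  (mW : forall i, (i < n)%N -> measurable_fun setT (W i)).
Hypotheses (Y10 : forall i x w, (i < n)%N -> 0 <= Y1 i x w)
  (Y20 : forall i x w, (i < n)%N -> 0 <= Y2 i x w).
Hypothesis YW : forall i x w, (i < n)%N -> `|Y1 i x w - Y2 i x w| <= W i w.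
Hypothesis Ysym : forall i w, (i < n)%N -> \sum_x (Y1 i x w - Y2 i x w) = 0.

Let S i x w := \sum_(j < i) (Y1 j x w - Y2 j x w).
(** The inverse temperature: if some [S n x] reaches 1, then [lse] of [a * S n] is at least [a],
    that is, one more than its minimum [ln #|X|%:R]. *)
Let a := 1 + ln (#|X|%:R : R).

Hypothesis Y2fin : forall i x, (i < n)%N -> (Ex Pr (Y2 i x) < +oo)%E.
(** This replaces the martingale property: the Gibbs weights at step [i] are functions of the
    earlier increments, and against them [Y1] and [Y2] have the same mean. *)
Hypothesis centred : forall i x, (i < n)%N ->
  Ex Pr (fun w => gibbs (fun y => a * S i y w) x * Y1 i x w) =
  Ex Pr (fun w => gibbs (fun y => a * S i y w) x * Y2 i x w).

Let a1 : 1 <= a.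
Proof. by rewrite lerDl ln_ge0// ler1n. Qed.

Let mS i x : (i <= n)%N -> measurable_fun setT (S i x).
Proof.
move=> ik; apply: measurable_sum => j.
have jn : (j < n)%N by exact: leq_trans (ltn_ord j) ik.
by apply: measurable_funB; [exact: mY1|exact: mY2].
Qed.

Let maS i x : (i <= n)%N -> measurable_fun setT (fun w => a * S i x w).
Proof. by move=> ik; apply: measurable_funM => //; exact: mS. Qed.

Let F i w := lse (fun x => a * S i x w).

Let mF i : (i <= n)%N -> measurable_fun setT (F i).
Proof. by move=> ik; apply: measurable_lse => x; exact: maS. Qed.

Let Sbal i w : (i <= n)%N -> \sum_x a * S i x w = 0.
Proof.
move=> ik; rewrite -mulr_sumr exchange_big/= big1 ?mulr0// => j _.
by rewrite Ysym// (leq_trans (ltn_ord j)).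
Qed.

Let F_ge i w : (i <= n)%N -> ln #|X|%:R <= F i w.
Proof. by move=> ik; apply: lse_ge_card => //; exact: Sbal. Qed.

Let F_ge0 i w : (i <= n)%N -> 0 <= F i w.
Proof. by move=> ik; apply: le_trans (F_ge w ik); rewrite ln_ge0// ler1n. Qed.

Let mgY i x (Y : Omega -> R) : (i <= n)%N -> measurable_fun setT Y ->
  measurable_fun setT (fun w => gibbs (fun y => a * S i y w) x * Y w).
Proof.
move=> ik mY; apply: measurable_funM => //.
by apply: measurable_gibbs => y; exact: maS.
Qed.

Let step i : (i < n)%N ->
  (Ex Pr (F i.+1) <= Ex Pr (F i) + (4 * a `^ p)%:E * Ex Pr (fun w => (W i w `^ p)%R))%E.
Proof.
move=> ik; have ik' := ltnW ik.
pose V1 w := \sum_x gibbs (fun y => a * S i y w) x * Y1 i x w.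
pose V2 w := \sum_x gibbs (fun y => a * S i y w) x * Y2 i x w.
have V10 w : 0 <= V1 w by apply: sumr_ge0 => x _; rewrite mulr_ge0 ?gibbs_ge0// Y10.
have V20 w : 0 <= V2 w by apply: sumr_ge0 => x _; rewrite mulr_ge0 ?gibbs_ge0// Y20.
have mV1 : measurable_fun setT V1 by apply: measurable_sum => x; apply: mgY => //; exact: mY1.
have mV2 : measurable_fun setT V2 by apply: measurable_sum => x; apply: mgY => //; exact: mY2.
have V12 : Ex Pr V1 = Ex Pr V2.
  rewrite /V1 /V2 !Ex_sum.
  - by apply: eq_bigr => x _; exact: centred.
  - by move=> x _; apply: mgY => //; exact: mY2.
  - by move=> x _ w; rewrite mulr_ge0 ?gibbs_ge0// Y20.
  - by move=> x _; apply: mgY => //; exact: mY1.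
  - by move=> x _ w; rewrite mulr_ge0 ?gibbs_ge0// Y10.
have V2fin : Ex Pr V2 \is a fin_num.
  rewrite ge0_fin_numE ?expectation_ge0// /V2 Ex_sum; last 2 first.
  - by move=> x _; apply: mgY => //; exact: mY2.
  - by move=> x _ w; rewrite mulr_ge0 ?gibbs_ge0// Y20.
  apply: lte_sum_pinfty => x _; apply: le_lt_trans (Y2fin x ik).
  apply: Ex_le.
  - by apply: mgY => //; exact: mY2.
  - by move=> w; rewrite mulr_ge0 ?gibbs_ge0// Y20.
  - exact: mY2.
  - by move=> w; rewrite ler_piMl ?Y20// gibbs_le1.
have a0 : 0 <= a by exact: le_trans a1.
have W0 w : 0 <= W i w.
  by have /card_gt0P[x _] := X0; apply: le_trans (YW x w ik).
have mWp : measurable_fun setT (fun w => (W i w `^ p)%R).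
  by apply: (measurableT_comp (@measurable_powR R p)); exact: mW.
(* The negative part of the drift stands on the left, so that both sides are nonnegative; the finite
   quantity [a * Ex Pr V2] is cancelled after taking expectations. *)
have ptw w : F i.+1 w + a * V2 w <= F i w + a * V1 w + (4 * a `^ p) * W i w `^ p.
  have := @lse_step R X (fun x => a * S i x w)
    (fun x => a * (Y1 i x w - Y2 i x w)) (a * W i w) p X0 p12.
  have -> : lse (fun x => a * S i x w + a * (Y1 i x w - Y2 i x w)) = F i.+1 w.
    by congr lse; apply/funext => x; rewrite -mulrDr /S big_ord_recr.
  rewrite powRM// mulrA => /(_ _)h.
  have {h} h : F i.+1 w <= lse (fun x => a * S i x w) +
    \sum_x gibbs (fun x => a * S i x w) x * (a * (Y1 i x w - Y2 i x w)) +
    4 * a `^ p * W i w `^ p.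
    by apply: h => x; rewrite normrM ger0_norm// ler_wpM2l// YW.
  apply: (le_trans (lerD h (lexx _))).
  rewrite le_eqVlt; apply/orP; left; apply/eqP.
  have -> : \sum_x gibbs (fun x => a * S i x w) x * (a * (Y1 i x w - Y2 i x w)) =
    a * V1 w - a * V2 w.
    by rewrite !mulr_sumr -sumrB; apply: eq_bigr => x _; ring.
  by rewrite /F; ring.
have ma (V : Omega -> R) : measurable_fun setT V -> measurable_fun setT (fun w => a * V w).
  by move=> mV; apply: measurable_funM.
have aV0 (V : Omega -> R) : (forall w, 0 <= V w) -> forall w : Omega, 0 <= a * V w.
  by move=> V0 w; rewrite mulr_ge0.
have ap0 : 0 <= 4 * a `^ p by rewrite mulr_ge0 ?powR_ge0.
have Wp0 w : 0 <= W i w `^ p by exact: powR_ge0.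
have mFi := mF ik'; have Fi0 w := F_ge0 w ik'.
have mFi1 := mF ik; have Fi10 w := F_ge0 w ik.
have mFa : measurable_fun setT (fun w => F i w + a * V1 w).
  by apply: measurable_funD => //; exact: ma.
have Fa0 w : 0 <= F i w + a * V1 w by rewrite addr_ge0 ?aV0.
have mWa : measurable_fun setT (fun w => 4 * a `^ p * W i w `^ p).
  by apply: measurable_funM.
have Wa0 w : 0 <= 4 * a `^ p * W i w `^ p by rewrite mulr_ge0.
have L1 : Ex Pr (fun w => F i.+1 w + a * V2 w) = (Ex Pr (F i.+1) + a%:E * Ex Pr V2)%E.
  by rewrite (ExD Pr mFi1 Fi10 (ma _ mV2) (aV0 _ V20)) ExZ.
have L2 : Ex Pr (fun w => F i w + a * V1 w + 4 * a `^ p * W i w `^ p) =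
    (Ex Pr (F i) + (4 * a `^ p)%:E * Ex Pr (fun w => (W i w `^ p)%R) + a%:E * Ex Pr V2)%E.
  rewrite (ExD Pr mFa Fa0 mWa Wa0) (ExD Pr mFi Fi0 (ma _ mV1) (aV0 _ V10)).
  by rewrite !ExZ// V12 addeAC.
have : (Ex Pr (fun w => (F i.+1 w + a * V2 w)%R) <=
    Ex Pr (fun w => (F i w + a * V1 w + 4 * a `^ p * W i w `^ p)%R))%E.
  apply: Ex_le => //.
  - by apply: measurable_funD => //; exact: ma.
  - by move=> w; rewrite addr_ge0 ?aV0.
  - exact: measurable_funD.
by rewrite L1 L2 leeD2rE// fin_numM.
Qed.

(** The steps add up from [lse0], and Markov's inequality is applied to the excess
    [F n - ln #|X|%:R]. The size of the family enters through [a ^ p] only, a power of its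
    logarithm. *)
Lemma maximal_inequality :
  (Pr [set w | exists x, (1 <= S n x w)%R] <=
   (4 * a `^ p)%:E * \sum_(i < n) Ex Pr (fun w => (W i w `^ p)%R))%E.
Proof.
have a0 : 0 <= a by exact: le_trans a1.
have ap0 : 0 <= 4 * a `^ p by rewrite mulr_ge0 ?powR_ge0.
have EF i : (i <= n)%N -> (Ex Pr (F i) <= (ln #|X|%:R)%:E +
    (4 * a `^ p)%:E * \sum_(j < i) Ex Pr (fun w => (W j w `^ p)%R))%E.
  elim: i => [_|i IH ik].
    rewrite big_ord0 mule0 adde0 (_ : F 0 = fun=> ln #|X|%:R) ?expectation_cst//.
    apply/funext => w; rewrite -lse0 /F; congr lse; apply/funext => x.
    by rewrite /S big_ord0 mulr0.
  apply: (le_trans (step ik)); rewrite big_ord_recr/= ge0_muleDr.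
  - by rewrite addeA; apply: leeD2r; apply: IH; exact: ltnW.
  - by apply: sume_ge0 => j _; apply: expectation_ge0 => w; exact: powR_ge0.
  - by apply: expectation_ge0 => w; exact: powR_ge0.
pose G w := F n w - ln #|X|%:R.
have mG : measurable_fun setT G by apply: measurable_funB => //; exact: mF.
have G0 w : 0 <= G w by rewrite subr_ge0 F_ge.
have lnX0 : 0 <= ln #|X|%:R :> R by rewrite ln_ge0// ler1n.
have EG : (Ex Pr G <= (4 * a `^ p)%:E * \sum_(j < n) Ex Pr (fun w => (W j w `^ p)%R))%E.
  have := EF n (leqnn n).
  rewrite (_ : F n = fun w => ln #|X|%:R + G w); last first.
    by apply/funext => w; rewrite /G addrC subrK.
  by rewrite ExD ?expectation_cst ?leeD2lE.
apply: le_trans EG.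
have := Ex_markov Pr mG G0 ler01; rewrite mul1e; apply: le_trans.
have mS1 x : measurable [set w | (1 <= S n x w)%R].
  rewrite -[X in measurable X]setTI (_ : [set w | _] = S n x @^-1` `[1, +oo[%classic).
    by apply: mS.
  by apply/seteqP; split => w /=; rewrite in_itv/= andbT.
apply: le_measure; rewrite ?inE.
- rewrite (_ : [set w | _] = \bigcup_(x in [set: X]) [set w | (1 <= S n x w)%R]).
    by apply: fin_bigcup_measurable => //; exact: finite_finset.
  by apply/seteqP; split => [w [x Sx]|w [x _ Sx]]; exists x.
- rewrite -[X in measurable X]setTI (_ : [set w | _] = G @^-1` `[1, +oo[%classic).
    exact: mG.
  by apply/seteqP; split => w /=; rewrite in_itv/= andbT.
- move=> w [x Sx] /=; rewrite /G lerBrDr -/a /F.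
  apply: le_trans (lse_ge_max (fun x => a * S n x w) x).
  by rewrite -[leLHS]mulr1 ler_wpM2l.
Qed.

End maximal_inequality.

(** * Independence between levels and between cubes of one level *)

Section mutual_independence.
Context {dO : measure_display} {Omega : measurableType dO} {R : realType}.
Variable Pr : probability Omega R.

Lemma mutually_independentS {I : choiceType} (A B : set I) (F G : I -> set (set Omega)) :
  A `<=` B -> (forall i, A i -> F i `<=` G i) ->
  mutually_independent Pr B G -> mutually_independent Pr A F.
Proof.
move=> AB FG BG J E JE; apply: BG => i iJ; have [Ai Fi] := JE _ iJ.
by split; [exact: AB|exact: FG].
Qed.

Lemma mutually_independent1 {I : choiceType} (A : set I) (F : I -> set (set Omega))
    (J : {fset I}) (i0 : I) (E : I -> set Omega) (B : set Omega) :
  mutually_independent Pr A F -> i0 \notin J ->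
  (forall i, i \in J -> A i /\ F i (E i)) -> A i0 -> F i0 B ->
  Pr ((\bigcap_(i in [set` J]) E i) `&` B) =
  (Pr (\bigcap_(i in [set` J]) E i) * Pr B)%E.
Proof.
move=> ind i0J JE Ai0 FB.
(* [F i0] is an arbitrary family of sets; the finiteness of [Pr B] is read off the independence
   relation for the single index [i0]. *)
have hB : Pr B = (fine (Pr B))%:E.
  have := ind [fset i0]%fset (fun=> B).
  rewrite big_seq_fset1 set_fset1 bigcap_set1 => -> //.
  by move=> i; rewrite inE => /eqP ->.
rewrite (ind J E JE) hB -EFinM.
pose E' i := if i == i0 then B else E i.
have E'J i : i \in J -> E' i = E i.
  by move=> iJ; rewrite /E'; case: eqP => // ii0; rewrite -ii0 iJ in i0J.
have := ind (i0 |` J)%fset E'.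
have E'0 : E' i0 = B by rewrite /E' eqxx.
rewrite big_fsetU1//= E'0 mulrC.
rewrite (_ : \prod_(i <- J) fine (Pr (E' i)) = \prod_(i <- J) fine (Pr (E i))); last first.
  by rewrite big_seq [RHS]big_seq; apply: eq_bigr => i iJ; rewrite E'J.
move=> <-.
  congr (Pr _); apply/seteqP; split=> [w [Jw Bw] i /=|w Jw].
    rewrite !inE /E' => /orP[/eqP->|iJ]; first by rewrite eqxx.
    by case: eqP => // _; exact: Jw.
  split; last by have := Jw i0; rewrite /E' eqxx; apply; rewrite /= !inE eqxx.
  by move=> i iJ; rewrite -E'J//; apply: Jw; rewrite /= !inE iJ orbT.
move=> i; rewrite !inE => /orP[/eqP ->|iJ]; first by rewrite /E' eqxx.
by rewrite E'J//; exact: JE.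
Qed.

End mutual_independence.

Section two_level_independence.
Context {dO : measure_display} {Omega : measurableType dO} {R : realType}.
Variables (Pr : probability Omega R) (I J : choiceType).
Variables (f : I -> set (set Omega)) (g : J -> set (set Omega)).
Hypothesis fm : forall i, f i `<=` measurable.
Variables (A : {fset I}) (i0 : I) (B : {fset J}) (j0 : J).
Hypotheses (i0A : i0 \notin A) (j0B : j0 \notin B).
Hypothesis gf : forall j, <<s g j >> `<=` <<s f i0 >>.
Hypothesis find : mutually_independent Pr setT (fun i => <<s f i >>).
Hypothesis gind : mutually_independent Pr [set` (j0 |` B)%fset] (fun j => <<s g j >>).

Let Gf i := sub_sigma_algebra_measurable (@fm i).

(** A pi-system generating the past of the cube [j0]: events of the earlier levels [A], intersected
    with events of the cubes [B] of level [i0] already treated. *)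
Definition past_pi : set (set Omega) :=
  [set C | exists (E : I -> set Omega) (E' : J -> set Omega),
    [/\ forall i, <<s f i >> (E i), forall j, <<s g j >> (E' j)
      & C = (\bigcap_(i in [set` A]) E i) `&` (\bigcap_(j in [set` B]) E' j)]].

Let sigmaT (h : set (set Omega)) : <<s h >> setT.
Proof. exact: (@measurableT _ (g_sigma_algebraType h)). Qed.

Let sigmaI (h : set (set Omega)) C D : <<s h >> C -> <<s h >> D -> <<s h >> (C `&` D).
Proof. exact: (@measurableI _ (g_sigma_algebraType h)). Qed.

Let gm j : <<s g j >> `<=` measurable.
Proof. by move=> C /gf; exact: Gf. Qed.

Lemma past_pi_measurable : past_pi `<=` measurable.
Proof.
move=> _ [E [E' [fE gE' ->]]]; apply: measurableI.
  by apply: fin_bigcap_measurable => // i _; exact: (Gf (fE i)).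
by apply: fin_bigcap_measurable => // j _; exact: (gm (gE' j)).
Qed.

Lemma past_piT : past_pi setT.
Proof.
exists (fun=> setT), (fun=> setT); split => //.
by rewrite bigcapT// bigcapT// setIT.
Qed.

Lemma past_piI : setI_closed past_pi.
Proof.
move=> _ _ [E [E' [fE gE' ->]]] [D [D' [fD gD' ->]]].
exists (fun i => E i `&` D i), (fun j => E' j `&` D' j); split.
- by move=> i; exact: sigmaI.
- by move=> j; exact: sigmaI.
- by rewrite !bigcapI setIACA.
Qed.

Lemma past_pif i : i \in A -> <<s f i >> `<=` past_pi.
Proof.
move=> iA C fC; exists (fun k => if k == i then C else setT), (fun=> setT).
split => //; first by move=> k; case: eqP => // ->.
rewrite [X in _ `&` X]bigcapT// setIT; apply/seteqP; split => w.
  by move=> Cw k _; case: eqP.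
by move=> /(_ i iA); rewrite eqxx.
Qed.

Lemma past_pig j : j \in B -> <<s g j >> `<=` past_pi.
Proof.
move=> jB C gC; exists (fun=> setT), (fun k => if k == j then C else setT).
split => //; first by move=> k; case: eqP => // ->.
rewrite [X in X `&` _]bigcapT// setTI; apply/seteqP; split => w.
  by move=> Cw k _; case: eqP.
by move=> /(_ j jB); rewrite eqxx.
Qed.

(** Independence is used twice: between levels, where the events [K] and [K] with [D] both belong to
    level [i0], and between the cubes of that level, to separate [K] from [D]. *)
Lemma past_pi_indep C D : past_pi C -> <<s g j0 >> D ->
  Pr (C `&` D) = (Pr C * Pr D)%E.
Proof.
move=> [E [E' [fE gE' ->]]] gD; set K := \bigcap_(j in [set` B]) E' j.
have fK : <<s f i0 >> K.
  by apply: (@fin_bigcap_measurable _ (g_sigma_algebraType (f i0))) => // j _; exact: (gf (gE' j)).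
have KD : Pr (K `&` D) = (Pr K * Pr D)%E.
  apply: (mutually_independent1 gind j0B) => //.
  - by move=> j jB; split => //; exact: fset1Ur.
  - exact: fset1U1.
have EJ i : i \in A -> setT i /\ <<s f i >> (E i) by [].
rewrite -setIA (mutually_independent1 find i0A EJ Logic.I)//; last first.
  by apply: sigmaI => //; exact: (gf gD).
by rewrite (mutually_independent1 find i0A EJ Logic.I fK) KD muleA.
Qed.

End two_level_independence.

Section product_expectation.
Context {dO : measure_display} {Omega : measurableType dO} {R : realType}.
Variable Pr : probability Omega R.

Lemma measurable_fun_sigmaS (G H : set (set Omega)) (X : Omega -> R) :
  <<s G >> `<=` <<s H >> ->
  measurable_fun (setT : set (g_sigma_algebraType G)) X ->
  measurable_fun (setT : set (g_sigma_algebraType H)) X.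
Proof. by move=> GH mX _ B mB; apply: GH; exact: (mX measurableT B mB). Qed.

(** This makes independence of whole levels an instance of the two-level statement: a single cube
    [tt] and no cube before it. *)
Lemma mutually_independent_unit (F : set (set Omega)) :
  F `<=` measurable -> mutually_independent Pr [set` (tt |` fset0)%fset] (fun=> F).
Proof.
move=> Fm J E JE.
have [tJ|tJ] := boolP (tt \in J); last first.
  have -> : J = fset0.
    by apply/fsetP => -[]; rewrite (negbTE tJ) inE.
  by rewrite set_fset0 bigcap_set0 big_seq_fset0 probability_setT.
have -> : J = [fset tt]%fset by apply/fsetP => -[]; rewrite tJ inE.
rewrite set_fset1 bigcap_set1 big_seq_fset1 fineK// fin_num_measure//.
by apply: Fm; case: (JE _ tJ).
Qed.

Variable f : nat -> set (set Omega).
Hypothesis fm : forall i, f i `<=` measurable.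
Hypothesis find : mutually_independent Pr setT (fun i => <<s f i >>).

Let below m : {fset nat} := [fset j | j in iota 0 m]%fset.

Let in_below m j : (j \in below m) = (j < m)%N.
Proof. by rewrite /below inE/= mem_iota. Qed.

Lemma expectation_prod (X : nat -> Omega -> R) m :
  (forall j w, 0 <= X j w) ->
  (forall j, measurable_fun (setT : set (g_sigma_algebraType (f j))) (X j)) ->
  Ex Pr (fun w => \prod_(j < m) X j w) = (\prod_(j < m) Ex Pr (X j))%E.
Proof.
move=> X0 mX; elim: m => [|m IH].
  under eq_fun do rewrite big_ord0.
  by rewrite big_ord0; exact: expectation_cst.
under eq_fun do rewrite big_ord_recr/=; rewrite big_ord_recr/= -IH.
have mA : m \notin below m by rewrite in_below ltnn.
have fmm : <<s f m >> `<=` measurable := sub_sigma_algebra_measurable (@fm m).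
have B0 : tt \notin (fset0 : {fset unit}) by rewrite inE.
pose g (_ : unit) := f m.
have gf (j : unit) : <<s g j >> `<=` <<s f m >> by [].
have gind := mutually_independent_unit fmm.
apply: (independent_integralM (past_pi_measurable fm gf)
  (@past_piI _ _ _ _ f g (below m) fset0) (past_piT _ _ _ _)).
- apply: measurable_prod => j _.
  apply: (measurable_fun_sigmaS _ (mX j)) => C fC.
  by apply: sub_sigma_algebra; apply: past_pif fC; rewrite in_below.
- by move=> w; exact: prodr_ge0.
- exact: (measurable_fun_sub (@fm m)).
- by [].
- move=> C D GC mD.
  apply: (past_pi_indep mA B0 gf find gind GC).
  by have := mX m measurableT D mD; rewrite setTI.
Qed.

Variables (J : choiceType) (g : J -> set (set Omega)) (m : nat).
Variables (B : {fset J}) (j0 : J).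
Hypothesis j0B : j0 \notin B.
Hypothesis gf : forall j, <<s g j >> `<=` <<s f m >>.
Hypothesis gind : mutually_independent Pr [set` (j0 |` B)%fset] (fun j => <<s g j >>).

Definition past_sigma : set (set Omega) := past_pi f g (below m) B.

Lemma measurable_past_sigma (X : Omega -> R) :
  measurable_fun (setT : set (g_sigma_algebraType past_sigma)) X ->
  measurable_fun setT X.
Proof. exact: (measurable_fun_sub (past_pi_measurable fm gf)). Qed.

Lemma past_sigma_fst j (X : Omega -> R) : (j < m)%N ->
  measurable_fun (setT : set (g_sigma_algebraType (f j))) X ->
  measurable_fun (setT : set (g_sigma_algebraType past_sigma)) X.
Proof.
move=> jm; apply: measurable_fun_sigmaS => C fC.
by apply: sub_sigma_algebra; apply: past_pif fC; rewrite in_below.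
Qed.

Lemma past_sigma_snd j (X : Omega -> R) : j \in B ->
  measurable_fun (setT : set (g_sigma_algebraType (g j))) X ->
  measurable_fun (setT : set (g_sigma_algebraType past_sigma)) X.
Proof.
move=> jB; apply: measurable_fun_sigmaS => C gC.
by apply: sub_sigma_algebra; exact: past_pig gC.
Qed.

(** It serves in place of conditioning on the past: [G] may involve all lower levels and the treated
    cubes of level [m], [Z] only the current cube. *)
Lemma expectation_past (G Z : Omega -> R) :
  measurable_fun (setT : set (g_sigma_algebraType past_sigma)) G ->
  (forall w, 0 <= G w) ->
  measurable_fun (setT : set (g_sigma_algebraType (g j0))) Z ->
  (forall w, 0 <= Z w) ->
  Ex Pr (fun w => G w * Z w) = (Ex Pr G * Ex Pr Z)%E.
Proof.
move=> mG G0 mZ Z0.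
have mA : m \notin below m by rewrite in_below ltnn.
have gmm : <<s g j0 >> `<=` measurable.
  by move=> C /gf; exact: (sub_sigma_algebra_measurable (@fm m)).
apply: (independent_integralM (past_pi_measurable fm gf)
  (@past_piI _ _ _ _ f g (below m) B) (past_piT _ _ _ _)) => //.
- by move=> _ D mD; apply: gmm; exact: (mZ measurableT D mD).
- move=> C D GC mD.
  apply: (past_pi_indep mA j0B gf find gind GC).
  by have := mZ measurableT D mD; rewrite setTI.
Qed.

End product_expectation.

(** * Moments of the chaos densities *)

Section b_adic_cubes.
Context {R : realType} (d b : nat).
Hypothesis b0 : (0 < b)%N.
Implicit Types t s : d.-tuple R.

Lemma hcube_ccube : @hcube R d `<=` ccube d.
Proof. by move=> t ht i; have /andP[-> /ltW] := ht i. Qed.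

Let bm0 m : (0 < b ^ m)%N. Proof. by rewrite expn_gt0 b0. Qed.

Lemma bcube_hcube m (h : bindex d b m) : @bcube R d b m h `<=` hcube d.
Proof.
move=> t ht i; have /andP[t1 t2] := ht i; apply/andP; split.
  by apply: le_trans t1; rewrite divr_ge0.
apply: (lt_le_trans t2); rewrite ler_pdivrMr ?mul1r ?ltr0n//.
by rewrite ler_nat.
Qed.

Lemma bcube_ccube m (h : bindex d b m) : @bcube R d b m h `<=` ccube d.
Proof. by move=> t /bcube_hcube /hcube_ccube. Qed.

Lemma bcube_sub m j (h : bindex d b m) (h' : bindex d b j) : (j <= m)%N ->
  (forall i, h' i = h i %/ b ^ (m - j) :> nat)%N -> @bcube R d b m h `<=` bcube h'.
Proof.
move=> jm hh' t ht i; rewrite hh'.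
have /andP[t1 t2] := ht i.
have E : (b ^ m)%:R = (b ^ j)%:R * (b ^ (m - j))%:R :> R.
  by rewrite -natrM -expnD subnKC.
have pj : 0 < (b ^ j)%:R :> R by rewrite ltr0n.
have pmj : 0 < (b ^ (m - j))%:R :> R by rewrite ltr0n.
move: t1 t2; rewrite E invfM => t1 t2; apply/andP; split.
  apply: le_trans t1; rewrite mulrCA mulrC ler_pM2l ?invr_gt0//.
  by rewrite ler_pdivlMr// -natrM ler_nat leq_trunc_div.
apply: (lt_le_trans t2); rewrite mulrCA mulrC ler_pM2r ?invr_gt0//.
rewrite ler_pdivrMr// -natrM ler_nat.
by rewrite ltn_ceil.
Qed.

Lemma bcube_ancestor m j (h : bindex d b m) : (j <= m)%N ->
  exists h' : bindex d b j, @bcube R d b m h `<=` bcube h'.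
Proof.
move=> jm; have lt i : (h i %/ b ^ (m - j) < b ^ j)%N.
  by rewrite ltn_divLR ?bm0// -expnD subnKC.
by exists [ffun i => Ordinal (lt i)]; apply: bcube_sub => // i; rewrite ffunE.
Qed.

Lemma euclid_dist_ge0 t s : 0 <= euclid_dist t s.
Proof. exact: sqrtr_ge0. Qed.

End b_adic_cubes.

Lemma measurable_process_sigma {dO : measure_display} {Omega : measurableType dO}
    {R : realType} (T : Type) (A : set T) (X : T -> Omega -> R) t : A t ->
  measurable_fun (setT : set (g_sigma_algebraType
    [set X t @^-1` B | t in A & B in measurable])) (X t).
Proof.
move=> At _ B mB; rewrite setTI; apply: sub_sigma_algebra.
by exists t => //; exists B.
Qed.

Arguments measurable_process_sigma {dO Omega R T A} X {t} _.

Section telescope.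
Context {R : realType}.

(** The [i]-th factor in the [j]-th term of the telescoping of a difference of products. *)
Definition mix (a e : nat -> R) (j i : nat) : R :=
  if (i < j)%N then a i else if i == j then `|a i - e i| else e i.

Lemma telescope_prod (a e : nat -> R) m :
  (forall i, 0 <= a i) -> (forall i, 0 <= e i) ->
  `|\prod_(i < m) a i - \prod_(i < m) e i| <=
  \sum_(j < m) \prod_(i < m) mix a e j i.
Proof.
move=> a0 e0; elim: m => [|m IH]; first by rewrite !big_ord0 subrr normr0.
rewrite !big_ord_recr/= [X in _ <= _ + X](_ : _ = (\prod_(i < m) a i) * `|a m - e m|); last first.
  congr (_ * _); last by rewrite /mix ltnn eqxx.
  by apply: eq_bigr => i _; rewrite /mix ltn_ord.
rewrite [X in _ <= X + _](_ : _ = (\sum_(j < m) \prod_(i < m) mix a e j i) * e m); last first.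
  rewrite mulr_suml; apply: eq_bigr => j _; rewrite big_ord_recr/=; congr (_ * _).
  by rewrite /mix ltnNge ltnW// gtn_eqF.
set A := \prod_(i < m) a i; set E := \prod_(i < m) e i.
have -> : A * a m - E * e m = (A - E) * e m + A * (a m - e m) by ring.
apply: (le_trans (ler_normD _ _)); rewrite !normrM (ger0_norm (e0 m)).
rewrite (@ger0_norm _ A) ?prodr_ge0//.
by rewrite lerD2r ler_wpM2r.
Qed.

Lemma powR_prod (p : R) (a : nat -> R) m : (forall i, 0 <= a i) ->
  (\prod_(i < m) a i) `^ p = \prod_(i < m) a i `^ p.
Proof.
move=> a0; elim: m => [|m IH]; first by rewrite !big_ord0 powR1.
by rewrite !big_ord_recr/= powRM ?prodr_ge0// IH.
Qed.

Lemma prode_le (F : nat -> \bar R) (c : nat -> R) m :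
  (forall i, (i < m)%N -> (0 <= F i <= (c i)%:E)%E) ->
  (\prod_(i < m) F i <= (\prod_(i < m) c i)%:E)%E.
Proof.
move=> Fc; suff /andP[] : (0 <= \prod_(i < m) F i <= (\prod_(i < m) c i)%:E)%E by [].
elim: m Fc => [|m IH] Fc; first by rewrite !big_ord0 lee_fin ler01 lexx.
have /andP[A0 A1] := IH (fun i im => Fc i (ltnW im)).
have /andP[F0 F1] := Fc m (ltnSn m).
by rewrite !big_ord_recr/= EFinM mule_ge0//= lee_pmul.
Qed.

End telescope.

Section chaos_moments.
Context {dO : measure_display} {Omega : measurableType dO} {R : realType}.
Variables (Pr : probability Omega R) (d b : nat).
Variable P : nat -> d.-tuple R -> Omega -> R.
Hypothesis b0 : (0 < b)%N.
Hypothesis Pmeas : forall m,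
  measurable_fun (ccube d `*` [set: Omega]) (fun z => P m z.1 z.2).
Hypothesis Pindep : independent_processes Pr [set: nat] (fun=> ccube d) P.
Hypothesis Pge0 : forall m t w, ccube d t -> 0 <= P m t w.

Definition genP j : set (set Omega) := [set P j t @^-1` B | t in ccube d & B in measurable].

Lemma measurable_ccube : measurable (@ccube R d).
Proof.
rewrite (_ : ccube d = \bigcap_(i in [set: 'I_d]) ((fun t : d.-tuple R => tnth t i) @^-1` `[0, 1]%classic)).
  apply: fin_bigcap_measurable => // i _; rewrite -[X in measurable X]setTI.
  by apply: measurable_tnth.
apply/seteqP; split => t h i; first by move=> _ /=; rewrite in_itv/=; exact: h.
by have := h i Logic.I; rewrite /= in_itv.
Qed.

Lemma measurable_proc j t : ccube d t -> measurable_fun setT (P j t).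
Proof.
move=> ct _ B mB.
have mD : measurable (@ccube R d `*` [set: Omega]).
  exact: (measurableX measurable_ccube measurableT).
have := measurable_xsection t (Pmeas j mD mB).
congr measurable; apply/seteqP; split => w /=; rewrite /xsection/= ?inE/=.
  by move=> [].
by move=> [].
Qed.

Lemma genP_measurable j : genP j `<=` measurable.
Proof.
move=> _ [t ct [B mB <-]]; rewrite -[X in measurable X]setTI.
exact: measurable_proc.
Qed.

(* The density of mu_(m-1), and 1 for m = 0. *)
Definition chaosQ m t w : R := \prod_(j < m) P j t w.

Lemma chaosQ_ge0 m t w : ccube d t -> 0 <= chaosQ m t w.
Proof. by move=> ct; apply: prodr_ge0 => j _; exact: Pge0. Qed.

Lemma chaosQS m t w : chaosQ m.+1 t w = chaosQ m t w * P m t w.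
Proof. by rewrite /chaosQ big_ord_recr. Qed.

Lemma measurable_chaosQ m t : ccube d t -> measurable_fun setT (chaosQ m t).
Proof. by move=> ct; apply: measurable_prod => j _; exact: measurable_proc. Qed.

Lemma expectation_prodP (X : nat -> Omega -> R) m :
  (forall j w, 0 <= X j w) ->
  (forall j, measurable_fun (setT : set (g_sigma_algebraType (genP j))) (X j)) ->
  Ex Pr (fun w => \prod_(j < m) X j w) = (\prod_(j < m) Ex Pr (X j))%E.
Proof. exact: (expectation_prod genP_measurable Pindep). Qed.

Variables (p alpha0 C3 : R) (M : nat -> R).
Hypotheses (p1 : 1 <= p) (C30 : 0 <= C3) (M1 : forall j, 1 <= M j).
Hypothesis alpha00 : 0 <= alpha0.
Hypothesis PM : forall j t, hcube d t -> (Ex Pr (fun w => (P j t w `^ p)%R) <= (M j)%:E)%E.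
Hypothesis PC3 : forall j (h : bindex d b j) t s, bcube h t -> bcube h s ->
  (Ex Pr (fun w => (`|P j t w - P j s w| `^ p)%R) <=
   (C3 * ((b ^ j)%:R * euclid_dist t s) `^ (alpha0 * p))%:E)%E.

Definition chaosA m := \prod_(j < m) M j.

Lemma chaosA_ge1 m : 1 <= chaosA m.
Proof.
rewrite /chaosA; elim: m => [|m IH]; first by rewrite big_ord0.
by rewrite big_ord_recr/=; have := M1 m; nra.
Qed.

Lemma chaosQ_moment m t : hcube d t ->
  (Ex Pr (fun w => (chaosQ m t w `^ p)%R) <= (chaosA m)%:E)%E.
Proof.
move=> ht; have ct := hcube_ccube ht.
rewrite (_ : (fun w => _) = fun w => \prod_(j < m) P j t w `^ p); last first.
  by apply/funext => w; rewrite /chaosQ (@powR_prod R p (fun j => P j t w))// => i; exact: Pge0.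
rewrite (@expectation_prodP (fun j w => P j t w `^ p)).
- apply: (@prode_le R (fun j => Ex Pr (fun w => P j t w `^ p)) M m).
  move=> j _; rewrite PM// andbT.
  by apply: expectation_ge0 => w; exact: powR_ge0.
- by move=> j w; exact: powR_ge0.
- move=> j; apply: (measurableT_comp (@measurable_powR R p)).
  exact: (measurable_process_sigma (P j) ct).
Qed.

(** Telescoping leaves [m] products of independent factors, exactly one of which is an increment;
    the convexity bound for [m] terms gives the factor [m ^ p]. The condition [m <= m'.+1] covers
    both densities that enter the difference at level [m']. *)
Lemma chaosQ_increment m m' (h : bindex d b m') t s : (m <= m'.+1)%N ->
  bcube h t -> bcube h s ->
  (Ex Pr (fun w => (`|chaosQ m t w - chaosQ m s w| `^ p)%R) <=
   (m%:R `^ p * (C3 * chaosA m) * ((b ^ m')%:R * euclid_dist t s) `^ (alpha0 * p))%:E)%E.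
Proof.
move=> mm' bt bs.
have ht := bcube_hcube b0 bt; have hs := bcube_hcube b0 bs.
have ct := hcube_ccube ht; have cs := hcube_ccube hs.
pose z j i w := mix (fun k => P k t w) (fun k => P k s w) j i.
have z0 j i w : 0 <= z j i w.
  by rewrite /z /mix; case: ifP => _; [exact: Pge0|case: ifP => // _; exact: Pge0].
have mz j i : measurable_fun (setT : set (g_sigma_algebraType (genP i))) (z j i).
  have mt := measurable_process_sigma (P i) ct.
  have ms := measurable_process_sigma (P i) cs.
  rewrite /z /mix; case: (ltnP i j) => // _; case: eqP => // _.
  by apply: (measurableT_comp (@normr_measurable R setT)); exact: measurable_funB.
have mz' j i := measurable_fun_sub (@genP_measurable i) (mz j i).
set D := ((b ^ m')%:R * euclid_dist t s) `^ (alpha0 * p).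
have D0 : 0 <= D by exact: powR_ge0.
have Ezp j : (j < m)%N ->
    (Ex Pr (fun w => (\prod_(i < m) z j i w `^ p)%R) <= (C3 * chaosA m * D)%:E)%E.
  move=> jm; rewrite (@expectation_prodP (fun i w => z j i w `^ p)).
  - rewrite (_ : C3 * chaosA m * D = \prod_(i < m) (M i * (if i == j :> nat then C3 * D else 1))).
      apply: (@prode_le R (fun i => Ex Pr (fun w => z j i w `^ p))
        (fun i => M i * (if i == j then C3 * D else 1)) m).
      move=> i im; apply/andP; split.
        by apply: expectation_ge0 => w; exact: powR_ge0.
      rewrite /z /mix; case: (ltnP i j) => ij.
        by rewrite (ltn_eqF ij) mulr1; exact: PM.
      case: eqP => [ij'|_]; last by rewrite mulr1; exact: PM.
      (* [PC3] at level [i] wants both points in one cube of that level: the ancestor of [h], which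
         exists as [i < m <= m'.+1]. *)
      have [h' hh'] := @bcube_ancestor R d b b0 m' i h ltac:(by rewrite -ltnS (leq_trans im)).
      apply: (le_trans (PC3 (hh' _ bt) (hh' _ bs))); rewrite lee_fin.
      apply: (@le_trans _ _ (C3 * D)); last first.
        by rewrite ler_peMl ?M1// mulr_ge0.
      rewrite ler_wpM2l// /D le_powR//.
      + by rewrite mulr_ge0// (le_trans ler01).
      + by rewrite mulr_ge0// euclid_dist_ge0.
      + rewrite ler_wpM2r ?euclid_dist_ge0// ler_nat leq_pexp2l//.
        by rewrite -ltnS (leq_trans im).
    rewrite big_split/= -/(chaosA m) (bigD1 (Ordinal jm))//= eqxx big1 ?mulr1; first by ring.
    by move=> i; rewrite -val_eqE/= => /negbTE ->.
  - by move=> i w; exact: powR_ge0.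
  - by move=> i; apply: (measurableT_comp (@measurable_powR R p)).
have mprod j : measurable_fun setT (fun w => \prod_(i < m) z j i w `^ p).
  by apply: measurable_prod => i _; apply: (measurableT_comp (@measurable_powR R p)).
apply: (@le_trans _ _ (Ex Pr (fun w =>
   (m%:R `^ (p - 1) * \sum_(j < m) \prod_(i < m) z j i w `^ p)%R))).
  apply: Ex_le.
  - apply: (measurableT_comp (@measurable_powR R p)).
    apply: (measurableT_comp (@normr_measurable R setT)).
    by apply: measurable_funB; exact: measurable_chaosQ.
  - by move=> w; exact: powR_ge0.
  - by apply: measurable_funM => //; apply: measurable_sum => j.
  - move=> w; have := @telescope_prod R (fun k => P k t w) (fun k => P k s w) m
      (fun k => Pge0 k w ct) (fun k => Pge0 k w cs).
    move=> /(le_powR (le_trans ler01 p1) (normr_ge0 _)) h1; apply: (le_trans h1).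
    have := @powR_sum_le R 'I_m (fun j => \prod_(i < m) z j i w) p p1.
    have zz0 (j : 'I_m) : 0 <= \prod_(i < m) z j i w by apply: prodr_ge0 => i _.
    rewrite card_ord => /(_ zz0) h2; apply: (le_trans h2); rewrite ler_wpM2l ?powR_ge0//.
    by apply: ler_sum => j _; rewrite (@powR_prod R p (fun i => z j i w)).
rewrite ExZ ?powR_ge0//; last 2 first.
- by apply: measurable_sum => j.
- by move=> w; apply: sumr_ge0 => j _; apply: prodr_ge0 => i _; exact: powR_ge0.
rewrite Ex_sum//; last by move=> j _ w; apply: prodr_ge0 => i _; exact: powR_ge0.
apply: (@le_trans _ _ ((m%:R `^ (p - 1))%:E * \sum_(j < m) (C3 * chaosA m * D)%:E)%E).
  by rewrite lee_wpmul2l ?lee_fin ?powR_ge0//; apply: lee_sum => j _; exact: Ezp.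
rewrite sumEFin sumr_const card_ord -EFinM lee_fin -[X in _ * X <= _]mulr_natl.
rewrite -(@mulr_powRB1 _ m%:R p)// ?(lt_le_trans ltr01)// le_eqVlt; apply/orP; left.
by apply/eqP; rewrite /D; ring.
Qed.

End chaos_moments.

(** * Oscillation on a cube *)

Section waves.
Context {R : realType}.

Definition wave (kd : bool) : R -> R := if kd then cos else sin.

Lemma wave_le1 kd a : `|wave kd a| <= 1.
Proof. by case: kd; [exact: cos_max|exact: sin_max]. Qed.

Lemma wave_second_difference kd a e :
  wave kd (a + e) + wave kd (a - e) = 2 * cos e * wave kd a.
Proof. by case: kd; rewrite /wave ?cosD ?sinD ?cosB ?sinB ?cosN ?sinN; ring. Qed.

Lemma wave_lipschitz kd a e : `|wave kd a - wave kd e| <= `|a - e|.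
Proof.
wlog ea : a e / e <= a.
  move=> h; have [/h//|/ltW/h] := leP e a.
  by rewrite distrC [in leRHS]distrC.
move: ea; rewrite le_eqVlt => /predU1P[->|ea]; first by rewrite !subrr.
pose dw (x : R) := if kd then - sin x else cos x.
have dwP (x : R) : is_derive x 1 (wave kd) (dw x).
  by rewrite /wave /dw; case: ifP => _; [exact: is_derive_cos|exact: is_derive_sin].
have cw : {within `[e, a], continuous (wave kd)}.
  apply: continuous_subspaceT => x; apply: differentiable_continuous.
  by apply/derivable1_diffP; exact: (@ex_derive _ _ _ _ _ _ _ (dwP x)).
have [x _ ->] := MVT ea (fun x _ => dwP x) cw.
rewrite normrM ler_piMl// /dw.
by case: ifP => _; [rewrite normrN; exact: sin_max|exact: cos_max].
Qed.

Lemma cos_lt1 (x : R) : 0 < x <= pi -> cos x < 1.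
Proof.
move=> /andP[x0 xpi]; rewrite -[ltRHS](@cos0 R) ltr_cos// in_itv/= ?lexx ?pi_ge0//.
by rewrite (ltW x0).
Qed.

Lemma cos_le_between (x y : R) : 0 <= y -> y <= `|x| -> `|x| <= pi -> cos x <= cos y.
Proof.
move=> y0 yx xpi; rewrite -(cos_norm x).
move: yx; rewrite le_eqVlt => /predU1P[->//|yx]; apply: ltW.
rewrite ltr_cos// in_itv/= ?xpi ?normr_ge0// y0.
by rewrite (le_trans (ltW yx)).
Qed.

End waves.

Section cyclic_shift.
Context {d K : nat}.
Hypothesis K0 : (0 < K)%N.
Implicit Types k : {ffun 'I_d -> 'I_K}.

(** The shift along axis [i] is cyclic in order to be a permutation, with the shift by [K - H] as
    its inverse; the points that wrap around become the boundary in [oscillating_sum]. *)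
Definition cshift (i : 'I_d) (H : nat) k : {ffun 'I_d -> 'I_K} :=
  [ffun j => if j == i then Ordinal (ltn_pmod (k i + H) K0) else k j].

Lemma cshiftK i H : (H <= K)%N -> cancel (cshift i H) (cshift i (K - H)).
Proof.
move=> HK k; apply/ffunP => j; rewrite !ffunE; case: eqP => // ->.
apply: val_inj; rewrite /= eqxx/= modnDml -addnA subnKC// -modnDmr modnn addn0.
by rewrite modn_small.
Qed.

Lemma cshiftVK i H : (H <= K)%N -> cancel (cshift i (K - H)) (cshift i H).
Proof.
by move=> HK; have := @cshiftK i (K - H) (leq_subr _ _); rewrite subKn.
Qed.

Lemma cshift_wrap i H k : (H <= K)%N ->
  (cshift i H k i < H)%N = (K <= k i + H)%N.
Proof.
move=> HK; rewrite ffunE eqxx/=; have kK := ltn_ord (k i).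
case: (leqP K (k i + H)) => h.
  have E : ((k i + H) %% K = k i + H - K)%N.
    by rewrite -{1}(subnK h) modnDr modn_small//; lia.
  by rewrite E; lia.
by rewrite modn_small//; lia.
Qed.

Lemma cshift_forward i H k : (k i + H < K)%N -> (cshift i H k i = k i + H :> nat)%N.
Proof. by move=> h; rewrite ffunE eqxx/= modn_small. Qed.

Lemma cshift_backward i H k : (H <= K)%N -> (H <= k i)%N ->
  (cshift i (K - H) k i = k i - H :> nat)%N.
Proof.
move=> HK h; rewrite ffunE eqxx/=; have kK := ltn_ord (k i).
have -> : (k i + (K - H) = k i - H + K)%N by lia.
by rewrite modnDr modn_small//; lia.
Qed.

Lemma cshift_neq i H k j : j != i -> cshift i H k j = k j.
Proof. by move=> ji; rewrite ffunE (negbTE ji). Qed.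

End cyclic_shift.

(** The indicator is a product over the coordinates with trivial factors off [i], so the sum over
    the grid is a product of one-dimensional sums. *)
Lemma count_slab {R : realType} (d K H : nat) (i : 'I_d) (Q : pred nat) :
  (\sum_(y < K) (Q y : nat) = H)%N ->
  \sum_(k : {ffun 'I_d -> 'I_K}) (Q (k i))%:R = (H * K ^ d.-1)%:R :> R.
Proof.
move=> QH.
pose G (j : 'I_d) (y : 'I_K) : R := if j == i then (Q y)%:R else 1.
transitivity (\sum_(k : {ffun 'I_d -> 'I_K}) \prod_j G j (k j)).
  apply: eq_bigr => k _; rewrite (bigD1 i)//= /G eqxx big1 ?mulr1//.
  by move=> j /negbTE ->.
rewrite -bigA_distr_bigA (bigD1 i)//= {1}/G eqxx -natr_sum QH natrM; congr (_ * _).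
rewrite (eq_bigr (fun=> K%:R)); last first.
  by move=> j ji; rewrite /G (negbTE ji) sumr_const card_ord.
rewrite prodr_const natrX; congr (_ ^+ _).
by rewrite -[in RHS](card_ord d) -(cardC1 i); apply: eq_card.
Qed.

Section grid_points.
Context {R : realType} (d b m K : nat).
Hypotheses (b0 : (0 < b)%N) (K0 : (0 < K)%N).
Implicit Types (h : bindex d b m) (k : {ffun 'I_d -> 'I_K}).

Definition gpt h k : d.-tuple R :=
  [tuple (h i * K + k i)%:R / (b ^ m * K)%:R | i < d].

Let bm0 : 0 < (b ^ m)%:R :> R. Proof. by rewrite ltr0n expn_gt0 b0. Qed.
Let KR0 : 0 < K%:R :> R. Proof. by rewrite ltr0n. Qed.

Lemma bcube_gpt h k : bcube h (gpt h k).
Proof.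
move=> i; rewrite tnth_mktuple; have kK := ltn_ord (k i).
have -> : (h i * K + k i)%:R / (b ^ m * K)%:R =
    (h i * K + k i)%:R / K%:R / (b ^ m)%:R :> R.
  by rewrite natrM invfM -mulrA [X in _ * X]mulrC.
apply/andP; split.
  by rewrite ler_pM2r ?invr_gt0// ler_pdivlMr// -natrM ler_nat leq_addr.
rewrite ltr_pM2r ?invr_gt0// ltr_pdivrMr// -natrM ltr_nat mulSn.
by rewrite addnC ltn_add2r.
Qed.

Lemma euclid_dist_gpt h k k' i H : (forall j, j != i -> k' j = k j) ->
  (k' i = k i + H :> nat)%N ->
  euclid_dist (gpt h k) (gpt h k') = H%:R / (b ^ m * K)%:R.
Proof.
move=> kk ki; rewrite /euclid_dist (bigD1 i)//= big1 ?addr0; last first.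
  by move=> j ji; rewrite !tnth_mktuple kk// subrr expr0n.
rewrite sqrtr_sqr !tnth_mktuple ki -mulrBl.
rewrite (_ : _ - _ = - H%:R) ?mulNr ?normrN; last by rewrite !natrD; ring.
by rewrite ger0_norm// divr_ge0.
Qed.

Lemma dotp_gpt (x : d.-tuple R) h k k' i (z : R) : (forall j, j != i -> k' j = k j) ->
  (k' i)%:R = (k i)%:R + z ->
  dotp x (gpt h k') = dotp x (gpt h k) + tnth x i * (z / (b ^ m * K)%:R).
Proof.
move=> kk ki; rewrite /dotp (bigD1 i)//= [in RHS](bigD1 i)//= addrAC; congr (_ + _).
  rewrite !tnth_mktuple -mulrDr; congr (_ * _).
  by rewrite !natrD ki -mulrDl addrA.
by apply: eq_bigr => j ji; rewrite !tnth_mktuple kk.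
Qed.

End grid_points.

Section weighted_moment.
Context {dO : measure_display} {Omega : measurableType dO} {R : realType}.
Variable Pr : probability Omega R.

(** Minkowski's inequality in L^p for a common moment bound, obtained from convexity. *)
Lemma expectation_weighted (I : finType) (c : I -> R) (z : I -> Omega -> R) (p D : R) :
  1 <= p -> (forall a, 0 <= c a) -> (forall a, measurable_fun setT (z a)) ->
  (forall a w, 0 <= z a w) ->
  (forall a, (Ex Pr (fun w => (z a w `^ p)%R) <= D%:E)%E) ->
  (Ex Pr (fun w => ((\sum_a c a * z a w) `^ p)%R) <= ((\sum_a c a) `^ p * D)%:E)%E.
Proof.
move=> p1 c0 mz z0 zD; set C := \sum_a c a.
have C0 : 0 <= C by exact: sumr_ge0.
have mzp a : measurable_fun setT (fun w => z a w `^ p).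
  by apply: (measurableT_comp (@measurable_powR R p)).
have mczp a : measurable_fun setT (fun w => c a * z a w `^ p).
  by apply: measurable_funM.
apply: (@le_trans _ _ (Ex Pr (fun w => (C `^ (p - 1) * \sum_a c a * z a w `^ p)%R))).
  apply: Ex_le.
  - apply: (measurableT_comp (@measurable_powR R p)).
    by apply: measurable_sum => a; apply: measurable_funM.
  - by move=> w; exact: powR_ge0.
  - by apply: measurable_funM => //; apply: measurable_sum => a.
  - by move=> w; exact: powR_mean.
have cz0 a w : 0 <= c a * z a w `^ p by rewrite mulr_ge0// powR_ge0.
rewrite ExZ ?powR_ge0//; [|by apply: measurable_sum|by move=> w; exact: sumr_ge0].
rewrite Ex_sum//.
apply: (@le_trans _ _ ((C `^ (p - 1))%:E * \sum_a (c a * D)%:E)%E).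
  rewrite lee_wpmul2l ?lee_fin ?powR_ge0//; apply: lee_sum => a _.
  rewrite ExZ//; last by move=> w; exact: powR_ge0.
  by rewrite EFinM lee_wpmul2l// lee_fin.
rewrite sumEFin -EFinM lee_fin -mulr_suml -/C mulrA [C `^ _ * C]mulrC.
by rewrite mulr_powRB1// (lt_le_trans ltr01).
Qed.

End weighted_moment.

Section oscillation_bound.
Context {dO : measure_display} {Omega : measurableType dO} {R : realType}.
Variables (Pr : probability Omega R) (d b m n kappa : nat).
Hypotheses (b2 : (2 <= b)%N) (kappa0 : (0 < kappa)%N) (mn : (m <= n + 3)%N).
Variables (h : bindex d b m).

(** A shift by [H] grid points is a displacement of length [b^-(n+3)] whatever the refinement
    [kappa]; [rho] is this length relative to the side [b^-m] of the cube. *)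
Let K := (b ^ (n + 3) * kappa)%N.
Let H := (b ^ m * kappa)%N.
Let rho : R := (b ^ m)%:R / (b ^ (n + 3))%:R.

Let b0 : (0 < b)%N. Proof. exact: leq_trans b2. Qed.
Let K0 : (0 < K)%N. Proof. by rewrite muln_gt0 expn_gt0 b0. Qed.
Let HK : (H <= K)%N. Proof. by rewrite leq_mul2r leq_pexp2l// orbT. Qed.
Let bp j : 0 < (b ^ j)%:R :> R. Proof. by rewrite ltr0n expn_gt0 b0. Qed.
Let kp : 0 < kappa%:R :> R. Proof. by rewrite ltr0n. Qed.
Let KR0 : 0 < K%:R :> R. Proof. by rewrite ltr0n. Qed.

Variables (F : {ffun 'I_d -> 'I_K} -> Omega -> R) (p D alpha0 s : R).
Hypotheses (p1 : 1 <= p) (mF : forall k, measurable_fun setT (F k)).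
Hypothesis s01 : 0 <= s <= 1.
Hypothesis salpha : s <= alpha0.
Hypothesis D0 : 0 <= D.
Hypothesis FD : forall k, (Ex Pr (fun w => (`|F k w| `^ p)%R) <= D%:E)%E.
Hypothesis Fincr : forall (i : 'I_d) (k : {ffun 'I_d -> 'I_K}), (k i + H < K)%N ->
  (Ex Pr (fun w => (`|F k w - F (cshift K0 i H k) w| `^ p)%R) <= (D * rho `^ (alpha0 * p))%:E)%E.

(** When a coordinate of the frequency lies between [b^n] and [b^(n+1)], a displacement [b^-(n+3)]
    along its axis turns the phase by an angle between [2 * pi / b^3] and [pi]; the factor
    [2 - 2 * cos] of that angle is then at least this constant. *)
Definition osc_gap : R := 2 - 2 * cos (2 * pi / (b ^ 3)%:R).

Lemma osc_gap_gt0 : 0 < osc_gap.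
Proof.
have h8 : 8 <= (b ^ 3)%:R :> R by rewrite (ler_nat _ 8) (@leq_exp2r 2 b 3).
have : cos (2 * pi / (b ^ 3)%:R) < 1 :> R.
  apply: cos_lt1; apply/andP; split.
    by rewrite divr_gt0// mulr_gt0// pi_gt0.
  rewrite ler_pdivrMr// mulrC ler_pM2l ?pi_gt0//; lra.
by rewrite /osc_gap; lra.
Qed.

Let rho0 : 0 < rho. Proof. by rewrite divr_gt0. Qed.
Let rho1 : rho <= 1.
Proof. by rewrite ler_pdivrMr// mul1r ler_nat leq_pexp2l. Qed.

Let HE : H%:R = rho * K%:R :> R.
Proof. by rewrite /H /K /rho !natrM; field; rewrite gt_eqF. Qed.

Let rs := rho `^ s.
Let rs0 : 0 < rs. Proof. exact: powR_gt0. Qed.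

Let T := ('I_d * {ffun 'I_d -> 'I_K} * bool)%type.

Let wrapf (i : 'I_d) (k : {ffun 'I_d -> 'I_K}) := (K <= k i + H)%N.
Let wrapb (i : 'I_d) (k : {ffun 'I_d -> 'I_K}) := (k i < H)%N.

(** The right-hand side of [oscillating_sum] as a weighted sum of variables whose [p]-th moments are
    at most [D]: differences divided by [rs], and boundary values. All axes are summed, so that one
    bound serves every frequency. *)
Let c (a : T) : R := if a.2 then 2 * rs else
  4 * (wrapf a.1.1 a.1.2)%:R + 4 * (wrapb a.1.1 a.1.2)%:R.

Let z (a : T) w : R := if a.2 then
  (if wrapf a.1.1 a.1.2 then 0 else `|F a.1.2 w - F (cshift K0 a.1.1 H a.1.2) w| / rs)
  else `|F a.1.2 w|.

Let c0 a : 0 <= c a.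
Proof.
rewrite /c; case: ifP => _; first by rewrite mulr_ge0// (ltW rs0).
by rewrite addr_ge0// mulr_ge0.
Qed.

Let z0 a w : 0 <= z a w.
Proof.
by rewrite /z; case: ifP => _ //; case: ifP => _ //; rewrite divr_ge0// (ltW rs0).
Qed.

Let mz a : measurable_fun setT (z a).
Proof.
case: a => [[i k] bb]; rewrite /z/=; case: bb; last first.
  exact: (measurableT_comp (@normr_measurable R setT)).
case: (wrapf i k) => //; apply: measurable_funM => //.
by apply: (measurableT_comp (@normr_measurable R setT)); exact: measurable_funB.
Qed.

Let zD a : (Ex Pr (fun w => (z a w `^ p)%R) <= D%:E)%E.
Proof.
have pn0 : p != 0 by rewrite gt_eqF// (lt_le_trans ltr01 p1).
case: a => [[i k] bb]; rewrite /z/=; case: bb => //.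
have [wk|] := boolP (wrapf i k).
  by under eq_fun do rewrite powR0//; rewrite expectation_cst lee_fin.
rewrite /wrapf -ltnNge => wk.
rewrite (_ : (fun w => _) = fun w => (rs `^ p)^-1 *
    `|F k w - F (cshift K0 i H k) w| `^ p); last first.
  apply/funext => w; rewrite powRM ?invr_ge0 ?(ltW rs0)// mulrC; congr (_ * _).
  by rewrite -(powR_inv1 (ltW rs0)) -(powR_inv1 (powR_ge0 rs p)) powRAC.
have mX : measurable_fun setT (fun w => `|F k w - F (cshift K0 i H k) w| `^ p).
  apply: (measurableT_comp (@measurable_powR R p)).
  by apply: (measurableT_comp (@normr_measurable R setT)); exact: measurable_funB.
rewrite (ExZ Pr mX (fun w => powR_ge0 _ _)) ?invr_ge0 ?powR_ge0//.
apply: (@le_trans _ _ (((rs `^ p)^-1)%:E * (D * rho `^ (alpha0 * p))%:E)%E).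
  by rewrite lee_wpmul2l ?Fincr// lee_fin invr_ge0 powR_ge0.
rewrite -EFinM lee_fin mulrC ler_pdivrMr ?powR_gt0// ler_wpM2l//.
rewrite /rs -powRrM ger_powR ?rho0//.
by rewrite ler_wpM2r// (le_trans ler01).
Qed.

Let sum_indic (Q : pred nat) (i : 'I_d) : (\sum_(y < K) (Q y : nat) = H)%N ->
  \sum_(k : {ffun 'I_d -> 'I_K}) (Q (k i))%:R = rho * K%:R ^+ d :> R.
Proof.
move=> QH; rewrite (count_slab _ QH) natrM natrX HE -mulrA -exprS prednK//.
by case: d i => [[]|].
Qed.

Let count_lt : (\sum_(y < K) ((y < H) : nat) = H)%N.
Proof.
rewrite -(big_mkord xpredT (fun y => ((y < H)%N : nat))) (big_cat_nat (leq0n H) HK)//=.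
rewrite [X in (X + _)%N](eq_big_nat _ _ (F2 := fun=> 1%N)) ?sum_nat_const_nat; last first.
  by move=> y /andP[_ ->].
rewrite [X in (_ + X)%N]big1_seq ?addn0 ?muln1 ?subn0// => y.
by rewrite mem_index_iota leqNgt => /andP[_ /andP[/negbTE -> _]].
Qed.

Let count_ge : (\sum_(y < K) ((K <= y + H) : nat) = H)%N.
Proof.
rewrite (reindex_inj rev_ord_inj)/= -[RHS]count_lt; apply: eq_bigr => y _.
have yK := ltn_ord y; have HK' := HK.
by have -> : (K <= K - y.+1 + H)%N = (y < H)%N by lia.
Qed.

(** Per axis and grid point the differences weigh [2 * rs] and the two boundary slabs [8 * rho] on
    average; [rho <= rs] because [s <= 1]. *)
Let sumc : \sum_a c a <= 10 * d%:R * K%:R ^+ d * rs.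
Proof.
have -> : \sum_a c a = \sum_(i < d) \sum_(k : {ffun 'I_d -> 'I_K})
    (2 * rs + (4 * (wrapf i k)%:R + 4 * (wrapb i k)%:R)).
  rewrite -(pair_big xpredT xpredT (fun (q : 'I_d * {ffun 'I_d -> 'I_K}) bb => c (q, bb)))/=.
  rewrite -(pair_big xpredT xpredT (fun i k => \sum_bb c ((i, k), bb)))/=.
  by apply: eq_bigr => i _; apply: eq_bigr => k _; rewrite big_bool.
rewrite (eq_bigr (fun=> (2 * rs + 8 * rho) * K%:R ^+ d)); last first.
  move=> i _; rewrite !big_split/= -!mulr_sumr.
  rewrite (sum_indic i (Q := fun y => (K <= y + H)%N) count_ge).
  rewrite (sum_indic i (Q := fun y => (y < H)%N) count_lt).
  by rewrite sumr_const card_ffun !card_ord -[rs *+ _]mulr_natr natrX; ring.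
rewrite sumr_const card_ord -[leLHS]mulr_natr.
have : rho <= rs.
  by rewrite /rs -[leLHS]powRr1 ?(ltW rho0)// ger_powR ?rho0//; have /andP[] := s01.
have Kd : 0 <= K%:R ^+ d :> R by exact: exprn_ge0.
have dd : 0 <= d%:R :> R by [].
have Kdd := mulr_ge0 Kd dd => h1.
have := ler_wpM2l Kdd h1; nra.
Qed.

(** The order of quantifiers matters: [W] depends neither on the frequency nor on the choice of sine
    or cosine, as the maximal inequality demands of its dominating variables. *)
Lemma oscillation_bound : exists W : Omega -> R,
  [/\ measurable_fun setT W, forall w, 0 <= W w,
    (Ex Pr (fun w => (W w `^ p)%R) <=
      ((10 * d%:R * K%:R ^+ d * rs / osc_gap) `^ p * D)%:E)%E &
    forall w kd (x : d.-tuple R) i,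
      (b ^ n)%:R <= `|tnth x i| <= (b ^ n.+1)%:R ->
      `|\sum_k F k w * wave kd (- (2 * pi * dotp x (gpt h k)))| <= W w].
Proof.
have g0 := osc_gap_gt0.
exists (fun w => osc_gap^-1 * \sum_a c a * z a w); split.
- by apply: measurable_funM => //; apply: measurable_sum => a; apply: measurable_funM.
- move=> w; rewrite mulr_ge0 ?invr_ge0 ?(ltW g0)// sumr_ge0// => a _.
  by rewrite mulr_ge0.
- have c'0 a : 0 <= osc_gap^-1 * c a by rewrite mulr_ge0// invr_ge0 (ltW g0).
  have := expectation_weighted p1 c'0 mz z0 zD.
  under eq_fun do under eq_bigr do rewrite -mulrA.
  under eq_fun do rewrite -mulr_sumr.
  move=> /le_trans; apply; rewrite lee_fin ler_wpM2r// le_powR//.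
  - exact: le_trans ler01 p1.
  - by apply: sumr_ge0 => a _; exact: c'0.
  - by rewrite -mulr_sumr mulrC ler_pM2r ?invr_gt0// sumc.
move=> w kd x i /andP[xn1 xn2].
pose theta (k : {ffun 'I_d -> 'I_K}) : R := - (2 * pi * dotp x (gpt h k)).
pose delta : R := 2 * pi * (tnth x i * (H%:R / (b ^ m * K)%:R)).
pose g k := wave kd (theta k).
have HmK : H%:R / (b ^ m * K)%:R = ((b ^ (n + 3))%:R)^-1 :> R.
  by rewrite /H /K !natrM; field; rewrite !gt_eqF.
have pi0 := pi_gt0 R.
have deltaE : `|delta| = 2 * pi * (`|tnth x i| / (b ^ (n + 3))%:R).
  by rewrite /delta HmK !normrM normfV (gtr0_norm pi0) (gtr0_norm (bp _)) normr_nat.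
have b4 : 4 <= (b ^ 2)%:R :> R by rewrite (ler_nat _ 4) (@leq_exp2r 2 b 2).
have delta1 : 2 * pi / (b ^ 3)%:R <= `|delta|.
  rewrite deltaE ler_wpM2l ?mulr_ge0 ?pi_ge0//.
  by rewrite ler_pdivlMr// expnD natrM mulrCA mulVf ?mulr1// gt_eqF.
have delta2 : `|delta| <= pi.
  have hx : `|tnth x i| / (b ^ (n + 3))%:R <= 2^-1.
    have -> : (n + 3 = n.+1 + 2)%N by rewrite addn3 addn2.
    rewrite ler_pdivrMr// expnD natrM.
    apply: (le_trans xn2); rewrite mulrCA ler_peMr// mulrC ler_pdivlMr// mul1r.
    by apply: le_trans b4; rewrite ler_nat.
  by rewrite deltaE [2 * pi]mulrC -mulrA ler_piMr ?pi_ge0// mulrC -ler_pdivlMr// mul1r.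
have cosd : cos delta <= cos (2 * pi / (b ^ 3)%:R).
  apply: cos_le_between => //.
  by rewrite divr_ge0// mulr_ge0// pi_ge0.
have thetaS (k k' : {ffun 'I_d -> 'I_K}) : (forall j, j != i -> k' j = k j) -> (k' i = k i + H :> nat)%N ->
    theta k' = theta k - delta.
  move=> kk ki; rewrite /theta (@dotp_gpt R d b m K x h k k' i H%:R kk).
    by rewrite /delta; ring.
  by rewrite ki natrD.
have BB' (k : {ffun 'I_d -> 'I_K}) : wrapb i (cshift K0 i H k) = wrapf i k by exact: cshift_wrap.
have := @oscillating_sum R _ (cshift K0 i H) (cshift K0 i (K - H)) (F ^~ w) g
  (fun k => wave kd (theta k - delta)) (fun k => wave kd (theta k + delta)) (cos delta)
  (wrapf i) (wrapb i) (cshiftK K0 i HK) (cshiftVK K0 i HK) (cos_le1 _)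
  (fun k => wave_le1 kd _) (fun k => wave_le1 kd _) (fun k => wave_le1 kd _).
move=> /(_ _ _ _ BB')osc.
have {osc} : (2 - 2 * cos delta) * `|\sum_k F k w * g k| <=
       2 * (\sum_(k | ~~ wrapf i k) `|F k w - F (cshift K0 i H k) w|) +
       4 * (\sum_(k | wrapf i k) `|F k w|) + 4 * (\sum_(k | wrapb i k) `|F k w|).
  apply: osc.
  - by move=> k; rewrite addrC wave_second_difference.
  - move=> k; rewrite /wrapf -ltnNge => wk; rewrite /g (thetaS k (cshift K0 i H k))//.
      by move=> j ji; rewrite cshift_neq.
    by rewrite cshift_forward.
  - move=> k; rewrite /wrapb -leqNgt => wk; rewrite /g.
    rewrite (thetaS (cshift K0 i (K - H) k) k) ?subrK//.
      by move=> j ji; rewrite cshift_neq.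
    by rewrite cshift_backward// subnK.
move=> osc; rewrite [leRHS]mulrC ler_pdivlMr//.
apply: (@le_trans _ _ ((2 - 2 * cos delta) * `|\sum_k F k w * g k|)).
  by rewrite mulrC ler_wpM2r// lerB// ler_wpM2l.
apply: (le_trans osc).
have -> : \sum_a c a * z a w = \sum_(i < d) \sum_(k : {ffun 'I_d -> 'I_K})
    \sum_bb c ((i, k), bb) * z ((i, k), bb) w.
  rewrite -(pair_big xpredT xpredT (fun (q : 'I_d * {ffun 'I_d -> 'I_K}) bb => c (q, bb) * z (q, bb) w))/=.
  by rewrite -(pair_big xpredT xpredT (fun i k => \sum_bb c ((i, k), bb) * z ((i, k), bb) w)).
(* Only the axis [i] on which the frequency is large is used; the terms of the other axes are
   nonnegative. *)
rewrite (bigD1 i)//= -[leLHS]addr0; apply: lerD; last first.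
  apply: sumr_ge0 => j _; apply: sumr_ge0 => k _; apply: sumr_ge0 => bb _.
  by rewrite mulr_ge0.
rewrite le_eqVlt; apply/orP; left; apply/eqP.
rewrite [X in 2 * X]big_mkcond [X in _ + 4 * X + _ = _]big_mkcond [X in _ + 4 * X = _]big_mkcond/=.
rewrite !mulr_sumr -!big_split/=; apply: eq_bigr => k _.
rewrite big_bool/= /c /z/=.
have rsn0 : rs != 0 by rewrite gt_eqF.
by case: (wrapf i k); case: (wrapb i k) => /=; field.
Qed.

End oscillation_bound.

Lemma expectation_powRB {dO : measure_display} {Omega : measurableType dO}
    {R : realType} (Pr : probability Omega R) (p : R) (X Y : Omega -> R) : 1 <= p ->
  measurable_fun setT X -> measurable_fun setT Y ->
  (Ex Pr (fun w => (`|X w - Y w| `^ p)%R) <= (2 `^ (p - 1))%:E *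
    (Ex Pr (fun w => (`|X w| `^ p)%R) + Ex Pr (fun w => (`|Y w| `^ p)%R)))%E.
Proof.
move=> p1 mX mY; have p0 : 0 <= p by exact: le_trans p1.
have mn (Z : Omega -> R) : measurable_fun setT Z ->
    measurable_fun setT (fun w => `|Z w| `^ p).
  move=> mZ; apply: (measurableT_comp (@measurable_powR R p)).
  exact: (measurableT_comp (@normr_measurable R setT)).
have n0 (Z : Omega -> R) w : 0 <= `|Z w| `^ p by exact: powR_ge0.
have mXY : measurable_fun setT (fun w => `|X w| `^ p + `|Y w| `^ p).
  by apply: measurable_funD; exact: mn.
have XY0 w : 0 <= `|X w| `^ p + `|Y w| `^ p by rewrite addr_ge0.
rewrite -(ExD Pr (mn _ mX) (n0 X) (mn _ mY) (n0 Y)) -(ExZ Pr mXY XY0) ?powR_ge0//.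
apply: Ex_le => //.
- by apply: mn; exact: measurable_funB.
- by apply: measurable_funM.
- move=> w; apply: le_trans (powRD_le p1 (normr_ge0 _) (normr_ge0 _)).
  by apply: le_powR => //; exact: ler_normB.
Qed.

Section chaos_increments.
Context {dO : measure_display} {Omega : measurableType dO} {R : realType}.
Variables (Pr : probability Omega R) (d b : nat).
Variable P : nat -> d.-tuple R -> Omega -> R.
Hypothesis b2 : (2 <= b)%N.
Hypothesis Pmeas : forall m,
  measurable_fun (ccube d `*` [set: Omega]) (fun z => P m z.1 z.2).
Hypothesis Pindep : independent_processes Pr [set: nat] (fun=> ccube d) P.
Hypothesis Pge0 : forall m t w, ccube d t -> 0 <= P m t w.
Variables (p alpha0 s C3 : R) (M : nat -> R).
Hypotheses (p1 : 1 <= p) (C30 : 0 <= C3) (M1 : forall j, 1 <= M j).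
Hypotheses (s01 : 0 <= s <= 1) (salpha : s <= alpha0).
Hypothesis PM : forall j t, hcube d t -> (Ex Pr (fun w => (P j t w `^ p)%R) <= (M j)%:E)%E.
Hypothesis PC3 : forall j (h : bindex d b j) t s, bcube h t -> bcube h s ->
  (Ex Pr (fun w => (`|P j t w - P j s w| `^ p)%R) <=
   (C3 * ((b ^ j)%:R * euclid_dist t s) `^ (alpha0 * p))%:E)%E.

Let b0 : (0 < b)%N. Proof. exact: leq_trans b2. Qed.
Let p0 : 0 <= p. Proof. exact: le_trans p1. Qed.
Let alpha00 : 0 <= alpha0. Proof. by have /andP[s0 _] := s01; exact: le_trans salpha. Qed.

(** At level 0 the subtracted term is 0 and not the constant density 1, so that the partial sums are
    the densities of the approximating measures themselves. Level 0 is consequently not centred. *)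
Definition chaosD m t w : R :=
  chaosQ P m.+1 t w - (if m is 0 then 0 else chaosQ P m t w).

Definition chaosB m : R := 2 `^ p * (m.+1)%:R `^ p * (1 + C3) * chaosA M m.+1.

Let A1 m : 1 <= chaosA M m. Proof. exact: chaosA_ge1. Qed.

Let AS m : chaosA M m <= chaosA M m.+1.
Proof.
by rewrite /chaosA big_ord_recr/= ler_peMr ?M1// -/(chaosA M m) (le_trans ler01).
Qed.

Lemma measurable_chaosD m t : ccube d t -> measurable_fun setT (chaosD m t).
Proof.
move=> ct; apply: measurable_funB; first exact: measurable_chaosQ.
by case: m => // m; exact: measurable_chaosQ.
Qed.

Let powp0 : 0 `^ p = 0 :> R.
Proof. by rewrite powR0// gt_eqF// (lt_le_trans ltr01 p1). Qed.

Let split2 (x : R) : 2 `^ (p - 1) * (x + x) = 2 `^ p * x.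
Proof. by rewrite -(@mulr_powRB1 _ 2 p) ?(lt_le_trans ltr01 p1)//; ring. Qed.

Lemma chaosB_ge0 m : 0 <= chaosB m.
Proof.
by rewrite /chaosB !mulr_ge0 ?powR_ge0// ?addr_ge0// (le_trans ler01).
Qed.

Lemma chaosD_moment m t : hcube d t ->
  (Ex Pr (fun w => (`|chaosD m t w| `^ p)%R) <= (chaosB m)%:E)%E.
Proof.
move=> ht; have ct := hcube_ccube ht.
pose Y w := if m is 0 then 0 : R else chaosQ P m t w.
have mY : measurable_fun setT Y.
  by rewrite /Y; case: (m) => // m'; exact: measurable_chaosQ.
have mX := measurable_chaosQ Pmeas m.+1 ct.
apply: (le_trans (expectation_powRB Pr p1 mX mY)).
have Qn j : (Ex Pr (fun w => (`|chaosQ P j t w| `^ p)%R) <= (chaosA M j)%:E)%E.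
  under eq_fun do rewrite ger0_norm ?chaosQ_ge0//.
  exact: (chaosQ_moment Pmeas Pindep Pge0 PM).
apply: (@le_trans _ _ ((2 `^ (p - 1))%:E * ((chaosA M m.+1)%:E + (chaosA M m.+1)%:E))%E).
  rewrite lee_wpmul2l ?lee_fin ?powR_ge0//; apply: leeD => //.
  rewrite /Y; case: (m) => [|m'].
    by under eq_fun do rewrite normr0 powp0; rewrite expectation_cst lee_fin (le_trans ler01).
  by apply: (le_trans (Qn _)); rewrite lee_fin.
rewrite -EFinD -EFinM lee_fin split2 /chaosB -!mulrA ler_wpM2l ?powR_ge0//.
have h1 : 1 <= (m.+1)%:R `^ p :> R.
  by rewrite -[leLHS](powRr0 (m.+1%:R : R)) ler_powR// ler1n.
rewrite mulrA ler_peMl ?(le_trans ler01)//.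
by have := C30; nra.
Qed.

Lemma chaosD_increment m (h : bindex d b m) t t' : bcube h t -> bcube h t' ->
  (Ex Pr (fun w => (`|chaosD m t w - chaosD m t' w| `^ p)%R) <=
   (chaosB m * ((b ^ m)%:R * euclid_dist t t') `^ (alpha0 * p))%:E)%E.
Proof.
move=> bt bt'.
have ct := bcube_ccube b0 bt; have ct' := bcube_ccube b0 bt'.
set D := _ `^ (alpha0 * p); have D0 : 0 <= D by exact: powR_ge0.
pose X w := chaosQ P m.+1 t w - chaosQ P m.+1 t' w.
pose Y w := if m is 0 then 0 : R else chaosQ P m t w - chaosQ P m t' w.
have mX : measurable_fun setT X by apply: measurable_funB; exact: measurable_chaosQ.
have mY : measurable_fun setT Y.
  by rewrite /Y; case: (m) => // m'; apply: measurable_funB; exact: measurable_chaosQ.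
have -> : (fun w => `|chaosD m t w - chaosD m t' w| `^ p) = fun w => `|X w - Y w| `^ p.
  apply/funext => w; rewrite /chaosD /X /Y; congr (`|_| `^ _).
  by case: (m) => [|m']; ring.
apply: (le_trans (expectation_powRB Pr p1 mX mY)).
pose E := (m.+1)%:R `^ p * (C3 * chaosA M m.+1) * D.
have CA0 j : 0 <= C3 * chaosA M j by rewrite mulr_ge0// (le_trans ler01).
have E0 : 0 <= E by rewrite mulr_ge0// mulr_ge0 ?powR_ge0 ?CA0.
have XE : (Ex Pr (fun w => (`|X w| `^ p)%R) <= E%:E)%E.
  exact: (chaosQ_increment b0 Pmeas Pindep Pge0 p1 C30 M1 alpha00 PM PC3 (leqnn _) bt bt').
have YE : (Ex Pr (fun w => (`|Y w| `^ p)%R) <= E%:E)%E.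
  rewrite /Y; case: (posnP m) => [m0|m0].
    by rewrite m0; under eq_fun do rewrite normr0 powp0; rewrite expectation_cst lee_fin.
  have -> : (fun w => `|match m with 0 => 0 | _.+1 => chaosQ P m t w - chaosQ P m t' w end| `^ p)
    = fun w => `|chaosQ P m t w - chaosQ P m t' w| `^ p.
    by apply/funext => w; case: (m) m0.
  apply: (le_trans (chaosQ_increment b0 Pmeas Pindep Pge0 p1 C30 M1 alpha00 PM PC3 (leqnSn m) bt bt')).
  rewrite lee_fin /E -/D ler_wpM2r// ler_pM ?powR_ge0//; last by rewrite ler_wpM2l.
  by apply: le_powR => //; rewrite ler_nat.
apply: (@le_trans _ _ ((2 `^ (p - 1))%:E * (E%:E + E%:E))%E).
  by rewrite lee_wpmul2l ?lee_fin ?powR_ge0//; exact: leeD.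
rewrite -EFinD -EFinM lee_fin split2 /E /chaosB !mulrA ler_wpM2r//.
rewrite -!mulrA !ler_wpM2l ?powR_ge0//.
rewrite ler_wpM2r ?(le_trans ler01)//; lra.
Qed.

Definition osc_const : R := 1 + 10 * d%:R / @osc_gap R b.

Let gap0 : 0 < @osc_gap R b. Proof. exact: osc_gap_gt0. Qed.

Lemma osc_const_ge1 : 1 <= osc_const.
Proof. by rewrite lerDl divr_ge0 ?mulr_ge0// ltW. Qed.

Definition scale_ratio m n : R := ((b ^ m)%:R / (b ^ (n + 3))%:R) `^ s.

(** If [m <= n + 3] the displacement [b^-(n+3)] fits in the cube and [oscillation_bound] applies.
    Smaller cubes see no oscillation, but then [scale_ratio] is at least 1 and the triangle
    inequality is enough. *)
Lemma cube_wave_bound m n kappa (h : bindex d b m) : (0 < kappa)%N ->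
  exists W : Omega -> R,
  [/\ measurable_fun setT W, forall w, 0 <= W w,
    (Ex Pr (fun w => (W w `^ p)%R) <=
      ((osc_const / (b ^ m)%:R ^+ d * scale_ratio m n) `^ p * chaosB m)%:E)%E &
    forall w kd (x : d.-tuple R) i,
      (b ^ n)%:R <= `|tnth x i| <= (b ^ n.+1)%:R ->
      `|((b ^ m * (b ^ (n + 3) * kappa))%:R ^+ d)^-1 *
        \sum_(k : {ffun 'I_d -> 'I_(b ^ (n + 3) * kappa)})
          chaosD m (gpt h k) w * wave kd (- (2 * pi * dotp x (gpt h k)))| <= W w].
Proof.
move=> kappa0; set K := (b ^ (n + 3) * kappa)%N; set N := (b ^ m * K)%N.
have K0 : (0 < K)%N by rewrite muln_gt0 expn_gt0 b0.
have bp j : 0 < (b ^ j)%:R :> R by rewrite ltr0n expn_gt0 b0.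
have KR0 : 0 < K%:R :> R by rewrite ltr0n.
have NE : N%:R = (b ^ m)%:R * K%:R :> R by rewrite natrM.
have NR0 : 0 < N%:R :> R by rewrite NE mulr_gt0.
have Nd0 : 0 <= (N%:R ^+ d)^-1 :> R by rewrite invr_ge0 exprn_ge0// ltW.
have B0 := chaosB_ge0 m.
have bg k : bcube h (@gpt R d b m K h k) by exact: bcube_gpt.
have hg k : hcube d (@gpt R d b m K h k) := bcube_hcube b0 (bg k).
have cg k : ccube d (@gpt R d b m K h k) := hcube_ccube (hg k).
have mD k : measurable_fun setT (chaosD m (@gpt R d b m K h k)).
  by apply: measurable_chaosD.
have Dm k := chaosD_moment m (hg k).
have oc1 := osc_const_ge1.
have [mn|nm] := leqP m (n + 3).
  have incr (i : 'I_d) (K0' : (0 < K)%N) (k : {ffun 'I_d -> 'I_K}) :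
      (k i + b ^ m * kappa < K)%N ->
      (Ex Pr (fun w => (`|chaosD m (gpt h k) w -
        chaosD m (gpt h (cshift K0' i (b ^ m * kappa) k)) w| `^ p)%R) <=
      (chaosB m * ((b ^ m)%:R / (b ^ (n + 3))%:R) `^ (alpha0 * p))%:E)%E.
    move=> kH.
    have := chaosD_increment (bg k) (bg (cshift K0' i (b ^ m * kappa) k)).
    rewrite (@euclid_dist_gpt R d b m K h k _ i (b ^ m * kappa)).
    - congr (_ <= (_ * (_ `^ _))%:E)%E.
      by rewrite /K !natrM; field; rewrite !gt_eqF// ltr0n.
    - by move=> j ji; rewrite cshift_neq.
    - by rewrite cshift_forward.
  have [W [mW W0 WE WS]] := oscillation_bound (b2 := b2) (kappa0 := kappa0) mn h
    (F := fun k => chaosD m (gpt h k)) p1 mD s01 salpha B0 Dm (fun i => incr i _).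
  exists (fun w => (N%:R ^+ d)^-1 * W w); split.
  - by apply: measurable_funM.
  - by move=> w; rewrite mulr_ge0.
  - under eq_fun do rewrite powRM//.
    rewrite ExZ ?powR_ge0//; last by move=> w; exact: powR_ge0.
      apply: (le_trans (lee_wpmul2l _ WE)); first by rewrite lee_fin powR_ge0.
      rewrite -EFinM lee_fin mulrA ler_wpM2r// -powRM//; last first.
        by rewrite divr_ge0// ?mulr_ge0 ?powR_ge0 ?exprn_ge0// ltW.
      apply: le_powR => //.
        by rewrite mulr_ge0// divr_ge0// ?mulr_ge0 ?powR_ge0 ?exprn_ge0// ltW.
      rewrite -/K -/(scale_ratio m n).
      have -> : (N%:R ^+ d)^-1 * (10 * d%:R * K%:R ^+ d * scale_ratio m n / osc_gap b) =
          (10 * d%:R / osc_gap b) / (b ^ m)%:R ^+ d * scale_ratio m n.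
        by rewrite NE exprMn; field; rewrite !gt_eqF ?exprn_gt0.
      have e2 : 0 <= ((b ^ m)%:R ^+ d)^-1 :> R by rewrite invr_ge0 exprn_ge0.
      rewrite ler_wpM2r ?powR_ge0// ler_wpM2r//.
      by rewrite /osc_const lerDr.
    by apply: (measurableT_comp (@measurable_powR R p)).
  - move=> w kd x i xi; rewrite normrM ger0_norm// ler_wpM2l//.
    exact: WS xi.
pose z (k : {ffun 'I_d -> 'I_K}) w := `|chaosD m (gpt h k) w|.
have mz k : measurable_fun setT (z k).
  exact: (measurableT_comp (@normr_measurable R setT)).
have zE := expectation_weighted p1 (fun k : {ffun 'I_d -> 'I_K} => Nd0) mz
  (fun k w => normr_ge0 _) Dm.
exists (fun w => \sum_(k : {ffun 'I_d -> 'I_K}) (N%:R ^+ d)^-1 * z k w); split.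
- by apply: measurable_sum => k; apply: measurable_funM.
- by move=> w; apply: sumr_ge0 => k _; rewrite mulr_ge0// normr_ge0.
- apply: (le_trans zE); rewrite lee_fin ler_wpM2r//.
  have sumE : \sum_(k : {ffun 'I_d -> 'I_K}) (N%:R ^+ d)^-1 = ((b ^ m)%:R ^+ d)^-1 :> R.
    rewrite sumr_const card_ffun !card_ord -[LHS]mulr_natr natrX NE exprMn.
    by field; rewrite !gt_eqF ?exprn_gt0.
  have e2 : 0 <= ((b ^ m)%:R ^+ d)^-1 :> R by rewrite invr_ge0 exprn_ge0.
  rewrite sumE; apply: le_powR => //.
  rewrite mulrAC; apply: ler_peMl => //.
  have r1 : 1 <= scale_ratio m n.
    rewrite /scale_ratio -[leLHS](powRr0 ((b ^ m)%:R / (b ^ (n + 3))%:R)) ler_powR//.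
      by rewrite ler_pdivlMr// mul1r ler_nat leq_pexp2l// ltnW.
    by have /andP[] := s01.
  have := ler_pM ler01 ler01 oc1 r1; by rewrite mul1r.
- move=> w kd x i xi; rewrite -mulr_sumr normrM ger0_norm// ler_wpM2l//.
  apply: (le_trans (ler_norm_sum _ _ _)); apply: ler_sum => k _.
  by rewrite normrM ler_piMr// wave_le1.
Qed.

End chaos_increments.

(** * The maximum over a grid of frequencies *)

Section frequencies.
Context {R : realType} (d b n : nat).

(* [freq] embeds [fgrid] as the mesh b^-n of [-b^(n+1), b^(n+1)]^d; the active points
   are those with sup norm at least b^n. *)
Definition fgrid := {ffun 'I_d -> 'I_(b ^ (2 * n + 1) * 2).+1}.

Definition freq (z : fgrid) : d.-tuple R :=
  [tuple ((z i)%:R - (b ^ (2 * n + 1))%:R) / (b ^ n)%:R | i < d].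

Definition active (z : fgrid) : bool := [exists i, (b ^ n)%:R <= `|tnth (freq z) i|].

Hypothesis b0 : (0 < b)%N.

Lemma freq_le z i : `|tnth (freq z) i| <= (b ^ n.+1)%:R.
Proof.
rewrite tnth_mktuple normrM normfV normr_nat ler_pdivrMr ?ltr0n ?expn_gt0 ?b0//.
rewrite -natrM -expnD (_ : (n.+1 + n = 2 * n + 1)%N); last by rewrite mul2n -addnn addn1 addSn.
rewrite ler_norml; have zi := ltn_ord (z i).
rewrite lerBrDr addrC subrr ler0n lerBlDr -natrD ler_nat addnn -muln2.
by rewrite -ltnS.
Qed.

Lemma activeP z : active z ->
  exists i, (b ^ n)%:R <= `|tnth (freq z) i| <= (b ^ n.+1)%:R.
Proof. by move=> /existsP[i iz]; exists i; rewrite iz freq_le. Qed.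

(** The sign in the index turns a one-sided maximum into a bound on absolute values, and makes the
    family sum to zero, as the lower bound on [lse] requires. Inactive mesh points carry the zero
    function. *)
Definition swave (x : fgrid * bool * bool) (t : d.-tuple R) : R :=
  (if x.2 then 1 else -1) *
  (if active x.1.1 then wave x.1.2 (- (2 * pi * dotp (freq x.1.1) t)) else 0).

Lemma swave_flip z kd sg t : swave (z, kd, ~~ sg) t = - swave (z, kd, sg) t.
Proof. by rewrite /swave/=; case: sg => /=; rewrite !mulN1r ?mul1r// opprK. Qed.

End frequencies.

Section class_tail.
Context {dO : measure_display} {Omega : measurableType dO} {R : realType}.
Variables (Pr : probability Omega R) (d b : nat).
Variable P : nat -> d.-tuple R -> Omega -> R.
Hypothesis b2 : (2 <= b)%N.
Hypothesis Pmeas : forall m,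
  measurable_fun (ccube d `*` [set: Omega]) (fun z => P m z.1 z.2).
Hypothesis Pindep : independent_processes Pr [set: nat] (fun=> ccube d) P.
Hypothesis Pge0 : forall m t w, ccube d t -> 0 <= P m t w.
Variables (p alpha0 s C3 : R) (M : nat -> R).
Hypotheses (p1 : 1 <= p) (C30 : 0 <= C3) (M1 : forall j, 1 <= M j).
Hypotheses (s01 : 0 <= s <= 1) (salpha : s <= alpha0).
Hypothesis PM : forall j t, hcube d t -> (Ex Pr (fun w => (P j t w `^ p)%R) <= (M j)%:E)%E.
Hypothesis PC3 : forall j (h : bindex d b j) t s, bcube h t -> bcube h s ->
  (Ex Pr (fun w => (`|P j t w - P j s w| `^ p)%R) <=
   (C3 * ((b ^ j)%:R * euclid_dist t s) `^ (alpha0 * p))%:E)%E.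

Let b0 : (0 < b)%N. Proof. exact: leq_trans b2. Qed.
Let p0 : 0 <= p. Proof. exact: le_trans p1. Qed.
Let alpha00 : 0 <= alpha0. Proof. by have /andP[s0 _] := s01; exact: le_trans salpha. Qed.

Hypothesis p2 : p <= 2.
Hypothesis Pmean1 : forall m t, ccube d t -> (Ex Pr (P m t) = 1)%E.
Variables (m n K : nat) (C : {set bindex d b m}) (theta : R).
Hypotheses (K0 : (0 < K)%N) (m0 : (0 < m)%N) (theta0 : 0 <= theta).
Hypothesis Cindep : independent_processes Pr [set h | h \in C] (fun h => bcube h) (fun=> P m).
Variable W : bindex d b m -> Omega -> R.
Hypotheses (mW : forall h, measurable_fun setT (W h)) (W0 : forall h w, 0 <= W h w).
Hypothesis WS : forall h w kd (x : d.-tuple R) i,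
  (b ^ n)%:R <= `|tnth x i| <= (b ^ n.+1)%:R ->
  `|((b ^ m * K)%:R ^+ d)^-1 * \sum_(k : {ffun 'I_d -> 'I_K})
     chaosD P m (gpt h k) w * wave kd (- (2 * pi * dotp x (gpt h k)))| <= W h w.

Let XI : finType := (fgrid d b n * bool * bool)%type.

Definition osc_entropy : R := 1 + ln #|XI|%:R.

Let Nd : R := theta / (b ^ m * K)%:R ^+ d.

Let Nd0 : 0 <= Nd. Proof. by rewrite divr_ge0// exprn_ge0. Qed.

Let X0 : (0 < #|XI|)%N.
Proof. by apply/card_gt0P; exists ([ffun=> ord0], true, true). Qed.

Let bm0 : (0 < b ^ m)%N. Proof. by rewrite expn_gt0 b0. Qed.
Let h0 : bindex d b m := [ffun=> Ordinal bm0].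
Let hh j := nth h0 (enum C) j.
Let size_C := size (enum C).
Let hhC j : (j < size_C)%N -> hh j \in C.
Proof. by move=> jn; rewrite -mem_enum; exact: mem_nth. Qed.

Let pt j (k : {ffun 'I_d -> 'I_K}) := @gpt R d b m K (hh j) k.
Let bpt j k : bcube (hh j) (pt j k). Proof. exact: bcube_gpt. Qed.
Let cpt j k : ccube d (pt j k). Proof. by move: (bpt j k); exact: bcube_ccube. Qed.

Let gp (x : XI) t : R := Num.max (swave x t) 0.
Let gn (x : XI) t : R := Num.max (- swave x t) 0.
Let gp0 x t : 0 <= gp x t. Proof. by rewrite le_max lexx orbT. Qed.
Let gn0 x t : 0 <= gn x t. Proof. by rewrite le_max lexx orbT. Qed.
Let gE x t : gp x t - gn x t = swave x t.
Proof.
rewrite /gp /gn; have [h|h] := leP 0 (swave x t).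
  by rewrite max_r ?subr0// oppr_le0.
by rewrite max_l ?opprK ?add0r// oppr_ge0 ltW.
Qed.

(** Taken with [gp, gn] and with [gn, gp], this gives the two nonnegative halves [Y1] and [Y2] of
    the maximal inequality: their difference pairs [chaosD] with the wave, and exchanging the two
    densities exchanges the halves. *)
Let Y (g1 g2 : XI -> d.-tuple R -> R) j x w := \sum_(k : {ffun 'I_d -> 'I_K})
  (Nd * g1 x (pt j k) * chaosQ P m.+1 (pt j k) w + Nd * g2 x (pt j k) * chaosQ P m (pt j k) w).

Let YB j x w : Y gp gn j x w - Y gn gp j x w =
  Nd * \sum_(k : {ffun 'I_d -> 'I_K}) chaosD P m (pt j k) w * swave x (pt j k).
Proof.
rewrite /Y -sumrB mulr_sumr; apply: eq_bigr => k _; rewrite -gE /chaosD.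
by case: (m) m0 => // m' _; ring.
Qed.

Let mQ j k l : measurable_fun setT (chaosQ P l (pt j k)).
Proof. exact: measurable_chaosQ. Qed.

Let Q0 l j k w : 0 <= chaosQ P l (pt j k) w. Proof. exact: chaosQ_ge0. Qed.

Let EQ l j k : (Ex Pr (chaosQ P l (pt j k)) = 1)%E.
Proof.
rewrite /chaosQ (@expectation_prodP _ _ _ Pr d P Pmeas Pindep (fun i w => P i (pt j k) w)).
- by under eq_bigr do rewrite Pmean1//; rewrite big1.
- by move=> i w; exact: Pge0.
- by move=> i; exact: measurable_process_sigma.
Qed.

Let expectation_lin (G : Omega -> R) (g1 g2 : XI -> d.-tuple R -> R) j x :
  measurable_fun setT G -> (forall w, 0 <= G w) ->
  (forall x t, 0 <= g1 x t) -> (forall x t, 0 <= g2 x t) ->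
  Ex Pr (fun w => G w * Y g1 g2 j x w) = (\sum_(k : {ffun 'I_d -> 'I_K})
   ((Nd * g1 x (pt j k))%:E * Ex Pr (fun w => (G w * chaosQ P m.+1 (pt j k) w)%R) +
    (Nd * g2 x (pt j k))%:E * Ex Pr (fun w => (G w * chaosQ P m (pt j k) w)%R)))%E.
Proof.
move=> mG G0 g10 g20.
have mGQ l k : measurable_fun setT (fun w => G w * chaosQ P l (pt j k) w).
  exact: measurable_funM.
have GQ0 l k w : 0 <= G w * chaosQ P l (pt j k) w by rewrite mulr_ge0.
have c10 k : 0 <= Nd * g1 x (pt j k) by rewrite mulr_ge0.
have c20 k : 0 <= Nd * g2 x (pt j k) by rewrite mulr_ge0.
have mcGQ (c : R) l k : measurable_fun setT (fun w => c * (G w * chaosQ P l (pt j k) w)).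
  by apply: measurable_funM.
have cGQ0 (c : R) l k w : 0 <= c -> 0 <= c * (G w * chaosQ P l (pt j k) w).
  by move=> c0; rewrite mulr_ge0.
rewrite (_ : (fun w => _) = fun w => \sum_(k : {ffun 'I_d -> 'I_K})
   (Nd * g1 x (pt j k) * (G w * chaosQ P m.+1 (pt j k) w) +
    Nd * g2 x (pt j k) * (G w * chaosQ P m (pt j k) w))); last first.
  by apply/funext => w; rewrite /Y mulr_sumr; apply: eq_bigr => k _; ring.
rewrite Ex_sum.
- apply: eq_bigr => k _; rewrite ExD ?ExZ//.
  + by move=> w; exact: cGQ0.
  + by move=> w; exact: cGQ0.
- by move=> k _; apply: measurable_funD.
- by move=> k _ w; rewrite addr_ge0// cGQ0.
Qed.

Let gens (h : bindex d b m) : set (set Omega) :=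
  [set P m t @^-1` B | t in bcube h & B in measurable].

Let gens_sub h : <<s gens h >> `<=` <<s genP P m >>.
Proof.
apply: sub_sigma_algebra2 => A [t bt [B mB <-]].
by exists t; [exact: bcube_ccube bt|exists B].
Qed.

Let B i : {fset bindex d b m} := [fset hh j | j in iota 0 i]%fset.

Let hh_notin i : (i < size_C)%N -> hh i \notin B i.
Proof.
move=> iC; apply/negP => /imfsetP[j /=]; rewrite mem_iota/= add0n => ji /eqP.
have jC : (j < size_C)%N by exact: ltn_trans iC.
by rewrite nth_uniq ?enum_uniq// gtn_eqF.
Qed.

Let past i := past_sigma (genP P) gens m (B i).

Let mP_past i j l k : (j < i)%N -> (l <= m)%N ->
  measurable_fun (setT : set (g_sigma_algebraType (past i))) (P l (pt j k)).
Proof.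
move=> ji; rewrite leq_eqVlt => /predU1P[->|lm].
  have hB : hh j \in B i by apply/imfsetP; exists j => //=; rewrite mem_iota.
  apply: (@past_sigma_snd _ _ _ (genP P) _ gens m (B i) (hh j) _ hB).
  exact: (measurable_process_sigma (P m) (bpt j k)).
apply: (@past_sigma_fst _ _ _ (genP P) _ gens m (B i) l _ lm).
exact: (measurable_process_sigma (P l) (cpt j k)).
Qed.

Let mQ_past i j l k : (j < i)%N -> (l <= m.+1)%N ->
  measurable_fun (setT : set (g_sigma_algebraType (past i))) (chaosQ P l (pt j k)).
Proof.
move=> ji lm; apply: measurable_prod => q _; apply: mP_past => //.
by rewrite -ltnS (leq_trans (ltn_ord q)).
Qed.

Let mQ_past0 i j k :
  measurable_fun (setT : set (g_sigma_algebraType (past i))) (chaosQ P m (pt j k)).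
Proof.
apply: measurable_prod => q _.
apply: (@past_sigma_fst _ _ _ (genP P) _ gens m (B i) q _ (ltn_ord q)).
exact: (measurable_process_sigma (P q) (cpt j k)).
Qed.

Let mY_past g1 g2 i j x : (j < i)%N ->
  measurable_fun (setT : set (g_sigma_algebraType (past i))) (Y g1 g2 j x).
Proof.
move=> ji; apply: measurable_sum => k; apply: measurable_funD;
by apply: measurable_funM => //; exact: mQ_past.
Qed.

Let G i x w := gibbs (fun y => osc_entropy * \sum_(j < i) (Y gp gn j y w - Y gn gp j y w)) x.

Let mG_past i x : measurable_fun (setT : set (g_sigma_algebraType (past i))) (G i x).
Proof.
apply: measurable_gibbs => y; apply: measurable_funM => //.
apply: measurable_sum => j; apply: measurable_funB; exact: mY_past.
Qed.

(** The new density is the old one times [P m] at a point of the current cube. The Gibbs weight and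
    the old density belong to the past, and the extra factor is independent of it with mean 1. *)
Let EGQ i x k : (i < size_C)%N ->
  Ex Pr (fun w => G i x w * chaosQ P m.+1 (pt i k) w) =
  Ex Pr (fun w => G i x w * chaosQ P m (pt i k) w).
Proof.
move=> iC.
transitivity (Ex Pr (fun w => (G i x w * chaosQ P m (pt i k) w) * P m (pt i k) w)).
  by congr (Ex Pr _); apply/funext => w; rewrite chaosQS mulrA.
have gind : mutually_independent Pr [set` (hh i |` B i)%fset] (fun h => <<s gens h >>).
  apply: mutually_independentS Cindep => [h /=|h _ A //].
  rewrite !inE => /orP[/eqP->|/imfsetP[j /=]]; first exact: hhC.
  by rewrite mem_iota/= add0n => ji ->; apply: hhC; exact: ltn_trans iC.
rewrite (expectation_past (genP_measurable Pmeas) Pindep (hh_notin iC) gens_sub gind).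
- by rewrite Pmean1// mule1.
- by apply: measurable_funM; [exact: mG_past|exact: mQ_past0].
- by move=> w; rewrite mulr_ge0// gibbs_ge0.
- exact: measurable_process_sigma.
- by move=> w; exact: Pge0.
Qed.

(** The increments of the maximal inequality are the cubes of the class in the order of their
    enumeration; [theta] normalises the threshold to 1. *)
Lemma class_tail :
  (Pr [set w | exists x : XI, (1 <= theta * (((b ^ m * K)%:R ^+ d)^-1 *
     \sum_(h in C) \sum_(k : {ffun 'I_d -> 'I_K})
       chaosD P m (gpt h k) w * swave x (gpt h k)))%R] <=
   (4 * osc_entropy `^ p)%:E * \sum_(h in C) Ex Pr (fun w => ((theta * W h w) `^ p)%R))%E.
Proof.
have sumC (T : nmodType) (f : bindex d b m -> T) : \sum_(h in C) f h = \sum_(j < size_C) f (hh j).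
  by rewrite -big_enum/= (big_nth h0) big_mkord.
have gm i x : measurable_fun setT (G i x).
  apply: (@measurable_past_sigma _ _ _ (genP P) (genP_measurable Pmeas) _ gens m (B i) gens_sub).
  exact: mG_past.
have p12 : 1 <= p <= 2 by rewrite p1 p2.
rewrite [X in (_ <= _ * X)%E]sumC.
have mY12 g1 g2 j x : measurable_fun setT (Y g1 g2 j x).
  apply: measurable_sum => k.
  by apply: measurable_funD; apply: measurable_funM.
have Y0 g1 g2 j x w : (forall x t, 0 <= g1 x t) -> (forall x t, 0 <= g2 x t) ->
    0 <= Y g1 g2 j x w.
  by move=> g10 g20; apply: sumr_ge0 => k _; rewrite addr_ge0// !mulr_ge0.
have YW j x w : `|Y gp gn j x w - Y gn gp j x w| <= theta * W (hh j) w.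
  rewrite YB /Nd -mulrA normrM (ger0_norm theta0) ler_wpM2l//.
  case: x => [[z kd] sg]; rewrite /swave/=; have [az|_] := boolP (active z); last first.
    by rewrite big1 ?mulr0 ?normr0// => k _; rewrite !mulr0.
  have [i iz] := activeP b0 az.
  apply: le_trans (WS (hh j) w kd iz); rewrite !normrM ler_wpM2l//.
  under eq_bigr do rewrite mulrCA; rewrite -mulr_sumr normrM.
  by case: sg; rewrite ?normrN normr1 mul1r.
have Ysym j w : \sum_x (Y gp gn j x w - Y gn gp j x w) = 0.
  pose flip (x : XI) : XI := (x.1, ~~ x.2).
  have flipK : involutive flip by move=> [[z kd] sg]; rewrite /flip/= negbK.
  set S := \sum_x _; have : S = - S; last by lra.
  rewrite {1}/S (reindex_inj (inv_inj flipK)) -sumrN; apply: eq_bigr => -[[z kd] sg] _.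
  rewrite !YB -mulrN -sumrN; congr (_ * _); apply: eq_bigr => k _.
  by rewrite /flip/= swave_flip mulrN.
have EY2 i x : (Ex Pr (Y gn gp i x) < +oo)%E.
  have := @expectation_lin (fun=> 1) gn gp i x (measurable_cst _) (fun=> ler01) gn0 gp0.
  under eq_fun do rewrite mul1r; move=> ->.
  apply: lte_sum_pinfty => k _.
  under eq_fun do rewrite mul1r; under [in X in (_ + X)%E]eq_fun do rewrite mul1r.
  by rewrite [X in (_ * X + _)%E]EQ [X in (_ + _ * X)%E]EQ !mule1 -EFinD ltry.
have cent i x : (i < size_C)%N ->
    Ex Pr (fun w => G i x w * Y gp gn i x w) = Ex Pr (fun w => G i x w * Y gn gp i x w).
  move=> iC; rewrite !expectation_lin//; try (by move=> w; exact: gibbs_ge0).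
  by apply: eq_bigr => k _; rewrite EGQ// addeC.
have SE x w : \sum_(j < size_C) (Y gp gn j x w - Y gn gp j x w) =
    theta * (((b ^ m * K)%:R ^+ d)^-1 * \sum_(h in C) \sum_(k : {ffun 'I_d -> 'I_K})
       chaosD P m (gpt h k) w * swave x (gpt h k)).
  rewrite sumC mulrA mulr_sumr; apply: eq_bigr => j _.
  by rewrite YB.
have := @maximal_inequality _ _ _ Pr XI p size_C (Y gp gn) (Y gn gp)
  (fun j w => theta * W (hh j) w) X0 p12
  (fun j x _ => mY12 gp gn j x) (fun j x _ => mY12 gn gp j x) _
  (fun j x w _ => Y0 gp gn j x w gp0 gn0) (fun j x w _ => Y0 gn gp j x w gn0 gp0)
  (fun j x w _ => YW j x w) (fun j w _ => Ysym j w) (fun j x _ => EY2 j x) cent.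
move=> /(_ (fun j _ => measurable_funM (measurable_cst _) (mW (hh j)))).
apply: le_trans; rewrite le_eqVlt; apply/orP; left; apply/eqP; congr (Pr _).
by apply/seteqP; split => w [x hx]; exists x; move: hx; rewrite SE.
Qed.

End class_tail.

Lemma measurable_exists_ge {dO : measure_display} {Omega : measurableType dO}
    {R : realType} (X : finType) (f : X -> Omega -> R) (c : R) :
  (forall x, measurable_fun setT (f x)) ->
  measurable [set w | exists x, c <= f x w].
Proof.
move=> mf; rewrite (_ : [set w | _] = \bigcup_(x in [set: X]) [set w | c <= f x w]).
  apply: fin_bigcup_measurable => [|x _]; first exact: finite_finset.
  rewrite -[X in measurable X]setTI (_ : [set w | _] = f x @^-1` `[c, +oo[%classic).
    exact: mf.
  by apply/seteqP; split => w /=; rewrite in_itv/= andbT.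
by apply/seteqP; split => [w [x Sx]|w [x _ Sx]]; exists x.
Qed.

Section riemann_tail.
Context {dO : measure_display} {Omega : measurableType dO} {R : realType}.
Variables (Pr : probability Omega R) (d b : nat).
Variable P : nat -> d.-tuple R -> Omega -> R.
Hypothesis b2 : (2 <= b)%N.
Hypothesis Pmeas : forall m,
  measurable_fun (ccube d `*` [set: Omega]) (fun z => P m z.1 z.2).
Hypothesis Pindep : independent_processes Pr [set: nat] (fun=> ccube d) P.
Hypothesis Pge0 : forall m t w, ccube d t -> 0 <= P m t w.
Variables (p alpha0 s C3 : R) (M : nat -> R).
Hypotheses (p1 : 1 <= p) (C30 : 0 <= C3) (M1 : forall j, 1 <= M j).
Hypotheses (s01 : 0 <= s <= 1) (salpha : s <= alpha0).
Hypothesis PM : forall j t, hcube d t -> (Ex Pr (fun w => (P j t w `^ p)%R) <= (M j)%:E)%E.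
Hypothesis PC3 : forall j (h : bindex d b j) t s, bcube h t -> bcube h s ->
  (Ex Pr (fun w => (`|P j t w - P j s w| `^ p)%R) <=
   (C3 * ((b ^ j)%:R * euclid_dist t s) `^ (alpha0 * p))%:E)%E.

Let b0 : (0 < b)%N. Proof. exact: leq_trans b2. Qed.
Let p0 : 0 <= p. Proof. exact: le_trans p1. Qed.
Let alpha00 : 0 <= alpha0. Proof. by have /andP[s0 _] := s01; exact: le_trans salpha. Qed.

Hypothesis p2 : p <= 2.
Hypothesis Pmean1 : forall m t, ccube d t -> (Ex Pr (P m t) = 1)%E.
Variables (m n kappa N : nat) (col : bindex d b m -> 'I_N) (lambda : R).
Hypotheses (kappa0 : (0 < kappa)%N) (lambda0 : 0 < lambda).
(** The injective case is meant for the low levels, out of reach of Assumption 1: a class is then a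
    single cube, and neither independence nor centring enters. *)
Hypothesis colP : injective col \/ ((0 < m)%N /\
  forall c, independent_processes Pr [set h | col h = c] (fun h => bcube h) (fun=> P m)).

Let K := (b ^ (n + 3) * kappa)%N.
Let XI : finType := (fgrid d b n * bool * bool)%type.

(* Independence is only used for these finite sums: an integral over a cube need not be
   measurable for the sigma-algebra generated by the process on that cube. *)
Definition riemann_sum K' (x : fgrid d b n * bool * bool) w : R :=
  ((b ^ m * K')%:R ^+ d)^-1 *
  \sum_(h : bindex d b m) \sum_(k : {ffun 'I_d -> 'I_K'}) chaosD P m (gpt h k) w * swave x (gpt h k).

(** In order: the cost of the maximum over the mesh, the threshold [lambda / N] left to each of the
    [N] classes, the number of cubes, and the moment of one cube. The refinement [kappa] does not
    appear. *)
Definition tail_bound : R :=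
  4 * osc_entropy d b n `^ p * (N%:R / lambda) `^ p * (b ^ (m * d))%:R *
  ((osc_const d b / (b ^ m)%:R ^+ d * scale_ratio b s m n) `^ p * chaosB p C3 M m).

Let K0 : (0 < K)%N. Proof. by rewrite muln_gt0 expn_gt0 b0. Qed.

(** If the sum over the classes reaches [lambda], then some class reaches [lambda / N]; the tails of
    the classes add up to a sum over all cubes. *)
Lemma riemann_tail :
  (Pr [set w | exists x, (lambda <= riemann_sum K x w)%R] <= (tail_bound)%:E)%E.
Proof.
have ent1 : 1 <= osc_entropy d b n :> R.
  rewrite /osc_entropy lerDl ln_ge0// ler1n; apply/card_gt0P.
  by exists ([ffun=> ord0], true, true).
have entp : 1 <= osc_entropy d b n `^ p :> R.
  by rewrite -[leLHS](powRr0 (osc_entropy d b n)) ler_powR.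
have cw (h : bindex d b m) := cube_wave_bound b2 Pmeas Pindep Pge0 p1 C30 M1 s01 salpha PM PC3 n h kappa0.
have [W WP] := choice cw.
pose theta : R := N%:R / lambda.
have theta0 : 0 <= theta by rewrite divr_ge0// ltW.
have mW h : measurable_fun setT (W h) by have [] := WP h.
have W0 h w : 0 <= W h w by have [_ W0 _ _] := WP h.
have WE h : (Ex Pr (fun w => ((theta * W h w) `^ p)%R) <= (theta `^ p *
    ((osc_const d b / (b ^ m)%:R ^+ d * scale_ratio b s m n) `^ p * chaosB p C3 M m))%:E)%E.
  have [_ _ WE _] := WP h.
  have mWp : measurable_fun setT (fun w => W h w `^ p).
    exact: (measurableT_comp (@measurable_powR R p)).
  under eq_fun do rewrite powRM//.
  rewrite (ExZ Pr mWp (fun w => powR_ge0 _ _)) ?powR_ge0// EFinM.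
  by rewrite lee_wpmul2l// lee_fin powR_ge0.
have mthetaW h : measurable_fun setT (fun w => (theta * W h w) `^ p).
  by apply: (measurableT_comp (@measurable_powR R p)); apply: measurable_funM.
pose Ci c : {set bindex d b m} := [set h | col h == c]%SET.
pose part (C : {set bindex d b m}) (x : fgrid d b n * bool * bool) w : R := ((b ^ m * K)%:R ^+ d)^-1 *
  \sum_(h in C) \sum_(k : {ffun 'I_d -> 'I_K}) chaosD P m (gpt h k) w * swave x (gpt h k).
have mcell (h : bindex d b m) (x : fgrid d b n * bool * bool) : measurable_fun setT (fun w => \sum_(k : {ffun 'I_d -> 'I_K})
    chaosD P m (gpt h k) w * swave x (gpt h k)).
  apply: measurable_sum => k; apply: measurable_funM => //.
  apply: measurable_chaosD => //.
  have : bcube h (@gpt R d b m K h k) by exact: bcube_gpt.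
  exact: bcube_ccube.
have mpart (C : {set bindex d b m}) x : measurable_fun setT (part C x).
  rewrite /part; apply: measurable_funM => //.
  under eq_fun do rewrite big_mkcond; apply: measurable_sum => h.
  by case: (h \in C).
have WS h w (x : XI) : `|((b ^ m * K)%:R ^+ d)^-1 * \sum_(k : {ffun 'I_d -> 'I_K})
     chaosD P m (gpt h k) w * swave x (gpt h k)| <= W h w.
  case: x => [[z kd] sg]; rewrite /swave/=; have [az|_] := boolP (active z); last first.
    by rewrite big1 ?mulr0 ?normr0// => k _; rewrite !mulr0.
  have [i iz] := activeP b0 az.
  have [_ _ _ WS] := WP h; apply: le_trans (WS w kd _ i iz); rewrite !normrM ler_wpM2l//.
  under eq_bigr do rewrite mulrCA; rewrite -mulr_sumr normrM.
  by case: sg; rewrite ?normrN normr1 mul1r.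
pose Ev c := [set w | exists x : XI, 1 <= theta * part (Ci c) x w].
have mEv c : measurable (Ev c).
  by apply: measurable_exists_ge => x; apply: measurable_funM.
have EvE c : (Pr (Ev c) <= (4 * osc_entropy d b n `^ p)%:E *
    \sum_(h in Ci c) Ex Pr (fun w => ((theta * W h w) `^ p)%R))%E.
  case: colP => [icol|[m0 cind]]; last first.
    apply: (class_tail b2 Pmeas Pindep Pge0 p1 p2 Pmean1 K0 m0 theta0) => //.
    - apply: mutually_independentS (cind c) => [h /=|h _ A //].
      by rewrite inE => /eqP.
    - by move=> h w kd x i xi; have [_ _ _ WS'] := WP h; exact: WS' xi.
  (* Injective colours: a class holds at most one cube, and Markov's inequality for the power of its
     bound [W] is enough. *)
  have mS : measurable_fun setT (fun w => \sum_(h in Ci c) (theta * W h w) `^ p).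
    under eq_fun do rewrite big_mkcond; apply: measurable_sum => h.
    by case: (h \in Ci c).
  have S0 w : 0 <= \sum_(h in Ci c) (theta * W h w) `^ p.
    by apply: sumr_ge0 => h _; exact: powR_ge0.
  rewrite -Ex_sum//; last by move=> h _ w; exact: powR_ge0.
  apply: (@le_trans _ _ (Ex Pr (fun w => (\sum_(h in Ci c) (theta * W h w) `^ p)%R))); last first.
    rewrite -[leLHS]mul1e lee_wpmul2r ?expectation_ge0//.
    by rewrite lee_fin; have := entp; lra.
  apply: (@le_trans _ _ (Pr [set w | (1 <= \sum_(h in Ci c) (theta * W h w) `^ p)%R])); last first.
    by have := Ex_markov Pr mS S0 ler01; rewrite mul1e.
  apply: le_measure; rewrite ?inE//.
    rewrite -[X in measurable X]setTI (_ : [set w | _] =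
      (fun w => \sum_(h in Ci c) (theta * W h w) `^ p) @^-1` `[1, +oo[%classic).
      exact: mS.
    by apply/seteqP; split => w /=; rewrite in_itv/= andbT.
  move=> w [x]; rewrite /part.
  have [->|[h hC]] := set_0Vmem (Ci c).
    by rewrite big_set0 !mulr0 => /(lt_le_trans ltr01); rewrite ltxx.
  have -> : Ci c = [set h]%SET.
    apply/setP => h'; move: hC; rewrite !inE => /eqP hc; apply/eqP/eqP => [h'c|->//].
    by apply: icol; rewrite hc.
  rewrite !big_set1 => h1; rewrite /= big_set1.
  apply: (@le_trans _ _ (1 `^ p)); first by rewrite powR1.
  apply: le_powR => //.
  apply: (le_trans h1); rewrite ler_wpM2l//.
  by apply: le_trans (WS h w x); exact: ler_norm.
have mtot : measurable [set w | exists x, lambda <= riemann_sum K x w].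
  apply: measurable_exists_ge => x; rewrite /riemann_sum; apply: measurable_funM => //.
  by apply: measurable_sum => h.
(* The events are extended by the empty set to all natural numbers, the index set of Boole's
   inequality. *)
pose Ev' j := if insub j is Some c then Ev c else set0.
have Ev'E (c : 'I_N) : Ev' c = Ev c by rewrite /Ev' valK.
have mEv' j : (j < N)%N -> measurable (Ev' j).
  by move=> jN; rewrite -[j]/(val (Ordinal jN)) Ev'E.
have cover : [set w | exists x, lambda <= riemann_sum K x w] `<=`
    \big[setU/set0]_(j < N) Ev' j.
  move=> w [x hx]; rewrite -bigcup_mkord.
  apply: contrapT => nE.
  have small c : part (Ci c) x w < lambda / N%:R.
    rewrite ltNge; apply/negP => h; apply: nE; exists (val c); first exact: ltn_ord.
    rewrite Ev'E; exists x; rewrite /theta -ler_pdivrMl ?invf_div ?mulr1//.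
    by rewrite divr_gt0// ltr0n (leq_ltn_trans _ (ltn_ord c)).
  have sumE : riemann_sum K x w = \sum_c part (Ci c) x w.
    rewrite /riemann_sum /part -mulr_sumr; congr (_ * _).
    rewrite (partition_big col xpredT)//=; apply: eq_bigr => c _.
    by apply: eq_bigl => h; rewrite inE.
  have Npos : (0 < N)%N.
    by rewrite (leq_ltn_trans _ (ltn_ord (col [ffun=> Ordinal (_ : 0 < b ^ m)%N])))// expn_gt0 b0.
  have : \sum_c part (Ci c) x w < \sum_(c < N) lambda / N%:R.
    apply: ltr_sum => [|c _]; last exact: small.
    by apply/hasP; exists (Ordinal Npos) => //; rewrite mem_index_enum.
  rewrite -sumE sumr_const card_ord -[X in _ < X]mulr_natr divfK ?gt_eqF ?ltr0n//.
  by rewrite ltNge hx.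
have mbig : measurable (\big[setU/set0]_(j < N) Ev' j).
  by apply: bigsetU_measurable => j _; exact: (mEv' _ (ltn_ord j)).
have le1 : (Pr [set w | exists x, (lambda <= riemann_sum K x w)%R] <=
    Pr (\big[setU/set0]_(j < N) Ev' j))%E.
  by apply: le_measure cover; rewrite inE.
apply: (le_trans le1); apply: (le_trans (Boole_inequality _ mEv')).
apply: (@le_trans _ _ (\sum_(c < N) (4 * osc_entropy d b n `^ p)%:E *
    \sum_(h in Ci c) Ex Pr (fun w => ((theta * W h w) `^ p)%R))%E).
  by apply: lee_sum => c _; rewrite Ev'E; exact: EvE.
rewrite -ge0_sume_distrr; last first.
  by move=> c _; apply: sume_ge0 => h _; apply: expectation_ge0 => w; exact: powR_ge0.
have -> : (\sum_(c < N) \sum_(h in Ci c) Ex Pr (fun w => ((theta * W h w) `^ p)%R) =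
    \sum_h Ex Pr (fun w => ((theta * W h w) `^ p)%R))%E.
  rewrite [RHS](partition_big col xpredT)//=; apply: eq_bigr => c _.
  by apply: eq_bigl => h; rewrite inE.
have c4 : 0 <= 4 * osc_entropy d b n `^ p :> R by rewrite mulr_ge0 ?powR_ge0.
apply: (@le_trans _ _ ((4 * osc_entropy d b n `^ p)%:E * \sum_(h : bindex d b m) (theta `^ p *
    ((osc_const d b / (b ^ m)%:R ^+ d * scale_ratio b s m n) `^ p * chaosB p C3 M m))%:E)%E).
  by rewrite lee_wpmul2l ?lee_fin//; apply: lee_sum => h _; exact: WE.
rewrite sumEFin sumr_const card_ffun !card_ord -EFinM lee_fin /tail_bound -/theta expnM.
by rewrite -[X in _ * X <= _]mulr_natr le_eqVlt; apply/orP; left; apply/eqP; ring.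
Qed.

End riemann_tail.

(** * From Riemann sums to integrals *)

Section lebesgue_product_sets.
Context {R : realType}.
Local Open Scope ereal_scope.

(** Sides are indexed by [nat] so that the induction on [n] can shift the family without a cast of
    ordinals. *)
Definition tuple_prod n (A : nat -> set R) : set (n.-tuple R) :=
  [set t | forall i : 'I_n, A i (tnth t i)].

Arguments tuple_prod n A : clear implicits.

Lemma measurable_tuple_prod n (A : nat -> set R) : (forall i, measurable (A i)) ->
  measurable (tuple_prod n A).
Proof.
move=> mA; rewrite (_ : tuple_prod n A = \bigcap_(i in [set: 'I_n])
    ((fun t : n.-tuple R => tnth t i) @^-1` A i)).
  apply: fin_bigcap_measurable => // i _; rewrite -[X in measurable X]setTI.
  by apply: measurable_tnth.
by apply/seteqP; split => t h i; [move=> _; exact: h|exact: (h i Logic.I)].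
Qed.

Lemma lebesgue_tuple_prod n (A : nat -> set R) : (forall i, measurable (A i)) ->
  lebesgue_tuple n (tuple_prod n A) = \prod_(i < n) lebesgue_measure (A i).
Proof.
elim: n A => [|n IH] A mA.
  by rewrite big_ord0/= diracE mem_set// => -[].
rewrite big_ord_recl/= /lebesgue_cons /pushforward.
rewrite (_ : _ @^-1` tuple_prod n.+1 A =
    A 0%N `*` tuple_prod n (fun i => A i.+1)); last first.
  apply/seteqP; split => [[x t] /= h|[x t] /= [Ax At] i].
    split; first by have := h ord0; rewrite tnth0.
    by move=> i; have := h (lift ord0 i); rewrite tnthS.
  by case: (unliftP ord0 i) => [j|] ->; rewrite ?tnth0 ?tnthS//; exact: At.
have mt : measurable (tuple_prod n (fun i => A i.+1)) by exact: measurable_tuple_prod.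
by rewrite product_measure1E; [rewrite IH|exact: (mA 0%N)|exact: mt].
Qed.

End lebesgue_product_sets.
Arguments tuple_prod {R} n A.

Section cells.
Context {R : realType} (d b m K : nat).
Hypotheses (b0 : (0 < b)%N) (K0 : (0 < K)%N).
Let I := (bindex d b m * {ffun 'I_d -> 'I_K})%type.
Let N : R := (b ^ m * K)%:R.
Let N0 : 0 < N. Proof. by rewrite ltr0n muln_gt0 expn_gt0 b0. Qed.

Definition cell (a : bindex d b m * {ffun 'I_d -> 'I_K}) : set (d.-tuple R) :=
  [set t | forall i, (a.1 i * K + a.2 i)%:R / (b ^ m * K)%:R <= tnth t i <
                     (a.1 i * K + a.2 i).+1%:R / (b ^ m * K)%:R].

Let side (a : I) (j : nat) : set R :=
  if insub j is Some i then
    `[(a.1 i * K + a.2 i)%:R / N, (a.1 i * K + a.2 i).+1%:R / N[%classic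
  else setT.

Let cellE a : cell a = tuple_prod d (side a).
Proof.
by apply/seteqP; split => t h i; have := h i; rewrite /side valK /= in_itv.
Qed.

Let measurable_side a j : measurable (side a j).
Proof. by rewrite /side; case: insubP => [i _ _|_]. Qed.

Lemma measurable_cell a : measurable (cell a).
Proof. by rewrite cellE; exact: measurable_tuple_prod. Qed.

Lemma lebesgue_cell a : lebesgue_tuple d (cell a) = ((N ^+ d)^-1)%:E.
Proof.
rewrite cellE lebesgue_tuple_prod//.
rewrite (eq_bigr (fun=> (N^-1)%:E)); last first.
  move=> i _; rewrite /side valK lebesgue_measure_itv/= lte_fin.
  rewrite ltr_pM2r ?invr_gt0// ltr_nat ltnSn -EFinD -mulrBl.
  by rewrite -natr1 addrAC subrr add0r mul1r.
by rewrite prodEFin prodr_const card_ord exprVn.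
Qed.

Lemma cell_coord a t i : cell a t -> `|tnth t i - tnth (gpt a.1 a.2) i| <= N^-1.
Proof.
move=> /(_ i)/andP[t1 t2]; rewrite tnth_mktuple ger0_norm ?subr_ge0//.
rewrite lerBlDl (le_trans (ltW t2))// -natr1 mulrDl mul1r.
by [].
Qed.

Lemma cell_bcube a : cell a `<=` bcube a.1.
Proof.
move=> t h i; have /andP[t1 t2] := h i.
have bm0 : 0 < (b ^ m)%:R :> R by rewrite ltr0n expn_gt0 b0.
have KR0 : 0 < K%:R :> R by rewrite ltr0n.
have kK := ltn_ord (a.2 i).
have NE (x : nat) : x%:R / (b ^ m)%:R = (x * K)%:R / (b ^ m * K)%:R :> R.
  by rewrite !natrM; field; rewrite !gt_eqF.
apply/andP; split; rewrite NE.
  by apply: le_trans t1; rewrite ler_pM2r ?invr_gt0// ler_nat leq_addr.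
apply: (lt_le_trans t2); rewrite ler_pM2r ?invr_gt0// ler_nat.
by rewrite -addnS mulSn [leqRHS]addnC leq_add2l.
Qed.

Lemma trivIset_cell : trivIset setT cell.
Proof.
apply/trivIsetP => a e _ _; apply: contraNeq => /set0P[t [ta te]].
have ae i : (a.1 i * K + a.2 i = e.1 i * K + e.2 i)%N.
  have /andP[a1 a2] := ta i; have /andP[e1 e2] := te i.
  have := le_lt_trans a1 e2; have := le_lt_trans e1 a2.
  rewrite !ltr_pM2r ?invr_gt0// !ltr_nat !ltnS => h1 h2.
  by apply/eqP; rewrite eqn_leq h1 h2.
have a1 i : a.1 i = e.1 i.
  apply: val_inj => /=; have := congr1 (divn ^~ K) (ae i).
  by rewrite !divnMDl// !divn_small// !addn0.
have a2 i : a.2 i = e.2 i.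
  apply: val_inj => /=; have := congr1 (modn ^~ K) (ae i).
  by rewrite !modnMDl !modn_small.
by case: a e a1 a2 {ta te ae} => [a1 a2] [e1 e2] /= h1 h2; apply/eqP; congr pair; apply/ffunP.
Qed.

Lemma bigcup_cell : \bigcup_(a in [set: bindex d b m * {ffun 'I_d -> 'I_K}]) cell a = @hcube R d.
Proof.
apply/seteqP; split => [t [a _ /cell_bcube]|t ht]; first exact: bcube_hcube.
pose z i := Num.truncn (tnth t i * N).
have t0 i : 0 <= tnth t i * N by have /andP[h _] := ht i; rewrite mulr_ge0// ltW.
have zt i : (z i)%:R <= tnth t i * N < (z i).+1%:R.
  by rewrite /z; exact: truncn_itv.
have zN i : (z i < b ^ m * K)%N.
  rewrite -(ltr_nat R); have /andP[z1 _] := zt i; apply: (le_lt_trans z1).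
  by have /andP[_ h] := ht i; rewrite -[ltRHS]mul1r ltr_pM2r.
have zd i : (z i %/ K < b ^ m)%N by rewrite ltn_divLR.
have zm i : (z i %% K < K)%N by rewrite ltn_pmod.
exists ([ffun i => Ordinal (zd i)], [ffun i => Ordinal (zm i)]) => // i /=.
rewrite !ffunE/= -divn_eq; have /andP[z1 z2] := zt i.
by rewrite ler_pdivrMr// ltr_pdivlMr// z1 z2.
Qed.

End cells.

Lemma measurable_hcube {R : realType} d : measurable (@hcube R d).
Proof.
rewrite (_ : hcube d = tuple_prod d (fun=> `[0, 1[%classic)).
  exact: measurable_tuple_prod.
by apply/seteqP; split => t h i; have := h i; rewrite /= in_itv.
Qed.

Lemma euclid_dist_le {R : realType} d (t t' : d.-tuple R) :
  euclid_dist t t' <= \sum_i `|tnth t i - tnth t' i|.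
Proof.
set S := \sum_i `|_|; have S0 : 0 <= S by exact: sumr_ge0.
rewrite /euclid_dist -[leRHS](ger0_norm S0) -sqrtr_sqr ler_wsqrtr//.
rewrite expr2 {1}/S mulr_suml; apply: ler_sum => i _.
rewrite -[_ ^+ 2]real_normK ?num_real// expr2 ler_wpM2l//.
by rewrite /S (bigD1 i)//= lerDl sumr_ge0.
Qed.

Section tonelli_on.
Context {d1 d2 : measure_display} {T : measurableType d1} {Omega : measurableType d2}.
Context {R : realType}.
Variables (l : {sigma_finite_measure set T -> \bar R}) (Pr : probability Omega R).
Variables (A : set T) (F : T -> Omega -> R).
Hypotheses (mA : measurable A).
Hypothesis mF : measurable_fun (A `*` [set: Omega]) (fun z => F z.1 z.2).
Local Open Scope ereal_scope.

(** Extension by zero: the measurability and the sign of [F] are known over [A] only. *)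
Let f (z : T * Omega) : \bar R := ((fun z => (F z.1 z.2)%:E) \_ (A `*` setT)) z.

Let mf : measurable_fun setT f.
Proof.
apply/(measurable_restrictT _ (measurableX mA measurableT)).
exact/measurable_EFinP.
Qed.

Let fE t w : f (t, w) = ((fun t => (F t w)%:E) \_ A) t.
Proof.
rewrite /f !patchE; congr (if _ then _ else _).
by apply/idP/idP; rewrite !inE/=; [case|].
Qed.

Lemma measurable_section w : measurable_fun A (F ^~ w).
Proof.
have := measurableT_comp mf (pair2_measurable w).
rewrite (_ : _ \o _ = (fun t => (F t w)%:E) \_ A); last first.
  by apply/funext => t /=; rewrite fE.
by move/(measurable_restrictT _ mA)/measurable_EFinP.
Qed.

Hypothesis F0 : forall t w, A t -> (0 <= F t w)%R.

Let f0 z : 0 <= f z.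
Proof.
by rewrite /f patchE; case: ifPn => // /set_mem[/= At _]; rewrite lee_fin F0.
Qed.

Lemma measurable_integral_section :
  measurable_fun setT (fun w => \int[l]_(t in A) (F t w)%:E).
Proof.
have := @measurable_fun_fubini_tonelli_G _ _ _ _ _ l f mf f0.
congr measurable_fun; apply/funext => w; rewrite /fubini_G [RHS]integral_mkcond.
by apply: eq_integral => t _; rewrite fE.
Qed.

Lemma measurable_expectation_section : measurable_fun A (fun t => Ex Pr (F t)).
Proof.
have := measurable_funTS (D := A) (@measurable_fun_fubini_tonelli_F _ _ _ _ _ Pr f mf f0).
apply: eq_measurable_fun => t At; rewrite /fubini_F.
under eq_integral do rewrite fE patchE.
by rewrite At unlock.
Qed.

Lemma tonelli_on :
  \int[Pr]_w \int[l]_(t in A) (F t w)%:E = \int[l]_(t in A) Ex Pr (F t).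
Proof.
transitivity (\int[Pr]_w \int[l]_t f (t, w)).
  apply: eq_integral => w _; rewrite integral_mkcond.
  by apply: eq_integral => t _; rewrite fE.
rewrite -fubini_tonelli// [RHS]integral_mkcond; apply: eq_integral => t _.
rewrite patchE; under eq_integral do rewrite fE patchE.
case: ifP => _; first by rewrite unlock.
by rewrite integral0.
Qed.

End tonelli_on.

Section riemann_error.
Context {dO : measure_display} {Omega : measurableType dO} {R : realType}.
Variables (Pr : probability Omega R) (d b m K : nat).
Hypotheses (b0 : (0 < b)%N) (K0 : (0 < K)%N).
Variables (X : finType) (g : X -> d.-tuple R -> R) (D : d.-tuple R -> Omega -> R).
Variables (B L alpha0 : R).
Hypotheses (B0 : 0 <= B) (L0 : 0 <= L) (alpha00 : 0 <= alpha0).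
Hypothesis mg : forall x, measurable_fun setT (g x).
Hypothesis g1 : forall x t, `|g x t| <= 1.
Hypothesis gL : forall x t t', `|g x t - g x t'| <= L * \sum_i `|tnth t i - tnth t' i|.
Hypothesis mD : measurable_fun (hcube d `*` [set: Omega]) (fun z => D z.1 z.2).
Hypothesis mDt : forall t, hcube d t -> measurable_fun setT (D t).
Hypothesis ED : forall t, hcube d t -> (Ex Pr (fun w => `|D t w|%R) <= B%:E)%E.
Hypothesis EI : forall (h : bindex d b m) t t', bcube h t -> bcube h t' ->
  (Ex Pr (fun w => `|D t w - D t' w|%R) <= (B * ((b ^ m)%:R * euclid_dist t t') `^ alpha0)%:E)%E.

Let I := (bindex d b m * {ffun 'I_d -> 'I_K})%type.
Let l : {sigma_finite_measure set (d.-tuple R) -> \bar R} := lebesgue_tuple d.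
Let pt (a : I) : d.-tuple R := gpt a.1 a.2.

Definition cell_error (x : X) (a : I) t w : R := `|D t w * g x t - D (pt a) w * g x (pt a)|.

(** The error is summed over the family [X], so that a single variable dominates it for all waves at
    once. The loss of a factor [#|X|] is harmless, since the grid can be refined with [X] fixed. *)
Definition riemann_error w : \bar R :=
  (\sum_x \sum_(a : bindex d b m * {ffun 'I_d -> 'I_K}) \int[l]_(t in cell a) (cell_error x a t w)%:E)%E.

Let cell_hcube (a : I) : @cell R d b m K a `<=` hcube d.
Proof. by move=> t /(cell_bcube b0 K0)/(bcube_hcube b0). Qed.

Let hpt a : hcube d (pt a).
Proof. by apply: (bcube_hcube b0 (h := a.1)); exact: bcube_gpt. Qed.

Let mcell (a : I) := @measurable_cell R d b m K a.

Let volE (a : I) : l (@cell R d b m K a) = (((b ^ m * K)%:R ^+ d)^-1)%:E.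
Proof. exact: lebesgue_cell. Qed.

Let mce x a : measurable_fun (cell a `*` [set: Omega]) (fun z => cell_error x a z.1 z.2).
Proof.
apply: (measurableT_comp (@normr_measurable R setT)).
have mX : measurable (@cell R d b m K a `*` [set: Omega]) by exact: measurableX.
apply: measurable_funB; apply: measurable_funM.
- apply: measurable_funS mD => //; first exact: measurableX (@measurable_hcube R d) measurableT.
  by move=> [t w] [/= /cell_hcube].
- by apply: measurable_funTS; exact: (measurableT_comp (mg x) measurable_fst).
- by apply: measurable_funTS; exact: (measurableT_comp (mDt (hpt a)) measurable_snd).
- exact: measurable_cst.
Qed.

Lemma measurable_riemann_error : measurable_fun setT riemann_error.
Proof.
apply: emeasurable_sum => x; apply: emeasurable_sum => a.
apply: (measurable_integral_section _ (mcell a) (@mce x a)) => t w _.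
exact: normr_ge0.
Qed.

Let delta : R := B * (d%:R / K%:R) `^ alpha0 + B * (L * (d%:R / K%:R)).

(** The product changes across a cell through [D], controlled by [EI], and through [g], controlled
    by its Lipschitz constant. Both terms of [delta] vanish as [K] grows. *)
Let cell_expectation x a t : cell a t -> (Ex Pr (cell_error x a t) <= delta%:E)%E.
Proof.
move=> at_; have ht := cell_hcube at_.
have mDD : measurable_fun setT (fun w => `|D t w - D (pt a) w|).
  apply: (measurableT_comp (@normr_measurable R setT)).
  by apply: measurable_funB; exact: mDt.
have mDa : measurable_fun setT (fun w => `|D (pt a) w|).
  by apply: (measurableT_comp (@normr_measurable R setT)); exact: mDt.
pose e := `|g x t - g x (pt a)|.
apply: (@le_trans _ _ (Ex Pr (fun w => (`|D t w - D (pt a) w| + e * `|D (pt a) w|)%R))).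
  apply: Ex_le.
  - apply: (measurableT_comp (@normr_measurable R setT)).
    by apply: measurable_funB; apply: measurable_funM => //; exact: mDt.
  - by move=> w; exact: normr_ge0.
  - by apply: measurable_funD => //; apply: measurable_funM.
  - move=> w; rewrite /cell_error.
    rewrite (_ : _ - _ = (D t w - D (pt a) w) * g x t + (g x t - g x (pt a)) * D (pt a) w); last by ring.
    apply: (le_trans (ler_normD _ _)); rewrite !normrM; apply: lerD => //.
    by rewrite ler_piMr.
have meD : measurable_fun setT (fun w => e * `|D (pt a) w|) by apply: measurable_funM.
rewrite (ExD Pr mDD (fun w => normr_ge0 _) meD (fun w => mulr_ge0 (normr_ge0 _) (normr_ge0 _))).
rewrite (ExZ Pr mDa (fun w => normr_ge0 _) (normr_ge0 _)).
have KR0 : 0 < K%:R :> R by rewrite ltr0n.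
have bm0 : 1 <= (b ^ m)%:R :> R by rewrite ler1n expn_gt0 b0.
have bmp : 0 < (b ^ m)%:R :> R by rewrite (lt_le_trans ltr01).
have sumd : \sum_i `|tnth t i - tnth (pt a) i| <= d%:R / (b ^ m * K)%:R.
  rewrite mulr_natl -[X in _ *+ X](card_ord d) -sumr_const; apply: ler_sum => i _.
  exact: cell_coord.
have distd := euclid_dist_le t (pt a).
rewrite /delta EFinD; apply: leeD.
  apply: (le_trans (EI (cell_bcube b0 K0 at_) (bcube_gpt b0 K0 a.1 a.2))).
  rewrite lee_fin ler_wpM2l// le_powR//.
    by rewrite mulr_ge0// euclid_dist_ge0.
  rewrite -ler_pdivlMl//; apply: (le_trans distd); apply: (le_trans sumd).
  by rewrite natrM invfM mulrCA.
have eL : e <= L * (d%:R / K%:R).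
  apply: (le_trans (gL _ _ _)); rewrite ler_wpM2l//; apply: (le_trans sumd).
  rewrite ler_wpM2l// lef_pV2 ?posrE ?ltr0n ?muln_gt0 ?expn_gt0 ?b0//.
  by rewrite ler_nat leq_pmull// expn_gt0 b0.
apply: (@le_trans _ _ (e%:E * B%:E)%E).
  by rewrite lee_wpmul2l ?lee_fin// ED.
by rewrite -EFinM lee_fin mulrC ler_wpM2l.
Qed.

Lemma riemann_error_expectation :
  (\int[Pr]_w riemann_error w <= (#|X|%:R * delta)%:E)%E.
Proof.
have N0 : 0 < (b ^ m * K)%:R :> R by rewrite ltr0n muln_gt0 expn_gt0 b0.
have ce0 x (a : I) t w : cell a t -> 0 <= cell_error x a t w by move=> _; exact: normr_ge0.
have i0 x a w : (0 <= \int[l]_(t in cell a) (cell_error x a t w)%:E)%E.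
  by apply: integral_ge0 => t _; rewrite lee_fin normr_ge0.
have mi x a : measurable_fun setT (fun w => \int[l]_(t in cell a) (cell_error x a t w)%:E)%E.
  exact: (measurable_integral_section _ (mcell a) (@mce x a) (fun t w => @ce0 x a t w)).
rewrite /riemann_error ge0_integral_sum//; last 2 first.
- by move=> x; apply: emeasurable_sum => a.
- by move=> x w _; apply: sume_ge0 => a _.
have -> : #|X|%:R * delta = \sum_(x : X) \sum_(a : I) ((b ^ m * K)%:R ^+ d)^-1 * delta.
  have cardI : #|{: bindex d b m * {ffun 'I_d -> 'I_K}}| = ((b ^ m * K) ^ d)%N.
    by rewrite card_prod !card_ffun !card_ord expnMn.
  rewrite !sumr_const cardI -[_ *+ (_ ^ _)%N]mulr_natl natrX mulrA divff ?mul1r.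
    by rewrite mulr_natl.
  by rewrite expf_neq0// gt_eqF.
rewrite -sumEFin; apply: lee_sum => x _.
rewrite ge0_integral_sum// -sumEFin; apply: lee_sum => a _.
rewrite (tonelli_on l Pr (mcell a) (@mce x a) (fun t w => @ce0 x a t w)).
apply: (@le_trans _ _ (\int[l]_(t in cell a) delta%:E)%E).
  apply: ge0_le_integral => //.
  - by move=> t _; apply: expectation_ge0 => w; exact: normr_ge0.
  - exact: (measurable_expectation_section Pr (mcell a) (@mce x a) (fun t w => @ce0 x a t w)).
  - exact: cell_expectation.
rewrite integral_cst; last exact: mcell.
by rewrite [X in (_ * X)%E](volE a) -EFinM mulrC.
Qed.

Lemma riemann_error_path x w : l.-integrable (hcube d) (fun t => (D t w)%:E) ->
  ((`|\int[l]_(t in hcube d) (D t w * g x t) -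
     ((b ^ m * K)%:R ^+ d)^-1 * \sum_(h : bindex d b m) \sum_(k : {ffun 'I_d -> 'I_K})
       D (gpt h k) w * g x (gpt h k)|)%R%:E <= riemann_error w)%E.
Proof.
move=> Dint.
pose f t := D t w * g x t; pose c (a : I) : R := D (pt a) w * g x (pt a).
have mh := @measurable_hcube R d.
have mDw : measurable_fun (hcube d) (D ^~ w) by exact: (measurable_section mh mD).
have mf : measurable_fun (hcube d) f.
  by apply: measurable_funM => //; exact: measurable_funTS.
have fint : l.-integrable (hcube d) (EFin \o f).
  apply: le_integrable Dint => //; first exact/measurable_EFinP.
  by move=> t _ /=; rewrite lee_fin normrM ler_piMr.
have fia a : l.-integrable (@cell R d b m K a) (EFin \o f).
  exact: (integrableS mh (@mcell a) (@cell_hcube a) fint).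
have cia a : l.-integrable (@cell R d b m K a) (EFin \o (fun=> c a)).
  apply/integrableP; split; first exact: measurable_cst.
  rewrite /= integral_cst; last exact: mcell.
  by rewrite [X in (_ * X)%E](volE a) -EFinM ltry.
have e1 : \int[l]_(t in hcube d) f t = \sum_(a : I) \int[l]_(t in cell a) f t.
  rewrite /Rintegral sum_fine; last first.
    by move=> a _; exact: (integrable_fin_num (@mcell a) (fia a)).
  congr fine; rewrite -(@bigcup_cell R d b m K b0 K0).
  have Eb : \bigcup_(a in [set: bindex d b m * {ffun 'I_d -> 'I_K}]) @cell R d b m K a =
     \big[setU/set0]_(a <- index_enum (bindex d b m * {ffun 'I_d -> 'I_K})%type) cell a.
    rewrite -bigcup_seq; apply/seteqP; split => t [a _ ta]; exists a => //=.
    by rewrite mem_index_enum.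
  rewrite Eb; apply: integral_bigsetU_EFin => //.
  - exact: index_enum_uniq.
  - exact: (sub_trivIset (@subsetT _ _) (@trivIset_cell R d b m K b0 K0)).
  - by rewrite -Eb bigcup_cell//; exact/measurable_EFinP.
have e2 : ((b ^ m * K)%:R ^+ d)^-1 * \sum_(h : bindex d b m) \sum_(k : {ffun 'I_d -> 'I_K})
       D (gpt h k) w * g x (gpt h k) = \sum_(a : I) \int[l]_(t in cell a) c a.
  rewrite pair_big/= mulr_sumr; apply: eq_bigr => a _.
  rewrite Rintegral_cst; last exact: mcell.
  by rewrite [X in _ * fine X](volE a) mulrC.
rewrite e1 e2 -sumrB.
apply: (@le_trans _ _ ((\sum_(a : I) \int[l]_(t in cell a) cell_error x a t w)%R)%:E).
  rewrite lee_fin; apply: (le_trans (ler_norm_sum _ _ _)); apply: ler_sum => a _.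
  rewrite -RintegralB//.
  apply: le_normr_Rintegral; first exact: mcell.
  exact: (integrableB (@mcell a) (fia a) (cia a)).
rewrite /riemann_error (bigD1 x)//= -[leLHS]adde0; apply: leeD; last first.
  apply: sume_ge0 => y _; apply: sume_ge0 => a _; apply: integral_ge0 => t _.
  by rewrite lee_fin normr_ge0.
rewrite -sumEFin; apply: lee_sum => a _; rewrite fineK//.
apply: integrable_fin_num; first exact: mcell.
exact: (integrable_abse (integrableB (@mcell a) (fia a) (cia a))).
Qed.

End riemann_error.

Section swave_regularity.
Context {R : realType} (d b n : nat).
Hypothesis b0 : (0 < b)%N.
Implicit Types (x : fgrid d b n * bool * bool) (t : d.-tuple R).

Lemma swave_le1 x t : `|swave x t| <= 1.
Proof.
rewrite /swave normrM; have -> : `|(if x.2 then 1 else -1) : R| = 1.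
  by case: ifP => _; rewrite ?normrN normr1.
by rewrite mul1r; case: ifP => _; rewrite ?normr0// wave_le1.
Qed.

Lemma dotp_lipschitz (y : d.-tuple R) (C : R) t t' : (forall i, `|tnth y i| <= C) ->
  `|dotp y t - dotp y t'| <= C * \sum_i `|tnth t i - tnth t' i|.
Proof.
move=> yC; rewrite /dotp -sumrB mulr_sumr; apply: (le_trans (ler_norm_sum _ _ _)).
by apply: ler_sum => i _; rewrite -mulrBr normrM ler_wpM2r.
Qed.

Lemma swave_lipschitz x t t' :
  `|swave x t - swave x t'| <= 2 * pi * (b ^ n.+1)%:R * \sum_i `|tnth t i - tnth t' i|.
Proof.
have S0 : 0 <= \sum_i `|tnth t i - tnth t' i| by exact: sumr_ge0.
have pi0 := pi_ge0 R.
rewrite /swave -mulrBr normrM; have -> : `|(if x.2 then 1 else -1) : R| = 1.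
  by case: ifP => _; rewrite ?normrN normr1.
rewrite mul1r; case: ifP => _; last first.
  by rewrite subrr normr0 mulr_ge0// mulr_ge0// mulr_ge0.
apply: (le_trans (wave_lipschitz _ _ _)).
rewrite opprK addrC -mulrBr normrM ger0_norm ?mulr_ge0// -mulrA ler_wpM2l ?mulr_ge0//.
by rewrite distrC; apply: dotp_lipschitz => i; exact: freq_le.
Qed.

Lemma measurable_dotp (y : d.-tuple R) : measurable_fun setT (fun t => dotp y t).
Proof.
apply: measurable_sum => i; apply: measurable_funM => //.
exact: measurable_tnth.
Qed.

Lemma measurable_wave kd : measurable_fun setT (@wave R kd).
Proof.
apply: continuous_measurable_fun => y; rewrite /wave; case: kd.
  exact: continuous_cos.
exact: continuous_sin.
Qed.

Lemma measurable_swave x : measurable_fun setT (@swave R d b n x).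
Proof.
rewrite /swave; apply: measurable_funM => //; case: (active _) => //.
apply: (measurableT_comp (measurable_wave _)).
apply: (measurable_funN); apply: measurable_funM => //; exact: measurable_dotp.
Qed.

End swave_regularity.

(** * Summation over levels and scales *)

Lemma leq_exp2rW (x y e : nat) : (x <= y)%N -> (x ^ e <= y ^ e)%N.
Proof. by case: e => // e xy; rewrite leq_exp2r. Qed.

Section growth.
Context {R : realType}.

Lemma powR_gt1 (a x : R) : 1 < a -> 0 < x -> 1 < a `^ x.
Proof.
move=> a1 x0; rewrite /powR gt_eqF ?(lt_trans ltr01)//.
by rewrite -[ltLHS]expR0 ltr_expR mulr_gt0// ln_gt0.
Qed.

Lemma geometric_nneseries (K r : R) : 0 <= K -> 0 < r < 1 ->
  (\sum_(0 <= n <oo) (K * r ^+ n)%:E <= (K / (1 - r))%:E)%E.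
Proof.
move=> K0 /andP[r0 r1]; apply: lime_le.
  by apply: is_cvg_nneseries => n _ _; rewrite lee_fin mulr_ge0// exprn_ge0// ltW.
apply: nearW => n; rewrite sumEFin lee_fin.
by apply: geometric_le_lim => //; rewrite ger0_norm// ltW.
Qed.

(** The union over [m] is taken first, at a geometric cost, and the Borel-Cantelli lemma is applied
    in [n]; thus [n0] serves all [m] together. *)
Lemma double_borel_cantelli {dO : measure_display} {Omega : measurableType dO}
    (Pr : probability Omega R) (Bad : nat -> nat -> set Omega) (K r1 r2 : R) :
  0 <= K -> 0 < r1 < 1 -> 0 < r2 < 1 -> (forall m n, measurable (Bad m n)) ->
  (forall m n, (Pr (Bad m n) <= (K * r1 ^+ n * r2 ^+ m)%:E)%E) ->
  {ae Pr, forall w, exists n0, forall n m, (n0 <= n)%N -> ~ Bad m n w}.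
Proof.
move=> K0 r1P r2P mB PB; pose F n := \bigcup_m Bad m n.
have r10 : 0 < r1 by case/andP: r1P.
have mF n : measurable (F n) by exact: bigcup_measurable.
have PF n : (Pr (F n) <= (K / (1 - r2) * r1 ^+ n)%:E)%E.
  have h1 : (Pr (F n) <= \sum_(0 <= m <oo) Pr (Bad m n))%E.
    exact: measure_sigma_subadditive.
  apply: (le_trans h1); apply: (@le_trans _ _ (\sum_(0 <= m <oo) (K * r1 ^+ n * r2 ^+ m)%:E)%E).
    by apply: lee_nneseries.
  rewrite mulrAC; apply: geometric_nneseries => //.
  by rewrite mulr_ge0// exprn_ge0// ltW.
have Foo : (\sum_(0 <= n <oo) Pr (F n) < +oo)%E.
  apply: (@le_lt_trans _ _ (\sum_(0 <= n <oo) (K / (1 - r2) * r1 ^+ n)%:E)%E).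
    exact: lee_nneseries.
  apply: le_lt_trans (ltry (K / (1 - r2) / (1 - r1))); apply: geometric_nneseries => //.
  by case/andP: r2P => _ r21; rewrite divr_ge0// subr_ge0 ltW.
exists (lim_sup_set F); split.
- apply: bigcapT_measurable => n; exact: bigcup_measurable.
- exact: lim_sup_set_cvg0.
- move=> w /= nw n0 _; apply: contrapT => h; apply: nw; exists n0 => n m n0n Bw.
  by apply: h; exists n => //; exists m.
Qed.

Lemma natr_powR_le (c kappa p : R) : 1 < c -> 0 < kappa -> 1 <= p ->
  exists2 K, 0 <= K & forall n : nat, (n.+1)%:R `^ p <= K * c `^ (kappa * n%:R).
Proof.
move=> c1 k0 p1; have p0 : 0 < p by exact: lt_le_trans p1.
have lnc : 0 < ln c by rewrite ln_gt0.
pose a := kappa / p * ln c; have a0 : 0 < a by rewrite mulr_gt0// divr_gt0.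
exists ((1 + a^-1) `^ p) => [|n]; first exact: powR_ge0.
have K10 : 0 <= 1 + a^-1 by rewrite addr_ge0// invr_ge0 ltW.
have -> : c `^ (kappa * n%:R) = (c `^ (kappa / p * n%:R)) `^ p.
  by rewrite -powRrM; congr (_ `^ _); field; rewrite gt_eqF.
rewrite -powRM ?powR_ge0//; apply: le_powR => //; first exact: ltW.
apply: (@le_trans _ _ ((1 + a^-1) * (1 + n%:R * a))).
  have -> : (1 + a^-1) * (1 + n%:R * a) = 1 + n%:R * a + a^-1 + n%:R.
    by field; rewrite gt_eqF.
  rewrite -natr1; have := mulr_ge0 (ler0n R n) (ltW a0); have : 0 < a^-1 by rewrite invr_gt0.
  lra.
rewrite ler_wpM2l// /powR gt_eqF ?(lt_trans ltr01)//.
have -> : kappa / p * n%:R * ln c = n%:R * a by rewrite /a; ring.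
exact: expR_ge1Dx.
Qed.

Lemma osc_entropy_le (d b : nat) : (2 <= b)%N ->
  exists2 E : R, 0 <= E & forall n, osc_entropy d b n <= E * (n.+1)%:R.
Proof.
move=> b2; have lnb : 0 <= ln b%:R :> R by rewrite ln_ge0// ler1n ltnW.
exists (1 + (3 * d + 2)%:R * ln b%:R) => [|n]; first by rewrite addr_ge0// mulr_ge0.
have : (#|{: fgrid d b n * bool * bool}| <= b ^ ((2 * n + 3) * d + 2))%N.
  rewrite !card_prod card_bool card_ffun !card_ord -mulnA [in leqRHS]expnD [in leqRHS]expnM; apply: leq_mul; last exact: (leq_mul b2 b2).
  apply: (@leq_trans ((b ^ (2 * n + 1) * 2 ^ 2) ^ d)); last first.
    have -> : (2 * n + 3 = 2 * n + 1 + 2)%N by lia.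
    by rewrite [in leqRHS]expnD leq_exp2rW// leq_mul// leq_exp2rW.
  rewrite leq_exp2rW// -addn1; have : (0 < b ^ (2 * n + 1))%N by rewrite expn_gt0 ltnW.
  lia.
rewrite -(ler_nat R) natrX => cardb.
have card0 : 0 < #|{: fgrid d b n * bool * bool}|%:R :> R.
  by rewrite ltr0n; apply/card_gt0P; exists ([ffun=> ord0], true, true).
have b0 : 0 < b%:R :> R by rewrite ltr0n ltnW.
have : ln #|{: fgrid d b n * bool * bool}|%:R <= ((2 * n + 3) * d + 2)%:R * ln b%:R :> R.
  by rewrite mulr_natl -lnXn// ler_ln ?posrE// exprn_gt0.
move=> /(lerD (lexx 1)) /le_trans; apply.
rewrite mulrDl mul1r; apply: lerD; first by rewrite ler1n.
rewrite mulrAC ler_wpM2r// -natrM ler_nat.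
nia.
Qed.

End growth.

Section level_sums.
Context {dO : measure_display} {Omega : measurableType dO} {R : realType}.
Variables (Pr : probability Omega R) (d b : nat).
Variable P : nat -> d.-tuple R -> Omega -> R.
Hypothesis b2 : (2 <= b)%N.
Hypothesis Pmeas : forall m,
  measurable_fun (ccube d `*` [set: Omega]) (fun z => P m z.1 z.2).
Hypothesis Pindep : independent_processes Pr [set: nat] (fun=> ccube d) P.
Hypothesis Pge0 : forall m t w, ccube d t -> 0 <= P m t w.
Variables (p alpha0 s C3 : R) (M : nat -> R).
Hypotheses (p1 : 1 <= p) (C30 : 0 <= C3) (M1 : forall j, 1 <= M j).
Hypotheses (s01 : 0 <= s <= 1) (salpha : s <= alpha0).
Hypothesis PM : forall j t, hcube d t -> (Ex Pr (fun w => (P j t w `^ p)%R) <= (M j)%:E)%E.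
Hypothesis PC3 : forall j (h : bindex d b j) t s, bcube h t -> bcube h s ->
  (Ex Pr (fun w => (`|P j t w - P j s w| `^ p)%R) <=
   (C3 * ((b ^ j)%:R * euclid_dist t s) `^ (alpha0 * p))%:E)%E.

Let b0 : (0 < b)%N. Proof. exact: leq_trans b2. Qed.
Let p0 : 0 <= p. Proof. exact: le_trans p1. Qed.
Let alpha00 : 0 <= alpha0. Proof. by have /andP[s0 _] := s01; exact: le_trans salpha. Qed.

Hypothesis p2 : p <= 2.
Hypothesis alphap : 0 < alpha0.
Hypothesis Pmean1 : forall m t, ccube d t -> (Ex Pr (P m t) = 1)%E.
Variable C1 : R.
Hypothesis C10 : 0 <= C1.
(** First moments are needed besides those of order [p], because the Riemann error is estimated in
    L^1. *)
Hypothesis PC1 : forall j (h : bindex d b j) t s, bcube h t -> bcube h s ->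
  (Ex Pr (fun w => (`|P j t w - P j s w| `^ 1)%R) <=
   (C1 * ((b ^ j)%:R * euclid_dist t s) `^ (alpha0 * 1))%:E)%E.

Lemma measurable_chaosQ_joint m :
  measurable_fun (ccube d `*` [set: Omega]) (fun z => chaosQ P m z.1 z.2).
Proof. by apply: measurable_prod => j _; exact: Pmeas. Qed.

Lemma measurable_chaosD_joint m :
  measurable_fun (hcube d `*` [set: Omega]) (fun z => chaosD P m z.1 z.2).
Proof.
have mC : measurable (@ccube R d `*` [set: Omega]).
  exact: measurableX (@measurable_ccube R d) measurableT.
have sub : @hcube R d `*` [set: Omega] `<=` @ccube R d `*` [set: Omega].
  by move=> [t w] [/= /hcube_ccube].
apply: measurable_funB.
  exact: (measurable_funS mC sub (measurable_chaosQ_joint m.+1)).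
case: m => [|m]; first exact: measurable_cst.
exact: (measurable_funS mC sub (measurable_chaosQ_joint m.+1)).
Qed.

(** The bound is asked for every [K] from [kappa] on, since the grid in use has the multiple
    [b^(n+3) * kappa] as its [K]. *)
Lemma vanishing_scale (B L eta : R) : 0 <= B -> 0 <= L -> 0 < eta ->
  exists2 kappa, (0 < kappa)%N & forall K, (kappa <= K)%N ->
    B * (d%:R / K%:R) `^ alpha0 + B * (L * (d%:R / K%:R)) <= eta.
Proof.
move=> B0 L0 eta0.
have half A : 0 <= A -> A * (eta / (2 * (A + 1))) <= eta / 2.
  move=> A0; have A1 : A / (A + 1) <= 1 by rewrite ler_pdivrMr ?mul1r; lra.
  have -> : A * (eta / (2 * (A + 1))) = eta / 2 * (A / (A + 1)) by field; lra.
  by rewrite -[leRHS]mulr1 ler_wpM2l// divr_ge0// ltW.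
pose e1 := (eta / (2 * (B + 1))) `^ alpha0^-1.
pose e2 := eta / (2 * (B * L + 1)).
have e10 : 0 < e1 by rewrite powR_gt0// divr_gt0//; lra.
have BL0 : 0 <= B * L by rewrite mulr_ge0.
have e20 : 0 < e2 by rewrite divr_gt0//; lra.
pose e := Num.min e1 e2.
have e0 : 0 < e by rewrite lt_min e10.
exists (Num.truncn (d%:R / e)).+1 => // K hK.
have KR0 : 0 < K%:R :> R by rewrite ltr0n (leq_trans _ hK).
have dK : d%:R / K%:R <= e.
  rewrite ler_pdivrMr// mulrC -ler_pdivrMr// (le_trans (ltW (truncnS_gt _)))//.
  by rewrite ler_nat.
have dK0 : 0 <= d%:R / K%:R :> R by rewrite divr_ge0// ltW.
have h1 : (d%:R / K%:R) `^ alpha0 <= eta / (2 * (B + 1)).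
  apply: (@le_trans _ _ (e1 `^ alpha0)).
    by apply: le_powR => //; apply: (le_trans dK); rewrite ge_min lexx.
  rewrite /e1 -powRrM mulVf ?gt_eqF// powRr1// ltW// divr_gt0//; lra.
have h2 : d%:R / K%:R <= e2 by apply: (le_trans dK); rewrite ge_min lexx orbT.
have : B * (d%:R / K%:R) `^ alpha0 <= eta / 2.
  apply: (@le_trans _ _ (B * (eta / (2 * (B + 1))))); first by rewrite ler_wpM2l.
  exact: half.
have : B * (L * (d%:R / K%:R)) <= eta / 2.
  rewrite mulrA; apply: (@le_trans _ _ ((B * L) * e2)); first by rewrite ler_wpM2l.
  exact: half.
lra.
Qed.

Section level_tail.
Variables (m n N : nat) (col : bindex d b m -> 'I_N).
Hypothesis colP : injective col \/ ((0 < m)%N /\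
  forall c, independent_processes Pr [set h | col h = c] (fun h => bcube h) (fun=> P m)).

(** The tail of the Riemann sums is bounded uniformly in [kappa], so [kappa] may depend on [m], [n],
    [lambda] and [eps]. The bad event depends on it, but the conclusion about the integrals does
    not. *)
Lemma level_tail (lambda eps : R) : 0 < lambda -> 0 < eps ->
  exists Bad : set Omega, [/\ measurable Bad,
    (Pr Bad <= (tail_bound d b p s C3 M m n N lambda + eps)%:E)%E &
    forall w, ~ Bad w ->
      (@lebesgue_tuple R d).-integrable (hcube d) (fun t => (chaosD P m t w)%:E) ->
      forall x : fgrid d b n * bool * bool,
      `|\int[@lebesgue_tuple R d]_(t in hcube d) (chaosD P m t w * swave x t)| <= 2 * lambda].
Proof.
move=> lambda0 eps0.
(* At exponent 1 all moments of the process equal 1, so the moment bounds of [chaosD] apply with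
   constant [M]. *)
have le11 : (1 : R) <= 1 by [].
have M1' (j : nat) : (1 : R) <= 1 by [].
have PM1 j t : hcube d t -> (Ex Pr (fun w => (P j t w `^ 1)%R) <= 1%:E)%E.
  move=> ht; have ct := hcube_ccube ht.
  by under eq_fun do rewrite powRr1 ?Pge0//; rewrite Pmean1.
set B := chaosB 1 C1 (fun=> 1) m.
have B0 : 0 <= B by exact: chaosB_ge0.
have ED t : hcube d t -> (Ex Pr (fun w => `|chaosD P m t w|%R) <= B%:E)%E.
  move=> ht; have := chaosD_moment Pmeas Pindep Pge0 le11 C10 M1' PM1 m ht.
  by under eq_fun do rewrite powRr1//.
have EI (h : bindex d b m) t t' : bcube h t -> bcube h t' ->
  (Ex Pr (fun w => `|chaosD P m t w - chaosD P m t' w|%R) <=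
    (B * ((b ^ m)%:R * euclid_dist t t') `^ alpha0)%:E)%E.
  move=> bt bt'.
  have := chaosD_increment b2 Pmeas Pindep Pge0 le11 C10 M1' s01 salpha PM1 PC1 bt bt'.
  by under eq_fun do rewrite powRr1//; rewrite mulr1.
pose XI : finType := (fgrid d b n * bool * bool)%type.
pose L : R := 2 * pi * (b ^ n.+1)%:R.
have L0 : 0 <= L by rewrite mulr_ge0// mulr_ge0// pi_ge0.
have X0 : 0 < #|XI|%:R :> R.
  by rewrite ltr0n; apply/card_gt0P; exists ([ffun=> ord0], true, true).
(* The target [lambda * eps / #|X|] is what Markov's inequality at level [lambda] needs in order to
   leave probability [eps] after the sum over [X]. *)
have [kappa kappa0 kappaP] := vanishing_scale B0 L0 (divr_gt0 (mulr_gt0 lambda0 eps0) X0).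
pose K := (b ^ (n + 3) * kappa)%N.
have K0 : (0 < K)%N by rewrite muln_gt0 expn_gt0 b0.
have kK : (kappa <= K)%N by rewrite leq_pmull// expn_gt0 b0.
have mDt t : hcube d t -> measurable_fun setT (chaosD P m t).
  by move=> ht; apply: measurable_chaosD => //; exact: hcube_ccube.
pose err := riemann_error b m K (fun x : XI => @swave R d b n x) (chaosD P m).
have merr : measurable_fun setT err.
  apply: (@measurable_riemann_error _ Omega R d b m K b0 K0 XI (fun x => @swave R d b n x)) => //.
    by move=> x; exact: measurable_swave.
  exact: measurable_chaosD_joint.
have err0 w : (0 <= err w)%E.
  apply: sume_ge0 => x _; apply: sume_ge0 => a _; apply: integral_ge0 => t _.
  by rewrite lee_fin normr_ge0.
have Eerr := riemann_error_expectation b0 K0 B0 L0 alpha00 (@measurable_swave R d b n)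
  (@swave_le1 R d b n) (swave_lipschitz b0) (measurable_chaosD_joint m) mDt ED EI.
pose Bad1 := [set w | exists x : XI, lambda <= riemann_sum P m K x w].
pose Bad2 := [set w | (lambda%:E <= err w)%E].
have mBad1 : measurable Bad1.
  apply: measurable_exists_ge => x; rewrite /riemann_sum; apply: measurable_funM => //.
  apply: measurable_sum => h; apply: measurable_sum => k; apply: measurable_funM => //.
  have : bcube h (@gpt R d b m K h k) by exact: bcube_gpt.
  by move=> /(bcube_hcube b0); exact: mDt.
have mBad2 : measurable Bad2.
  by rewrite -[Bad2]setTI; exact: emeasurable_fun_c_infty.
have P1 : (Pr Bad1 <= (tail_bound d b p s C3 M m n N lambda)%:E)%E.
  exact: (riemann_tail b2 Pmeas Pindep Pge0 p1 C30 M1 s01 salpha PM PC3 p2 Pmean1 n kappa0 lambda0 colP).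
have P2 : (Pr Bad2 <= eps%:E)%E.
  have h1 : (lambda%:E * Pr Bad2 <= \int[Pr]_w err w)%E.
    have := le_integral_comp_abse Pr measurableT (@measurable_id _ (\bar R) setT)
      (fun r r0 => r0) (fun x y _ _ h => h) merr lambda0.
    rewrite /= setTI; under eq_integral do rewrite gee0_abs//.
    by under eq_set do rewrite gee0_abs//.
  have h2 : (lambda%:E * Pr Bad2 <= (lambda * eps)%:E)%E.
    apply: (le_trans h1); apply: (le_trans Eerr); rewrite lee_fin.
    rewrite mulrC -ler_pdivlMr//; exact: kappaP.
  by move: h2; rewrite EFinM lee_pmul2l.
exists (Bad1 `|` Bad2); split; first exact: measurableU.
  apply: (le_trans (measureU2 Pr mBad1 mBad2)); rewrite EFinD; exact: leeD.
move=> w /not_orP[nB1 nB2] Dint x.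
have errl : (err w < lambda%:E)%E by rewrite ltNge; apply/negP.
have := riemann_error_path m b0 K0 (@measurable_swave R d b n)
  (@swave_le1 R d b n) (measurable_chaosD_joint m) x Dint.
move=> /le_lt_trans => /(_ _ errl); rewrite lte_fin => h1.
have R1 (y : XI) : riemann_sum P m K y w < lambda.
  by rewrite ltNge; apply/negP => hy; apply: nB1; exists y.
have R2 : `|riemann_sum P m K x w| < lambda.
  rewrite ltr_norml R1 andbT ltrNl; case: x {h1} => [[z kd] sg].
  have -> : - riemann_sum P m K (z, kd, sg) w = riemann_sum P m K (z, kd, ~~ sg) w.
    rewrite /riemann_sum -mulrN -sumrN; congr (_ * _); apply: eq_bigr => h _.
    by rewrite -sumrN; apply: eq_bigr => k _; rewrite swave_flip mulrN.
  exact: R1.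
rewrite -[X in `|X|](subrK (riemann_sum P m K x w)).
by apply: (le_trans (ler_normD _ _)); rewrite mulrDl mul1r; apply: lerD; exact: ltW.
Qed.

End level_tail.

Variables (N : nat -> nat) (col : forall m, bindex d b m -> 'I_(N m)).
Hypothesis colP : forall m, injective (@col m) \/ ((0 < m)%N /\
  forall c, independent_processes Pr [set h | @col m h = c] (fun h => bcube h) (fun=> P m)).
(** [s0] is the decay to be proved and [tau] the exponent allowed by the growth of the moments. The
    slack [s - s0] pays for the entropy of the mesh, and [tau - s] for all that grows with [m]. *)
Variables (s0 tau CN CA : R).
Hypotheses (s0s : s0 < s) (stau : s < tau) (CN0 : 0 <= CN) (CA0 : 0 <= CA).

(** One quarter pays for the number of classes, one for the decay in [m] of the thresholds, one for
    the factor [(m.+1) ^ p] in [chaosB]; the last remains as the decay of the probabilities in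
    [m]. *)
Definition level_gap : R := (tau - s) / 4.
Definition level_threshold m n : R := b%:R `^ (- (s0 * n%:R + level_gap * m%:R)).

Hypothesis NE : forall m, (N m)%:R <= CN * b%:R `^ (level_gap * m%:R).
Hypothesis AE : forall m,
  chaosA M m.+1 <= CA * b%:R `^ ((d%:R * (p - 1) - p * tau) * m%:R).

Let beta : R := b%:R.
Let beta1 : 1 < beta. Proof. by rewrite ltr1n. Qed.
Let beta_gt0 : 0 < beta. Proof. exact: lt_trans beta1. Qed.
Let qD x y : beta `^ (x + y) = beta `^ x * beta `^ y.
Proof. by rewrite powRD ?(gt_eqF beta_gt0) ?implybT. Qed.
Let qX n : (b ^ n)%:R = beta `^ n%:R.
Proof. by rewrite natrX powR_mulrn; last exact: ltW. Qed.

Lemma tail_bound_le : exists2 K, 0 <= K & forall m n,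
  tail_bound d b p s C3 M m n (N m) (level_threshold m n) <=
  K * (beta `^ (- (p * (s - s0) / 2))) ^+ n * (beta `^ (- (p * (tau - s) / 4))) ^+ m.
Proof.
have pp : 0 < p by exact: lt_le_trans p1.
have k1 : 0 < p * (s - s0) / 2 by rewrite divr_gt0// mulr_gt0// subr_gt0.
have k2 : 0 < p * (tau - s) / 4 by rewrite divr_gt0// mulr_gt0// subr_gt0.
have [K1 K10 K1P] := natr_powR_le beta1 k1 p1.
have [K2 K20 K2P] := natr_powR_le beta1 k2 p1.
have [E E0 EP] := @osc_entropy_le R d b b2.
have oc1 : 1 <= osc_const d b :> R by exact: osc_const_ge1.
have oc0 : 0 <= osc_const d b :> R by exact: le_trans oc1.
exists (4 * (E `^ p * K1) * CN `^ p * osc_const d b `^ p * (2 `^ p * K2 * (1 + C3) * CA)).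
  by rewrite !mulr_ge0 ?powR_ge0// addr_ge0.
move=> m n; rewrite /tail_bound /chaosB.
have ent0 : 0 <= osc_entropy d b n :> R.
  by rewrite /osc_entropy addr_ge0// ln_ge0// ler1n; apply/card_gt0P; exists ([ffun=> ord0], true, true).
have e1 : osc_entropy d b n `^ p <= E `^ p * (K1 * beta `^ (p * (s - s0) / 2 * n%:R)).
  apply: (@le_trans _ _ ((E * n.+1%:R) `^ p)); first by apply: le_powR => //; exact: ltW.
  by rewrite powRM// ler_wpM2l ?powR_ge0.
have e2 : ((N m)%:R / level_threshold m n) `^ p <=
    CN `^ p * beta `^ (p * (2 * level_gap * m%:R + s0 * n%:R)).
  have -> : CN `^ p * beta `^ (p * (2 * level_gap * m%:R + s0 * n%:R)) =
      (CN * beta `^ (level_gap * m%:R) * beta `^ (s0 * n%:R + level_gap * m%:R)) `^ p.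
    rewrite -[CN * _ * _]mulrA -qD powRM ?powR_ge0// -powRrM; congr (_ * _ `^ _); ring.
  have th0 : 0 < level_threshold m n by exact: powR_gt0.
  apply: le_powR; [exact: ltW|by rewrite divr_ge0// ltW|].
  by rewrite /level_threshold powRN invrK ler_wpM2r ?powR_ge0.
have e3 : (osc_const d b / (b ^ m)%:R ^+ d * scale_ratio b s m n) `^ p <=
    osc_const d b `^ p * beta `^ (p * (- (d%:R * m%:R) + s * (m%:R - n%:R))).
  have -> : osc_const d b `^ p * beta `^ (p * (- (d%:R * m%:R) + s * (m%:R - n%:R))) =
      (osc_const d b * beta `^ (- (m%:R * d%:R)) * beta `^ ((m%:R - n%:R) * s)) `^ p.
    rewrite -[osc_const d b * _ * _]mulrA -qD powRM ?powR_ge0// -powRrM; congr (_ * _ `^ _); ring.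
  apply: le_powR; first exact: ltW.
    by rewrite mulr_ge0 ?powR_ge0// divr_ge0// exprn_ge0.
  rewrite qX -powR_mulrn ?powR_ge0// -powRrM -powRN ler_wpM2l ?mulr_ge0 ?powR_ge0//.
  rewrite /scale_ratio !qX -powRN -qD -powRrM; apply: ler_powR; first exact: ltW.
  have /andP[s_ge0 _] := s01; rewrite ler_wpM2r// natrD; lra.
have e4 : (b ^ (m * d))%:R = beta `^ (m%:R * d%:R) by rewrite qX natrM.
have A0 : 0 <= chaosA M m.+1 by exact: le_trans (chaosA_ge1 M1 _).
apply: (@le_trans _ _ (4 * (E `^ p * (K1 * beta `^ (p * (s - s0) / 2 * n%:R))) *
  (CN `^ p * beta `^ (p * (2 * level_gap * m%:R + s0 * n%:R))) * beta `^ (m%:R * d%:R) *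
  (osc_const d b `^ p * beta `^ (p * (- (d%:R * m%:R) + s * (m%:R - n%:R))) *
  (2 `^ p * (K2 * beta `^ (p * (tau - s) / 4 * m%:R)) * (1 + C3) *
   (CA * beta `^ ((d%:R * (p - 1) - p * tau) * m%:R)))))).
  rewrite e4; have C31 : 0 <= 1 + C3 by rewrite addr_ge0.
  apply: ler_pM; rewrite ?mulr_ge0 ?powR_ge0//.
    rewrite ler_wpM2r ?powR_ge0//; apply: ler_pM; rewrite ?mulr_ge0 ?powR_ge0//.
    by rewrite ler_wpM2l.
  apply: ler_pM; rewrite ?mulr_ge0 ?powR_ge0//.
  apply: ler_pM; rewrite ?mulr_ge0 ?powR_ge0//.
  by rewrite ler_wpM2r// ler_wpM2l ?powR_ge0.
rewrite -!powR_mulrn ?powR_ge0// -!powRrM.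
set u1 := beta `^ (p * (s - s0) / 2 * n%:R); set u2 := beta `^ (p * (2 * _ * _ + _)).
set u3 := beta `^ (m%:R * d%:R); set u4 := beta `^ (p * (- _ + _)).
set u5 := beta `^ (p * (tau - s) / 4 * m%:R); set u6 := beta `^ ((_ - _) * _).
rewrite [leLHS](_ : _ = (4 * (E `^ p * K1) * CN `^ p * osc_const d b `^ p *
  (2 `^ p * K2 * (1 + C3) * CA)) * (u1 * u2 * u3 * u4 * u5 * u6)); last by ring.
rewrite -[leRHS]mulrA -qD /u1 /u2 /u3 /u4 /u5 /u6 -!qD le_eqVlt; apply/orP; left.
by apply/eqP; congr (_ * _ `^ _); rewrite /level_gap; field.
Qed.

Hypothesis integrable_chaosD : {ae Pr, forall w, forall m,
  (@lebesgue_tuple R d).-integrable (hcube d) (fun t => (chaosD P m t w)%:E)}.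

Lemma chaosD_fourier_small : {ae Pr, forall w, exists n0, forall n m, (n0 <= n)%N ->
  forall x : fgrid d b n * bool * bool,
  `|\int[@lebesgue_tuple R d]_(t in hcube d) (chaosD P m t w * swave x t)| <=
    2 * level_threshold m n}.
Proof.
have pp : 0 < p by exact: lt_le_trans p1.
have [K K0 KP] := tail_bound_le.
set r1 := beta `^ _ in KP; set r2 := beta `^ _ in KP.
have r1P : 0 < r1 < 1.
  rewrite /r1 powR_gt0//= powRN invf_lt1 ?powR_gt0//; apply: powR_gt1 => //.
  by rewrite divr_gt0// mulr_gt0// subr_gt0.
have r2P : 0 < r2 < 1.
  rewrite /r2 powR_gt0//= powRN invf_lt1 ?powR_gt0//; apply: powR_gt1 => //.
  by rewrite divr_gt0// mulr_gt0// subr_gt0.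
(* The Riemann error is allotted the same summable probability as the tail itself, so it only turns
   [K] into [K + 1]. *)
have eps0 m n : 0 < r1 ^+ n * r2 ^+ m.
  by case/andP: r1P => ? _; case/andP: r2P => ? _; rewrite mulr_gt0// exprn_gt0.
have th0 m n : 0 < level_threshold m n by exact: powR_gt0.
have /choice[Bad BadP] : forall mn : nat * nat, _ := fun mn =>
  level_tail mn.2 (colP mn.1) (th0 mn.1 mn.2) (eps0 mn.1 mn.2).
have mB m n : measurable (Bad (m, n)) by have [] := BadP (m, n).
have PB m n : (Pr (Bad (m, n)) <= ((K + 1) * r1 ^+ n * r2 ^+ m)%:E)%E.
  have [_ h _] := BadP (m, n); apply: (le_trans h); rewrite lee_fin /=.
  rewrite mulrDl mulrDl mul1r; exact: lerD (KP m n) (lexx _).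
have K1 : 0 <= K + 1 by rewrite addr_ge0.
have := double_borel_cantelli K1 r1P r2P mB PB.
apply: filterS2 integrable_chaosD => w iw [n0 n0P]; exists n0 => n m n0n x.
by have [_ _] := BadP (m, n); apply; [exact: n0P|exact: iw].
Qed.

End level_sums.

(** * Colourings of the cubes from Assumption 1 *)

Section colouring.
Context {dO : measure_display} {Omega : measurableType dO} {R : realType}.
Variables (Pr : probability Omega R) (d b : nat).
Variable P : nat -> d.-tuple R -> Omega -> R.
Hypothesis b2 : (2 <= b)%N.

Let b0 : (0 < b)%N. Proof. exact: leq_trans b2. Qed.

Lemma mutually_independent_reindex {I I' : choiceType} (f : I -> I') (g : I' -> I)
    (A : set I) (A' : set I') (F : I -> set (set Omega)) (F' : I' -> set (set Omega)) :
  (forall i, A i -> [/\ A' (f i), F i `<=` F' (f i) & g (f i) = i]) ->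
  mutually_independent Pr A' F' -> mutually_independent Pr A F.
Proof.
move=> fP ind J E JE; pose J' := [fset f i | i in J]%fset.
have gf i : i \in J -> g (f i) = i by move=> /JE[/fP[]].
have := ind J' (E \o g) _.
rewrite (_ : \bigcap_(i in [set` J']) (E \o g) i = \bigcap_(i in [set` J]) E i); last first.
  apply/seteqP; split => w Ew i /= iJ.
    by have := Ew (f i) (in_imfset _ f iJ); rewrite /= gf.
  by move: iJ => /imfsetP[j /= jJ ->]; rewrite gf//; exact: Ew.
rewrite big_imfset/=; last by move=> i j /gf gi /gf gj e; rewrite -gi -gj e.
have -> : \prod_(i <- J) fine (Pr (E (g (f i)))) = \prod_(i <- J) fine (Pr (E i)).
  by apply: eq_big_seq => i /gf ->.
apply => _ /imfsetP[i /= iJ ->]; have [Ai FE] := JE i iJ; have [A'f FF' gfi] := fP i Ai.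
by split => //=; rewrite gfi; exact: FF'.
Qed.

Let parent_lt k (h : bindex d b k.+1) i : (h i %/ b < b ^ k)%N.
Proof. by rewrite ltn_divLR// -expnSr. Qed.

Let child_lt k (h : bindex d b k.+1) i : (h i %% b < b)%N.
Proof. by rewrite ltn_mod. Qed.

Let lift_lt k (g : bindex d b k) (e : {ffun 'I_d -> 'I_b}) i : (g i * b + e i < b ^ k.+1)%N.
Proof.
rewrite expnSr; apply: (@leq_trans ((g i).+1 * b)); first by rewrite mulSn addnC ltn_add2r.
by rewrite leq_mul2r ltn_ord orbT.
Qed.

(* A colour records the class of the parent cube and the position of the cube in
   its parent, so that within a colour distinct cubes have distinct parents. *)
Lemma chaos_colouring : assumption1 Pr b P ->
  exists (N : nat -> nat) (col : forall m, bindex d b m -> 'I_(N m)),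
    (forall m, injective (@col m) \/ ((0 < m)%N /\
      forall c, independent_processes Pr [set h | @col m h = c] (fun h => bcube h) (fun=> P m))) /\
    forall eps : R, 0 < eps -> exists2 C, 0 <= C & forall m, (N m)%:R <= C * b%:R `^ (eps * m%:R).
Proof.
move=> [k0 [N [D [_ N0 Ncvg Duniq Dind]]]].
pose cl m (h : bindex d b m) : 'I_(N m) := projT1 (cid (Duniq m h)).
have clP m (h : bindex d b m) : h \in D m (cl m h) := (projT2 (cid (Duniq m h))).1.
pose par k (h : bindex d b k.+1) : bindex d b k := [ffun i => Ordinal (parent_lt h i)].
pose pos k (h : bindex d b k.+1) : {ffun 'I_d -> 'I_b} := [ffun i => Ordinal (child_lt h i)].
pose up k (e : {ffun 'I_d -> 'I_b}) (g : bindex d b k) : bindex d b k.+1 :=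
  [ffun i => Ordinal (lift_lt g e i)].
have upK k (h : bindex d b k.+1) : up k (pos k h) (par k h) = h.
  by apply/ffunP => i; apply/val_inj; rewrite !ffunE/= !ffunE/= -divn_eq.
pose colT k : finType := ('I_(N k) * {ffun 'I_d -> 'I_b})%type.
have level m : exists n (col : bindex d b m -> 'I_n), (injective col \/ ((0 < m)%N /\
      forall c, independent_processes Pr [set h | col h = c] (fun h => bcube h) (fun=> P m))) /\
    (n <= b ^ (k0 * d) + N m.-1 * b ^ d)%N.
  (* Up to level [k0] no independence is available: every cube receives its own colour, and at most
     [b^(k0 * d)] colours are spent. *)
  have [mk|km] := leqP m k0.
    exists #|{: bindex d b m}|, enum_rank; split; first by left; exact: enum_rank_inj.
    rewrite card_ffun !card_ord -expnM (leq_trans _ (leq_addr _ _))//.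
    by rewrite leq_pexp2l// leq_mul2r mk orbT.
  case: m km => // k km.
  exists #|{: colT k}|, (fun h => enum_rank (cl k (par k h), pos k h)); split; last first.
    by rewrite card_prod card_ffun !card_ord leq_addl.
  right; split=> // c; rewrite -(enum_valK c); case: (enum_val c) => [i e].
  apply: (mutually_independent_reindex (f := par k) (g := up k e)) (Dind k.+1 km i).
  move=> h /= /enum_rank_inj[<- <-]; rewrite upK; split=> //; first exact: clP.
  apply: sub_smallest2r => [|_ [t ht [B mB <-]]]; first exact: smallest_sigma_algebra.
  exists t; last by exists B.
  apply: bcube_sub ht => // j; by rewrite !ffunE/= subSnn expn1.
pose n m := projT1 (cid (level m)); pose colE m := cid (projT2 (cid (level m))).
exists n, (fun m => projT1 (colE m)); split=> [m|eps eps0]; first exact: (projT2 (colE m)).1.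
have nle m : (n m <= b ^ (k0 * d) + N m.-1 * b ^ d)%N := (projT2 (colE m)).2.
have beta1 : 1 <= b%:R :> R by rewrite ler1n.
have [C [_ /(_ (C + 1))]] := cvg_seq_bounded (cvgP _ (Ncvg _ eps0)).
rewrite ltrDl ltr01 => /(_ isT) CP.
have q0 (x : R) : 0 < b%:R `^ x by rewrite powR_gt0// ltr0n.
have NC m : (N m)%:R <= (`|C| + 1) * b%:R `^ (m%:R * eps).
  have := CP m Logic.I; rewrite /= ger0_norm ?divr_ge0 ?powR_ge0//.
  rewrite ler_pdivrMr// => /le_trans; apply.
  by rewrite ler_wpM2r ?powR_ge0// lerD2r ler_norm.
exists ((b ^ (k0 * d))%:R + (`|C| + 1) * (b ^ d)%:R) => [|m].
  by rewrite addr_ge0// mulr_ge0// addr_ge0.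
have qm (k : nat) : (k <= m)%N -> b%:R `^ (k%:R * eps) <= b%:R `^ (eps * m%:R) :> R.
  by move=> km; apply: ler_powR => //; rewrite [leRHS]mulrC ler_wpM2r ?ler_nat// ltW.
apply: (@le_trans _ _ (b ^ (k0 * d) + N m.-1 * b ^ d)%:R); first by rewrite ler_nat.
rewrite natrD natrM mulrDl; apply: lerD.
  rewrite ler_peMr//; apply: le_trans (qm 0%N _) => //.
  by rewrite mul0r powRr0.
rewrite mulrAC ler_wpM2r//; apply: (le_trans (NC _)).
by rewrite ler_wpM2l ?addr_ge0// qm// leq_pred.
Qed.

End colouring.

(** * The Fourier transform of the limit *)

Section density_measure.
Context {disp : measure_display} {T : measurableType disp} {R : realType}.
Variables (l : {sigma_finite_measure set T -> \bar R}) (g : T -> R).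
Hypotheses (g0 : forall t, 0 <= g t) (ig : l.-integrable setT (EFin \o g)).
Local Open Scope ereal_scope.

Definition density_measure (A : set T) : \bar R := \int[l]_(t in A) (g t)%:E.

Let mg : measurable_fun setT (EFin \o g).
Proof. exact: measurable_int ig. Qed.

Let density0 : density_measure set0 = 0.
Proof. exact: integral_set0. Qed.

Let density_ge0 A : 0 <= density_measure A.
Proof. by apply: integral_ge0 => t _; rewrite lee_fin. Qed.

Let density_sigma_additive : semi_sigma_additive density_measure.
Proof.
move=> F mF tF mUF; rewrite /density_measure ge0_integral_bigcup//.
- apply: is_cvg_nneseries => n _ _; exact: density_ge0.
- exact: measurable_funTS.
- by move=> t _; rewrite lee_fin.
Qed.

HB.instance Definition _ := isMeasure.Build _ _ _ density_measure
  density0 density_ge0 density_sigma_additive.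

Let density_fin : fin_num_fun density_measure.
Proof.
by move=> A mA; apply: integrable_fin_num => //; exact: (integrableS measurableT).
Qed.

HB.instance Definition _ := @Measure_isFinite.Build _ _ _ density_measure density_fin.

(** [g] is almost everywhere the Radon-Nikodym derivative of the measure, both having the same
    integrals over measurable sets; the change of variables for the derivative then covers signed
    [f]. *)
Lemma integral_density_measure f U : measurable U -> measurable_fun U f ->
  \int[density_measure]_(t in U) `|f t| < +oo ->
  \int[density_measure]_(t in U) f t = \int[l]_(t in U) (f t * (g t)%:E).
Proof.
move=> mU mf finf.
have dom : density_measure `<< l.
  apply/null_content_dominatesP => A mA lA0.
  by apply: null_set_integral => //; exact: measurable_funTS.
rewrite -(Radon_Nikodym_change_of_variables dom)//=; last by apply/integrableP; split.
apply: ae_eq_integral => //.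
- apply: emeasurable_funM => //; apply: (measurable_int l).
  apply: (integrableS _ _ (@subsetT _ _)) => //=.
  exact: Radon_Nikodym_integrable.
- by apply: emeasurable_funM => //; exact: measurable_funTS.
- apply: ae_eqe_mul2l => /=; rewrite Radon_NikodymE//=.
  case: cid => /= h [h1 h2 h3]; apply: integral_ae_eq => //=.
  + exact: integrableS h2.
  + exact: measurable_funTS.
  + by move=> E EU mE; rewrite -h3.
Qed.

End density_measure.

Section unit_cube_measure.
Context {R : realType} (d : nat).
Local Open Scope ereal_scope.
Let l : {sigma_finite_measure set (d.-tuple R) -> \bar R} := lebesgue_tuple d.

Lemma lebesgue_ccube : l (@ccube R d) = 1.
Proof.
rewrite (_ : @ccube R d = tuple_prod d (fun=> `[0%R, 1%R]%classic)).
  rewrite lebesgue_tuple_prod// big1// => i _.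
  by rewrite lebesgue_measure_itv/= lte_fin ltr01 oppr0 adde0.
by apply/seteqP; split => t h i; have := h i; rewrite /= in_itv.
Qed.

Lemma lebesgue_hcube : l (@hcube R d) = 1.
Proof.
rewrite (_ : @hcube R d = tuple_prod d (fun=> `[0%R, 1%R[%classic)).
  rewrite lebesgue_tuple_prod// big1// => i _.
  by rewrite lebesgue_measure_itv/= lte_fin ltr01 oppr0 adde0.
by apply/seteqP; split => t h i; have := h i; rewrite /= in_itv.
Qed.

(** Weak convergence is tested on the closed cube, whereas the b-adic cubes tile the half-open one;
    this lets one pass from either to the other. *)
Lemma lebesgue_ccube_boundary : l (ccube d `\` hcube d) = 0.
Proof.
have lC : l (ccube d) < +oo by rewrite lebesgue_ccube ltry.
rewrite measureD; [|exact: measurable_ccube|exact: measurable_hcube|exact: lC].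
rewrite (setIidr (fun t => @hcube_ccube R d t)) -[RHS](subee (x := 1))//.
by congr (_ - _); [exact: lebesgue_ccube|exact: lebesgue_hcube].
Qed.

Lemma ccubeD_boundary : ccube d `\` (ccube d `\` hcube d) = hcube d :> set (d.-tuple R).
Proof. by rewrite setDD setIidr// => t; exact: hcube_ccube. Qed.

End unit_cube_measure.

Section chaos_fourier.
Context {dO : measure_display} {Omega : measurableType dO} {R : realType}.
Variables (Pr : probability Omega R) (d b : nat).
Variable P : nat -> d.-tuple R -> Omega -> R.
Hypothesis Pmeas : forall m,
  measurable_fun (ccube d `*` [set: Omega]) (fun z => P m z.1 z.2).
Hypothesis Pindep : independent_processes Pr [set: nat] (fun=> ccube d) P.
Hypothesis Pge0 : forall m t w, ccube d t -> 0 <= P m t w.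
Hypothesis Pmean1 : forall m t, ccube d t -> (Ex Pr (P m t) = 1)%E.

Let l : {sigma_finite_measure set (d.-tuple R) -> \bar R} := lebesgue_tuple d.
Let mC : measurable (@ccube R d). Proof. exact: measurable_ccube. Qed.
Let mH : measurable (@hcube R d). Proof. exact: measurable_hcube. Qed.

(** By Tonelli's theorem the integral over the half-open cube has expectation at most 1, hence is
    almost surely finite, and there are countably many levels. *)
Lemma chaosQ_integrable : {ae Pr, forall w, forall m,
  l.-integrable (ccube d) (fun t => (chaosQ P m t w)%:E)}.
Proof.
apply: ae_foralln => m.
have mQ := measurable_chaosQ_joint Pmeas m.
have mQh : measurable_fun (hcube d `*` [set: Omega]) (fun z => chaosQ P m z.1 z.2).
  apply: measurable_funS mQ; first exact: measurableX.
  by move=> [t w] [/= /hcube_ccube].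
have Q0 t w : hcube d t -> 0 <= chaosQ P m t w by move=> /hcube_ccube; exact: chaosQ_ge0.
have PM1 j t : hcube d t -> (Ex Pr (fun w => (P j t w `^ 1)%R) <= 1%:E)%E.
  move=> ht; have ct := hcube_ccube ht.
  by under eq_fun do rewrite powRr1 ?Pge0//; rewrite Pmean1.
have EQ t : hcube d t -> (Ex Pr (chaosQ P m t) <= 1)%E.
  move=> ht; have := chaosQ_moment Pmeas Pindep Pge0 PM1 m ht.
  rewrite /chaosA big1//; under eq_fun do rewrite powRr1 ?Q0//.
  exact.
have I0 w : (0 <= \int[l]_(t in hcube d) (chaosQ P m t w)%:E)%E.
  by apply: integral_ge0 => t ht; rewrite lee_fin Q0.
have iI : Pr.-integrable setT (fun w => \int[l]_(t in hcube d) (chaosQ P m t w)%:E)%E.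
  apply/integrableP; split; first exact: (measurable_integral_section l mH mQh Q0).
  under eq_integral do rewrite gee0_abs//.
  rewrite (tonelli_on l Pr mH mQh Q0).
  apply: (@le_lt_trans _ _ (\int[l]_(t in hcube d) 1)%E).
    apply: ge0_le_integral => //.
    - by move=> t ht; apply: expectation_ge0 => w; exact: Q0.
    - exact: (measurable_expectation_section Pr mH mQh Q0).
  have lH : (l (hcube d) < +oo)%E by rewrite lebesgue_hcube ltry.
  by rewrite integral_cst// mul1e.
have := integrable_ae measurableT iI; apply: filterS => w /(_ Logic.I) fw.
have mQw := measurable_section mC mQ w.
apply/integrableP; split; first exact/measurable_EFinP.
rewrite (_ : \int[l]_(t in ccube d) _ = \int[l]_(t in hcube d) (chaosQ P m t w)%:E)%E.
  by rewrite ltey_eq fw.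
transitivity (\int[l]_(t in ccube d) (chaosQ P m t w)%:E)%E.
  by apply: eq_integral => t /set_mem ct; rewrite gee0_abs// lee_fin chaosQ_ge0.
rewrite (@ge0_negligible_integral _ _ _ l (ccube d) (ccube d `\` hcube d))//.
- by rewrite ccubeD_boundary.
- exact: measurableD.
- exact/measurable_EFinP.
- by move=> t ct; rewrite lee_fin chaosQ_ge0.
- exact: lebesgue_ccube_boundary.
Qed.

Lemma sum_chaosD m t w : \sum_(j < m.+1) chaosD P j t w = chaosQ P m.+1 t w.
Proof.
elim: m => [|m IH]; first by rewrite big_ord1 /chaosD subr0.
by rewrite big_ord_recr/= IH /chaosD addrC subrK.
Qed.

Section path.
Variable w : Omega.
Hypothesis iQ : forall m, l.-integrable (ccube d) (fun t => (chaosQ P m t w)%:E).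

Lemma chaosD_integrable m : l.-integrable (hcube d) (fun t => (chaosD P m t w)%:E).
Proof.
have iQh k : l.-integrable (hcube d) (fun t => (chaosQ P k t w)%:E).
  by apply: (integrableS mC mH) (iQ k) => t; exact: hcube_ccube.
case: m => [|m]; rewrite /chaosD; first by under eq_fun do rewrite subr0.
under eq_fun do rewrite EFinB; exact: integrableB.
Qed.

Variables (f : d.-tuple R -> R).
Hypotheses (mf : measurable_fun setT f) (f1 : forall t, `|f t| <= 1).

Let fbd (A : set (d.-tuple R)) : [bounded f t | t in A].
Proof.
exists 1; split; first exact: num_real.
by move=> y y1 t _; apply: le_trans (f1 t) (ltW y1).
Qed.

(** The approximating measure has the density [chaosQ P m.+1] on the closed cube; once the null
    boundary is dropped, the density is the sum of the [chaosD]. *)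
Lemma integral_chaos_approx m :
  fine (\int[chaos_approx P m w]_(t in ccube d) (f t)%:E)%E =
  \sum_(j < m.+1) \int[l]_(t in hcube d) (chaosD P j t w * f t).
Proof.
pose g : d.-tuple R -> R := (fun t => chaosQ P m.+1 t w) \_ (ccube d).
have g0 t : 0 <= g t.
  by rewrite /g patchE; case: ifPn => // /set_mem ct; exact: chaosQ_ge0.
have ig : l.-integrable setT (EFin \o g).
  have := iQ m.+1; rewrite (integrable_mkcond _ mC); congr integrable.
  by apply/funext => t; rewrite /g /= !patchE; case: ifP.
have gE : chaos_approx P m w = density_measure l g.
  apply/funext => A; rewrite /chaos_approx /density_measure integral_mkcondr.
  apply: eq_integral => t _; rewrite /g !patchE; by case: ifP.
have mfE A : measurable_fun A (EFin \o f) by apply/measurable_EFinP; exact: measurable_funTS.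
rewrite gE (@integral_density_measure _ _ _ l g g0 ig (EFin \o f))//; last first.
  apply: (@le_lt_trans _ _ (\int[@density_measure _ _ _ l g]_(t in ccube d) 1)%E).
    apply: ge0_le_integral => //.
    - by apply: (measurableT_comp (@abse_measurable R _) ); exact: mfE.
    - by move=> t _; rewrite lee_fin f1.
  by rewrite integral_cst// mul1e ltey_eq fin_num_measure.
have iDf j : l.-integrable (hcube d) (fun t => (chaosD P j t w * f t)%:E).
  under eq_fun do rewrite EFinM.
  by apply: (integrableMl mH (chaosD_integrable j)) => //; exact: measurable_funTS.
have iQf : l.-integrable (ccube d) (fun t => (chaosQ P m.+1 t w * f t)%:E).
  under eq_fun do rewrite EFinM.
  by apply: (integrableMl mC (iQ m.+1)) => //; exact: measurable_funTS.
transitivity (fine (\int[l]_(t in ccube d) (chaosQ P m.+1 t w * f t)%:E)%E).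
  by congr fine; apply: eq_integral => t tC; rewrite /g patchE tC EFinM muleC.
rewrite (@negligible_integral _ _ _ l (ccube d) (ccube d `\` hcube d))//; last 2 first.
- exact: measurableD.
- exact: lebesgue_ccube_boundary.
rewrite ccubeD_boundary.
transitivity (fine (\sum_(j < m.+1) \int[l]_(t in hcube d) (chaosD P j t w * f t)%:E)%E).
  congr fine; rewrite -integral_sum//; apply: eq_integral => t _.
  by rewrite sumEFin -mulr_suml sum_chaosD.
rewrite -sum_fine// => j _; exact: integrable_fin_num.
Qed.

End path.

Lemma weakly_cvg_wave w (nu : {measure set (d.-tuple R) -> \bar R}) kd (x : d.-tuple R) :
  (nu (ccube d) < +oo)%E ->
  (forall m, l.-integrable (ccube d) (fun t => (chaosQ P m t w)%:E)) ->
  weakly_cvg (chaos_approx P ^~ w) nu ->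
  \sum_(j < m.+1) \int[l]_(t in hcube d) (chaosD P j t w * wave kd (- (2 * pi * dotp x t)))
    @[m --> \oo] --> \int[nu]_(t in ccube d) wave kd (- (2 * pi * dotp x t)).
Proof.
move=> nuC iQ nucvg.
pose g t := wave kd (- (2 * pi * dotp x t)).
have mg : measurable_fun setT g.
  apply: (measurableT_comp (measurable_wave _)).
  apply: (measurable_funN); apply: measurable_funM => //; exact: measurable_dotp.
have g1 t : `|g t| <= 1 by exact: wave_le1.
have ig : nu.-integrable (ccube d) (EFin \o g).
  apply: measurable_bounded_integrable => //.
    exact: measurable_funTS.
  exists 1; split; first exact: num_real.
  by move=> y y1 t _; apply: le_trans (g1 t) (ltW y1).
pose f (v : 'rV[R]_d) := wave kd (- (2 * pi * \sum_(i < d) tnth x i * v ord0 i)).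
have cf : continuous f.
  have cw : continuous (@wave R kd).
    by rewrite /wave; case: (kd); [exact: continuous_cos|exact: continuous_sin].
  have cs : continuous (fun v : 'rV[R]_d => \sum_(i < d) tnth x i * v ord0 i).
    apply: continuous_big => [|i _ u]; first exact: add_continuous.
    apply: (@continuousM R 'rV[R]_d (fun=> tnth x i) (fun v => v ord0 i)).
      exact: cst_continuous.
    exact: coord_continuous.
  move=> v; apply: (@continuous_comp _ _ _
    (fun v : 'rV[R]_d => - (2 * pi * \sum_(i < d) tnth x i * v ord0 i))); last exact: cw.
  apply: (@continuousN R R^o 'rV[R]_d).
  apply: (@continuousM R 'rV[R]_d (fun=> 2 * pi)); [exact: cst_continuous|exact: cs].
have fE : (fun t => (f (row_of_tuple t))%:E) = (fun t => (g t)%:E).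
  apply/funext => t; rewrite /f /g /dotp; congr (wave _ (- (_ * _)))%:E.
  by apply: eq_bigr => i _; rewrite mxE.
have := nucvg f (continuous_subspaceT cf).
rewrite fE -[X in _ --> X]fineK; last exact: integrable_fin_num.
move=> /fine_cvg; rewrite (_ : fine \o _ = fun m =>
    \sum_(j < m.+1) \int[l]_(t in hcube d) (chaosD P j t w * g t)) //.
by apply/funext => m /=; rewrite integral_chaos_approx.
Qed.

End chaos_fourier.

(** * From the frequency mesh to all frequencies *)

Section fourier_interpolation.
Context {R : realType} (d b : nat).
Hypotheses (d1 : (1 <= d)%N) (b2 : (2 <= b)%N).

Let b0 : (0 < b)%N. Proof. exact: leq_trans b2. Qed.
Let bn0 n : 0 < (b ^ n)%:R :> R. Proof. by rewrite ltr0n expn_gt0 b0. Qed.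

Lemma freq_approx n (x : d.-tuple R) i0 :
  (forall i, `|tnth x i| < (b ^ n.+1)%:R) -> (b ^ n)%:R <= `|tnth x i0| ->
  exists2 z : fgrid d b n, @active R d b n z &
    forall i, `|tnth x i - tnth (freq z) i| <= (b ^ n)%:R^-1.
Proof.
move=> xlt xge; pose B2 : R := (b ^ (2 * n + 1))%:R.
have B2E : (b ^ n.+1)%:R * (b ^ n)%:R = B2.
  by rewrite -natrM -expnD; congr (b ^ _)%:R; lia.
pose u i := tnth x i * (b ^ n)%:R + B2.
have ub i : 0 <= u i < B2 * 2.
  have := xlt i; rewrite -(ltr_pM2r (bn0 n)) B2E -[X in _ * X]ger0_norm// -normrM ltr_norml.
  by rewrite /u; lra.
have tu i : (Num.truncn (u i))%:R <= u i < (Num.truncn (u i)).+1%:R.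
  by apply: truncn_itv; case/andP: (ub i).
have tlt i : (Num.truncn (u i) < (b ^ (2 * n + 1) * 2).+1)%N.
  rewrite ltnS -(ler_nat R) natrM -/B2; have /andP[h1 _] := tu i; have /andP[_ h2] := ub i.
  exact: ltW (le_lt_trans h1 h2).
pose z : fgrid d b n := [ffun i => Ordinal (tlt i)].
have zE i : tnth (freq z) i = ((Num.truncn (u i))%:R - B2) / (b ^ n)%:R.
  by rewrite tnth_mktuple ffunE.
have xE i : tnth x i = (u i - B2) / (b ^ n)%:R.
  by rewrite /u addrK mulfK// gt_eqF.
have fx i : 0 <= tnth x i - tnth (freq z) i <= (b ^ n)%:R^-1.
  have /andP[h1 h2] := tu i.
  have -> : tnth x i - tnth (freq z) i = (u i - (Num.truncn (u i))%:R) / (b ^ n)%:R.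
    by rewrite zE {1}xE -mulrBl; congr (_ / _); ring.
  rewrite divr_ge0 ?subr_ge0//= -[leRHS]mul1r ler_wpM2r ?invr_ge0//.
  by move: h2; rewrite -natr1; lra.
exists z => [|i]; last by have /andP[h1 h2] := fx i; rewrite ger0_norm.
(* Rounding goes downwards: a negative coordinate does not shrink in absolute value, and a positive
   one cannot fall below [b^n], which is itself a value of the mesh. *)
apply/existsP; exists i0; have [x0|x0] := leP 0 (tnth x i0); last first.
  have /andP[h1 _] := fx i0; rewrite ltr0_norm; last by apply: le_lt_trans x0; lra.
  by move: xge; rewrite ltr0_norm//; lra.
move: xge; rewrite ger0_norm// => xge.
apply: le_trans (ler_norm _); rewrite zE ler_pdivlMr// lerBrDr /B2 -natrM -natrD ler_nat -ltnS.
have /andP[_ h2] := tu i0; rewrite -(ltr_nat R); apply: le_lt_trans h2.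
by rewrite natrD natrM /u lerD2r ler_pM2r.
Qed.

Variable nu : {measure set (d.-tuple R) -> \bar R}.
Hypothesis nuC : (nu (ccube d) < +oo)%E.
Let F kd (x : d.-tuple R) := \int[nu]_(t in ccube d) wave kd (- (2 * pi * dotp x t)).
Let mC : measurable (@ccube R d). Proof. exact: measurable_ccube. Qed.

Lemma integrable_wave kd (x : d.-tuple R) :
  nu.-integrable (ccube d) (EFin \o (fun t => wave kd (- (2 * pi * dotp x t)))).
Proof.
apply: measurable_bounded_integrable => //.
  apply: measurable_funTS; apply: (measurableT_comp (measurable_wave _)).
  apply: (measurable_funN); apply: measurable_funM => //; exact: measurable_dotp.
exists 1; split; first exact: num_real.
by move=> y y1 t _; apply: le_trans (wave_le1 _ _) (ltW y1).
Qed.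

Lemma fourier_wave_lipschitz kd (x x' : d.-tuple R) (e : R) :
  (forall i, `|tnth x i - tnth x' i| <= e) ->
  `|F kd x - F kd x'| <= 2 * pi * d%:R * e * fine (nu (ccube d)).
Proof.
move=> xx'; have pi0 := pi_ge0 R.
rewrite /F -RintegralB//; [|exact: integrable_wave..].
have iB : nu.-integrable (ccube d) (EFin \o (fun t =>
    wave kd (- (2 * pi * dotp x t)) - wave kd (- (2 * pi * dotp x' t)))).
  rewrite (_ : _ \o _ = (EFin \o (fun t => wave kd (- (2 * pi * dotp x t)))) \-
    (EFin \o (fun t => wave kd (- (2 * pi * dotp x' t)))))%E//.
  by apply: integrableB => //; exact: integrable_wave.
apply: (le_trans (le_normr_Rintegral mC iB)).
rewrite -(Rintegral_cst nu mC); apply: le_Rintegral => //.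
- have := integrable_abse iB; by apply: eq_integrable.
- apply: measurable_bounded_integrable => //.
  set c := _ * e; exists `|c|; split; first exact: num_real.
  by move=> y cy t _; exact: ltW.
move=> t ct; apply: (le_trans (wave_lipschitz _ _ _)).
rewrite opprK addrC -mulrBr normrM ger0_norm ?mulr_ge0//.
rewrite -[2 * pi * d%:R * e]mulrA ler_wpM2l ?mulr_ge0// distrC /dotp -sumrB.
apply: (le_trans (ler_norm_sum _ _ _)).
rewrite mulr_natl -[X in _ *+ X]card_ord -sumr_const; apply: ler_sum => i _.
rewrite -mulrBl normrM -[leRHS]mulr1; apply: ler_pM => //.
by have /andP[t0 t1] := ct i; rewrite ger0_norm.
Qed.

Lemma euclid_norm_sup (x : d.-tuple R) : exists i0,
  (forall i, `|tnth x i| <= `|tnth x i0|) /\ euclid_norm x <= d%:R * `|tnth x i0|.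
Proof.
pose i1 : 'I_d := Ordinal d1.
have [i0 _ max] := Order.TotalTheory.arg_maxP (fun i => `|tnth x i|) (isT : xpredT i1).
exists i0; split=> [i|]; first exact: max.
set X := `|tnth x i0|; have X0 : 0 <= X by exact: normr_ge0.
rewrite /euclid_norm -[leRHS]ger0_norm ?mulr_ge0// -sqrtr_sqr ler_wsqrtr//.
apply: (@le_trans _ _ (\sum_(i < d) X ^+ 2)).
  apply: ler_sum => i _; rewrite -real_normK ?num_real//.
  by rewrite lerXn2r ?nnegrE//; exact: max.
rewrite sumr_const card_ord -[_ *+ d]mulr_natl exprMn ler_wpM2r ?sqr_ge0//.
by rewrite -natrX ler_nat -{1}(expn1 d) leq_pexp2l.
Qed.

(** The scale [n] is the integer logarithm of the sup norm of the frequency. Moving to a mesh point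
    costs a multiple of [b^-n], which is below [b^(-s n)] because [s <= 1]. *)
Lemma fourier_bigO_grid (s C : R) (n0 : nat) : 0 <= s <= 1 -> 0 <= C ->
  (forall n kd (z : fgrid d b n), (n0 <= n)%N -> @active R d b n z ->
    `|F kd (freq z)| <= C * b%:R `^ (- (s * n%:R))) ->
  fourier_bigO nu (2 * s).
Proof.
move=> /andP[s0 s1] C0 FC; have pi0 := pi_ge0 R.
have d0 : 0 < d%:R :> R by rewrite ltr0n.
have beta1 : 1 <= b%:R :> R by rewrite ler1n.
have beta0 : 0 < b%:R :> R by exact: lt_le_trans beta1.
pose V := fine (nu (ccube d)); have V0 : 0 <= V by exact: fine_ge0.
pose C' := C + 2 * pi * d%:R * V.
have C'0 : 0 <= C' by rewrite addr_ge0// !mulr_ge0.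
(* The 2 counts the real and imaginary parts; [b * d] compares the Euclidean norm, at most [d] times
   the sup norm, with [b^n]; the threshold forces the sup norm above [b^n0]. *)
exists (2 * (C' * (b%:R * d%:R) `^ s) ^+ 2), (d%:R * (b ^ n0)%:R).
split=> [|x xM]; first by rewrite mulr_gt0.
have [i0 [xi0 xe]] := euclid_norm_sup x.
set X := `|tnth x i0| in xi0 xe.
have Xn0 : (b ^ n0)%:R <= X by rewrite -(ler_pM2l d0); exact: le_trans xM xe.
have X0 : 0 < X by apply: lt_le_trans Xn0.
have e0 : 0 < euclid_norm x by apply: lt_le_trans xM; rewrite mulr_gt0.
pose k := Num.truncn X; have /andP[k1 k2] : k%:R <= X < k.+1%:R by apply: truncn_itv; exact: ltW.
have n0k : (b ^ n0 <= k)%N by rewrite -ltnS -(ltr_nat R); exact: le_lt_trans k2.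
have k0 : (0 < k)%N by apply: leq_trans n0k; rewrite expn_gt0 b0.
pose n := trunc_log b k; have /andP[n1 n2] : (b ^ n <= k < b ^ n.+1)%N by exact: trunc_log_bounds.
have n0n : (n0 <= n)%N by exact: trunc_log_max.
have Xn : (b ^ n)%:R <= X by apply: le_trans k1; rewrite ler_nat.
have Xn1 : X < (b ^ n.+1)%:R by apply: (lt_le_trans k2); rewrite ler_nat.
have [z az xz] := @freq_approx n x i0 (fun i => le_lt_trans (xi0 i) Xn1) Xn.
have qn : (b ^ n)%:R^-1 = b%:R `^ (- n%:R) :> R by rewrite natrX powRN powR_mulrn.
have F1 kd : `|F kd x| <= C' * b%:R `^ (- (s * n%:R)).
  rewrite -[F kd x](subrK (F kd (freq z))); apply: (le_trans (ler_normD _ _)).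
  rewrite /C' mulrDl addrC; apply: lerD; first exact: FC.
  apply: (le_trans (fourier_wave_lipschitz kd xz)); rewrite -/V qn mulrAC.
  rewrite ler_wpM2l ?mulr_ge0//; apply: ler_powR => //.
  by rewrite lerN2 ler_piMl.
have F2 kd : `|F kd x| <= C' * (b%:R * d%:R) `^ s * euclid_norm x `^ (- s).
  apply: (le_trans (F1 kd)); rewrite -mulrA ler_wpM2l//.
  have -> : b%:R `^ (- (s * n%:R)) = (b ^ n)%:R^-1 `^ s :> R.
    by rewrite qn -powRrM; congr (_ `^ _); ring.
  have -> : euclid_norm x `^ (- s) = (euclid_norm x)^-1 `^ s.
    by rewrite -powR_inv1 ?ltW// -powRrM mulN1r.
  rewrite -powRM ?mulr_ge0 ?invr_ge0 ?(ltW e0)//; apply: le_powR => //.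
  rewrite ler_pdivlMr// mulrC ler_pdivrMr//; apply: (le_trans xe).
  by rewrite mulrAC -natrM -expnS mulrC ler_wpM2r// ltW.
have -> : euclid_norm x `^ (- (2 * s)) = (euclid_norm x `^ (- s)) ^+ 2.
  by rewrite -powR_mulrn ?powR_ge0// -powRrM; congr (_ `^ _); ring.
rewrite -mulrA -exprMn; set Y := _ * _ `^ (- s) in F2 *.
have F3 kd : F kd x ^+ 2 <= Y ^+ 2.
  by rewrite -real_normK ?num_real// lerXn2r ?nnegrE//; exact: le_trans (F2 kd).
have -> : ComplexField.Normc.normc (fourier nu x) = Num.sqrt (F true x ^+ 2 + F false x ^+ 2) by [].
rewrite sqr_sqrtr ?addr_ge0 ?sqr_ge0// mulr2n mulrDl mul1r; exact: lerD.
Qed.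

End fourier_interpolation.

(** The thresholds sum over [m] to a geometric series of ratio [b^-g], so the partial sums are
    bounded uniformly and the bound passes to the weak limit on the mesh. *)
Lemma chaos_fourier_bigO {dO : measure_display} {Omega : measurableType dO} {R : realType}
    (d b : nat) (P : nat -> d.-tuple R -> Omega -> R) (w : Omega)
    (nu : {measure set (d.-tuple R) -> \bar R}) (s g : R) (n0 : nat) :
  (nu (ccube d) < +oo)%E ->
  (1 <= d)%N -> (2 <= b)%N ->

  (forall m t w, ccube d t -> 0 <= P m t w) ->
  0 <= s <= 1 -> 0 < g ->
  (forall m, (@lebesgue_tuple R d).-integrable (ccube d) (fun t => (chaosQ P m t w)%:E)) ->
  weakly_cvg (chaos_approx P ^~ w) nu ->
  (forall n m, (n0 <= n)%N -> forall x : fgrid d b n * bool * bool,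
    `|\int[@lebesgue_tuple R d]_(t in hcube d) (chaosD P m t w * swave x t)| <=
      2 * b%:R `^ (- (s * n%:R + g * m%:R))) ->
  fourier_bigO nu (2 * s).
Proof.
move=> nuC d1 b2 Pge0 s01 g0 iQ nucvg small.
have beta1 : 1 < b%:R :> R by rewrite ltr1n.
have beta0 : 0 < b%:R :> R by exact: lt_trans beta1.
pose r : R := b%:R `^ (- g).
have r0 : 0 < r by exact: powR_gt0.
have r1 : r < 1.
  by rewrite /r powRN invf_lt1 ?powR_gt0//; exact: powR_gt1.
apply: (@fourier_bigO_grid R d b d1 b2 nu nuC s (2 / (1 - r)) n0 s01) => [|n kd z n0n az].
  by rewrite divr_ge0// subr_ge0 ltW.
set B := _ * b%:R `^ _.
have cv := @weakly_cvg_wave _ _ _ d P Pge0 w nu kd (freq z) nuC iQ nucvg.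
have le m : `|\sum_(j < m.+1) \int[@lebesgue_tuple R d]_(t in hcube d)
    (chaosD P j t w * wave kd (- (2 * pi * dotp (freq z) t)))| <= B.
  apply: (le_trans (ler_norm_sum _ _ _)).
  apply: (@le_trans _ _ (series (geometric (2 * b%:R `^ (- (s * n%:R))) r) m.+1)).
    rewrite /series /= big_mkord; apply: ler_sum => j _.
    have -> : 2 * b%:R `^ (- (s * n%:R)) * r ^+ j = 2 * b%:R `^ (- (s * n%:R + g * j%:R)).
      rewrite /r -powR_mulrn ?powR_ge0// -powRrM -mulrA -powRD ?(gt_eqF beta0) ?implybT//.
      by congr (_ * _ `^ _); ring.
    apply: le_trans (small n j n0n (z, kd, true)).
    rewrite le_eqVlt; apply/orP; left; apply/eqP; congr `|_|.
    by apply: eq_Rintegral => t _; rewrite /swave /= az mul1r.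
  apply: (le_trans (geometric_le_lim _ _ r0 _)).
  - by rewrite mulr_ge0// powR_ge0.
  - by rewrite gtr0_norm.
  by rewrite /B mulrAC.
have cn := cvg_norm (FF := eventually_filter) cv; rewrite -(cvg_lim _ cn)//.
by apply: limr_le; [exact: cvgP cn|exact: nearW].
Qed.

(** * Proof of the theorem *)

Section limsup.
Context {R : realType}.
Implicit Types u : nat -> \bar R.
Local Open Scope ereal_scope.

Lemma limn_esup_lt u (l : \bar R) : limn_esup u < l ->
  exists j0, forall j, (j0 <= j)%N -> u j < l.
Proof.
rewrite limn_esup_lim (cvg_lim _ (@cvg_esups_inf _ u))// => /ereal_inf_lt[_ [j0 _ <-] ul].
exists j0 => j j0j; apply: le_lt_trans ul; apply: ereal_sup_ubound.
by exists j.
Qed.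

Lemma limn_esup_ge u (l : \bar R) : (forall j, l <= u j) -> l <= limn_esup u.
Proof.
move=> lu; rewrite limn_esup_lim; apply: lime_ge; first exact: is_cvg_esups.
apply: nearW => j; apply: (le_trans (lu j)); apply: ereal_sup_ubound.
by exists j => /=.
Qed.

End limsup.

(** The factors before [j0] are absorbed in the constant, which is legitimate because no factor is
    below 1. *)
Lemma chaosA_growth {R : realType} (M : nat -> R) (L : R) j0 :
  (forall j, 1 <= M j) -> 1 <= L -> (forall j, (j0 <= j)%N -> M j <= L) ->
  forall m, chaosA M m.+1 <= chaosA M j0.+1 * L ^+ m.
Proof.
move=> M1 L1 ML; have L0 : 0 <= L by exact: le_trans L1.
have A1 := chaosA_ge1 M1; have A0 m : 0 <= chaosA M m by exact: le_trans (A1 m).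
have AS m : chaosA M m.+1 = chaosA M m * M m by rewrite /chaosA big_ord_recr.
have A2 : forall m k, chaosA M m <= chaosA M (m + k)%N.
  move=> m; elim => [|k IH]; first by rewrite addn0.
  by rewrite addnS AS; apply: (le_trans IH); rewrite ler_peMr.
elim => [|m IH]; first by rewrite mulr1 (A2 1%N j0).
have [mj|jm] := leqP m.+1 j0.
  rewrite -[leLHS]mulr1; apply: ler_pM => //; last exact: exprn_ege1.
  by have := A2 m.+2 (j0 - m.+1)%N; rewrite addSn subnKC.
rewrite AS exprSr mulrA; apply: ler_pM => //; first exact: le_trans (M1 _).
by apply: ML; exact: ltnW.
Qed.

Section moments.
Context {dO : measure_display} {Omega : measurableType dO} {R : realType}.
Variables (Pr : probability Omega R) (d b : nat).
Variable P : nat -> d.-tuple R -> Omega -> R.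
Hypothesis d1 : (1 <= d)%N.
Hypothesis b2 : (2 <= b)%N.
Hypothesis Pmeas : forall m,
  measurable_fun (ccube d `*` [set: Omega]) (fun z => P m z.1 z.2).
Hypothesis Pge0 : forall m t w, ccube d t -> 0 <= P m t w.
Hypothesis Pmean1 : forall m t, ccube d t -> (Ex Pr (P m t) = 1)%E.

Let mP (p : R) j t : ccube d t -> measurable_fun setT (fun w => P j t w `^ p).
Proof. by move=> ct; apply: (measurableT_comp (@measurable_powR R p)); exact: measurable_proc. Qed.

(** Jensen's inequality from [powR_bernoulli], with [p - 1] moved so that all terms are nonnegative.
    It provides the lower bound 1 asked of [M], and keeps the limit superior inside [Theta] at least
    1. *)
Lemma moment_ge1 (p : R) j t : 1 <= p -> ccube d t -> (1 <= Ex Pr (fun w => (P j t w `^ p)%R))%E.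
Proof.
move=> p1 ct; have mPt : measurable_fun setT (P j t) by exact: measurable_proc.
have p10 : 0 <= p - 1 by rewrite subr_ge0.
have Pt0 w : 0 <= P j t w by exact: Pge0.
have p0 : 0 <= p by exact: le_trans p1.
have h : (Ex Pr (fun w => (p * P j t w)%R) <= Ex Pr (fun w => (P j t w `^ p + (p - 1))%R))%E.
  apply: Ex_le => [|w||w].
  - by apply: measurable_funM.
  - by rewrite mulr_ge0.
  - by apply: measurable_funD => //; exact: mP.
  - by have := powR_bernoulli (Pt0 w) p1; lra.
move: h; rewrite (ExZ Pr mPt Pt0 p0) Pmean1// mule1.
rewrite (ExD Pr (mP p j ct) (fun w => powR_ge0 _ _) (@measurable_cst _ _ _ _ setT (p - 1)) (fun=> p10)).
rewrite expectation_cst -leeBlDr// -EFinB; apply: le_trans.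
by rewrite lee_fin; lra.
Qed.

Lemma sup_moment_ub (p : R) j t : hcube d t ->
  (Ex Pr (fun w => (P j t w `^ p)%R) <= sup_moment Pr P p j)%E.
Proof. by move=> ht; apply: ereal_sup_ubound; exists t. Qed.

Lemma sup_moment_ge1 (p : R) j : 1 <= p -> (1 <= sup_moment Pr P p j)%E.
Proof.
move=> p1; have h0 : hcube d ([tuple 0 | i < d] : d.-tuple R).
  by move=> i; rewrite tnth_mktuple lexx ltr01.
exact: le_trans (moment_ge1 j p1 (hcube_ccube h0)) (sup_moment_ub p j h0).
Qed.

Lemma moment_le (p q : R) (X : Omega -> R) : 0 <= p <= q -> measurable_fun setT X ->
  (forall w, 0 <= X w) ->
  (Ex Pr (fun w => (X w `^ p)%R) <= 1 + Ex Pr (fun w => (X w `^ q)%R))%E.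
Proof.
move=> pq mX X0.
have mXp r : measurable_fun setT (fun w => X w `^ r).
  exact: (measurableT_comp (@measurable_powR R r)).
rewrite -(expectation_cst Pr 1) -(ExD Pr (@measurable_cst _ _ _ _ setT (1 : R)) (fun=> ler01) (mXp q) (fun w => powR_ge0 _ _)).
apply: Ex_le => [|w||w].
- exact: mXp.
- exact: powR_ge0.
- by apply: measurable_funD => //; exact: mXp.
- exact: powR_le1D.
Qed.

Lemma sup_moment_le (p q : R) j : 0 <= p <= q -> (sup_moment Pr P p j <= 1 + sup_moment Pr P q j)%E.
Proof.
move=> pq; apply: ge_ereal_sup => _ [t ht <-]; have ct := hcube_ccube ht.
have mPt : measurable_fun setT (P j t) by exact: measurable_proc.
apply: (le_trans (moment_le pq mPt (fun w => Pge0 j w ct))).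
by rewrite leeD2l// sup_moment_ub.
Qed.

Lemma euclid_dist_gt0 (t s : d.-tuple R) : t != s -> 0 < euclid_dist t s.
Proof.
move=> ts; rewrite sqrtr_gt0 lt_def sumr_ge0 ?andbT; last by move=> i _; exact: sqr_ge0.
apply: contra ts; rewrite psumr_eq0; last by move=> i _; exact: sqr_ge0.
move=> /allP h; apply/eqP/eq_from_tnth => i; have := h i (mem_index_enum _).
by rewrite /= sqrf_eq0 subr_eq0 => /eqP.
Qed.

(** Assumption 3 at order [q] is lowered to order [p] for the normalised increment; the added 1 only
    changes the constant. *)
Lemma increment_moment (p q alpha : R) : 0 < p <= q -> assumption3 Pr b P q alpha ->
  exists2 C, 0 <= C & forall j (h : bindex d b j) t s, bcube h t -> bcube h s ->
  (Ex Pr (fun w => (`|P j t w - P j s w| `^ p)%R) <=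
   (C * ((b ^ j)%:R * euclid_dist t s) `^ (alpha * p))%:E)%E.
Proof.
move=> /andP[p0 pq]; rewrite /assumption3 /=; set S := ereal_sup _ => Soo.
have [C C0 SC] : exists2 C, 0 <= C & (S <= C%:E)%E.
  case: S Soo => [r _|//|_]; last by exists 0 => //; exact: leNye.
  by exists `|r| => //; rewrite lee_fin ler_norm.
exists (1 + C) => [|j h t s ht hs]; first by rewrite addr_ge0.
have [<-|ts] := eqVneq t s.
  under eq_fun do rewrite subrr normr0 powR0 ?gt_eqF//.
  by rewrite expectation_cst lee_fin mulr_ge0 ?powR_ge0// addr_ge0.
have bj0 : 0 < (b ^ j)%:R :> R by rewrite ltr0n expn_gt0 ltnW.
have dist0 := euclid_dist_gt0 ts.
pose N := b%:R `^ (j%:R * alpha) * euclid_dist t s `^ alpha.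
have N0 : 0 < N by rewrite mulr_gt0 ?powR_gt0// ltr0n ltnW.
have NE : ((b ^ j)%:R * euclid_dist t s) `^ (alpha * p) = N `^ p.
  have qj : (b ^ j)%:R = b%:R `^ j%:R :> R by rewrite natrX powR_mulrn.
  rewrite powRrM powRM; [|exact: ltW..].
  by rewrite qj -[(b%:R `^ j%:R) `^ alpha]powRrM.
pose Y w := `|(P j t w - P j s w) / N|.
have mY : measurable_fun setT Y.
  apply: (measurableT_comp (@normr_measurable R setT)); apply: measurable_funM => //.
  by apply: measurable_funB; apply: measurable_proc => //; exact: (bcube_ccube (ltnW b2)).
have Y0 w : 0 <= Y w by exact: normr_ge0.
have EY : (Ex Pr (fun w => (Y w `^ q)%R) <= C%:E)%E.
  apply: le_trans SC; rewrite /S.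
  apply: (le_trans _ (ereal_sup_ubound _)); last by exists j.
  apply: (le_trans _ (ereal_sup_ubound _)); last by exists h.
  by apply: ereal_sup_ubound; exists (t, s).
have p00 : 0 <= p <= q by rewrite ltW.
have mYp : measurable_fun setT (fun w => Y w `^ p).
  exact: (measurableT_comp (@measurable_powR R p)).
have -> : (fun w => `|P j t w - P j s w| `^ p) = (fun w => N `^ p * Y w `^ p).
  apply/funext => w; rewrite -powRM ?(ltW N0)//; congr (_ `^ _).
  by rewrite /Y normrM normfV (gtr0_norm N0) mulrCA mulfV ?mulr1// gt_eqF.
rewrite (ExZ Pr mYp (fun w => powR_ge0 _ _)) ?powR_ge0// NE mulrC EFinM lee_wpmul2l//.
  by rewrite lee_fin powR_ge0.
apply: (le_trans (moment_le p00 mY Y0)).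
by rewrite EFinD leeD2l.
Qed.

End moments.

Lemma Theta_gt {dO : measure_display} {Omega : measurableType dO} {R : realType}
    (Pr : probability Omega R) (d b : nat) (P : nat -> d.-tuple R -> Omega -> R) (p c : R) :
  (2 <= b)%N -> (1 <= limn_esup (sup_moment Pr P p))%E ->
  (c%:E < Theta Pr b P p)%E <->
  (limn_esup (sup_moment Pr P p) < (b%:R `^ (d%:R * (p - 1) - c / ln b%:R))%:E)%E.
Proof.
move=> b2; rewrite /Theta; set l := limn_esup _.
have b0 : 0 < b%:R :> R by rewrite ltr0n ltnW.
have lnb : 0 < ln b%:R :> R by rewrite ln_gt0// ltr1n.
case: l => [r|_|]; [|by split|by []].
rewrite lee_fin => r1; have r0 : 0 < r by exact: lt_le_trans r1.
rewrite lne_EFin// -EFinB !lte_fin -[X in r < X](lnK (powR_gt0 _ b0)) ln_powR.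
have -> : (d%:R * (p - 1) - c / ln b%:R) * ln b%:R = d%:R * (p - 1) * ln b%:R - c.
  by field; rewrite gt_eqF.
rewrite -[X in X < expR _](lnK r0) ltr_expR; split; lra.
Qed.

Section fourier_dimension.
Context {dO : measure_display} {Omega : measurableType dO} {R : realType}.
Variables (Pr : probability Omega R) (d b : nat).
Variable P : nat -> d.-tuple R -> Omega -> R.
Hypotheses (d1 : (1 <= d)%N) (b2 : (2 <= b)%N).
Hypothesis Pmeas : forall m,
  measurable_fun (ccube d `*` [set: Omega]) (fun z => P m z.1 z.2).
Hypothesis Pindep : independent_processes Pr [set: nat] (fun=> ccube d) P.
Hypothesis Pge0 : forall m t w, ccube d t -> 0 <= P m t w.
Hypothesis Pmean1 : forall m t, ccube d t -> (Ex Pr (P m t) = 1)%E.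
Variables (q alpha : R).
Hypotheses (q12 : 1 < q <= 2) (alpha01 : 0 < alpha <= 1).
Hypotheses (A1 : assumption1 Pr b P) (A2 : assumption2 Pr b P q)
  (A3 : assumption3 Pr b P q alpha).
Variable mu : R.-ftker Omega ~> d.-tuple R.
Hypothesis hmu : {ae Pr, forall w, weakly_cvg (chaos_approx P ^~ w) (mu w)}.

Lemma chaos_decay (p s : R) : 1 < p <= q -> 0 <= s < alpha ->
  ((s * p * ln b%:R)%:E < Theta Pr b P p)%E ->
  {ae Pr, forall w, fourier_bigO (mu w) (2 * s)}.
Proof.
move=> /andP[p1 pq] /andP[s0 salpha] sTheta.
have pp : 0 < p by exact: lt_trans p1.
have b0 : 0 < b%:R :> R by rewrite ltr0n ltnW.
have b1 : 1 < b%:R :> R by rewrite ltr1n.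
have lnb : 0 < ln b%:R :> R by rewrite ln_gt0.
have sm1 j : (1 <= sup_moment Pr P p j)%E by apply: sup_moment_ge1 => //; exact: ltW.
have pq0 : 0 <= p <= q by rewrite ltW.
have smfin j : (sup_moment Pr P p j < +oo)%E.
  apply: (le_lt_trans (sup_moment_le Pr Pmeas Pge0 j pq0)).
  by rewrite lte_add_pinfty// ?ltry// A2.1.
pose M j := fine (sup_moment Pr P p j).
have ME j : (M j)%:E = sup_moment Pr P p j.
  by rewrite /M fineK// ge0_fin_numE//; exact: le_trans (sm1 j).
have M1 j : 1 <= M j by rewrite -lee_fin ME.
have PM j t : hcube d t -> (Ex Pr (fun w => (P j t w `^ p)%R) <= (M j)%:E)%E.
  by move=> ht; rewrite ME; exact: sup_moment_ub.
have lsup1 := limn_esup_ge sm1.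
(* The strict inequality on [Theta] leaves room for an exponent [tau] above [s]; an infinite [Theta]
   is replaced by a finite level. *)
have [tau stau tauTheta] : exists2 tau, s < tau &
    (limn_esup (sup_moment Pr P p) < (b%:R `^ (d%:R * (p - 1) - p * tau))%:E)%E.
  have [c sc cTheta] : exists2 c, s * p * ln b%:R < c & (c%:E < Theta Pr b P p)%E.
    case: (Theta _ _ _ _) sTheta => [r|_|//].
      rewrite lte_fin => sr; exists ((s * p * ln b%:R + r) / 2); rewrite ?lte_fin; lra.
    by exists (s * p * ln b%:R + 1); rewrite ?ltry//; lra.
  exists (c / (p * ln b%:R)); first by rewrite ltr_pdivlMr ?mulr_gt0// mulrA.
  move: cTheta; rewrite (Theta_gt _ b2 lsup1); congr (_ < (_ `^ (_ - _))%:E)%E.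
  by field; rewrite !gt_eqF.
set L := b%:R `^ _ in tauTheta.
have L1 : 1 <= L by rewrite -lee_fin; exact: ltW (le_lt_trans lsup1 tauTheta).
have [j0 j0L] := limn_esup_lt tauTheta.
have ML j : (j0 <= j)%N -> M j <= L by move=> /j0L; rewrite -ME lte_fin => /ltW.
have AL := chaosA_growth M1 L1 ML.
have ppq : 0 < p <= q by rewrite pp.
have [C3 C30 PC3] := increment_moment b2 Pmeas ppq A3.
have q1 : 0 < (1 : R) <= q by apply/andP; split; [exact: ltr01|case/andP: q12 => /ltW].
have [C1 C10 PC1] := increment_moment b2 Pmeas q1 A3.
have /andP[a0 a1] := alpha01.
(* [s'] is the exponent used on the cubes, while [s] itself becomes the target [s0]; strictness on
   both sides produces the two gaps. *)
pose s' := (s + Num.min alpha tau) / 2.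
have /andP[ss' s'min] : s < s' < Num.min alpha tau.
  have : s < Num.min alpha tau by rewrite lt_min salpha.
  by rewrite /s'; move: (Num.min _ _) => y sy; apply/andP; split; lra.
move: s'min; rewrite lt_min => /andP[s'alpha s'tau].
have s01 : 0 <= s <= 1.
  by rewrite s0 /= (le_trans (ltW salpha)).
have s'01 : 0 <= s' <= 1 by apply/andP; split; lra.
have p2 : p <= 2 by case/andP: q12 => _; exact: le_trans.
have gap0 : 0 < level_gap s' tau by rewrite divr_gt0// subr_gt0.
have [N [col [colP NP]]] := chaos_colouring b2 A1.
have [CN CN0 NE] := NP _ gap0.
have iQ := chaosQ_integrable Pmeas Pindep Pge0 Pmean1.
have iD : {ae Pr, forall w, forall m, (@lebesgue_tuple R d).-integrable (hcube d)
    (fun t => (chaosD P m t w)%:E)}.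
  by apply: filterS iQ => w iQw m; exact: chaosD_integrable.
have CA0 : 0 <= chaosA M j0.+1 by exact: le_trans (chaosA_ge1 M1 _).
have AE m : chaosA M m.+1 <= chaosA M j0.+1 * b%:R `^ ((d%:R * (p - 1) - p * tau) * m%:R).
  by rewrite powRrM powR_mulrn ?powR_ge0//; exact: AL.
have := chaosD_fourier_small b2 Pmeas Pindep Pge0 (ltW p1) C30 M1 s'01 (ltW s'alpha) PM PC3 p2 a0
  Pmean1 C10 PC1 colP ss' s'tau CN0 CA0 NE AE iD.
apply: filterS3 iQ hmu => w iQw cw [n0 small].
have muC : (mu w (ccube d) < +oo)%E.
  rewrite ltey_eq; apply/orP; left.
  exact: (@kernel_finite_transition _ _ _ _ _ mu w _ (@measurable_ccube R d)).
exact: (@chaos_fourier_bigO _ _ R d b P w (mu w) s (level_gap s' tau) n0 muC d1 b2 Pge0 s01 gap0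
  iQw cw small).
Qed.

Let b0 : 0 < b%:R :> R. Proof. by rewrite ltr0n ltnW. Qed.
Let lnb : 0 < ln b%:R :> R. Proof. by rewrite ln_gt0// ltr1n. Qed.

Let limsup_ge1 p : 1 <= p -> (1 <= limn_esup (sup_moment Pr P p))%E.
Proof. by move=> p1; apply: limn_esup_ge => j; exact: sup_moment_ge1. Qed.

(** At [p = q] the positivity of [Theta] is the second half of Assumption 2. *)
Lemma fourier_dim_bound_gt0 : (0 < fourier_dim_bound Pr b P q alpha)%E.
Proof.
have /andP[q1 _] := q12; have /andP[a0 _] := alpha01.
rewrite lt_min lte_fin mulr_gt0//=.
apply: (@lt_le_trans _ _ ((2 / (q * ln b%:R))%:E * Theta Pr b P q)%E); last first.
  by apply: ereal_sup_ubound; exists q => //=; rewrite q1 lexx.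
apply: mule_gt0; first by rewrite lte_fin divr_gt0// mulr_gt0// (lt_trans ltr01).
by apply/(Theta_gt 0 b2 (limsup_ge1 (ltW q1))); rewrite mul0r subr0; exact: A2.2.
Qed.

(** That [D < d%:R] is required for [D] to compete in [fourier_dim]. It follows from the limit
    superior being at least 1, whence [D * p / 2 < d * (p - 1)], and from [2 * (p - 1) <= p]. *)
Lemma chaos_decay_lt_bound (D : R) : 0 <= D ->
  (D%:E < fourier_dim_bound Pr b P q alpha)%E ->
  D < d%:R /\ {ae Pr, forall w, fourier_bigO (mu w) D}.
Proof.
move=> D0; rewrite lt_min lte_fin => /andP[Da /ereal_sup_gt[_ [p /= p1q <-] Dp]].
have /andP[p1 pq] := p1q; have /andP[_ q2] := q12.
have pp : 0 < p by exact: lt_trans p1.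
have plnb : 0 < p * ln b%:R by rewrite mulr_gt0.
have DT : ((D / 2 * p * ln b%:R)%:E < Theta Pr b P p)%E.
  move: Dp; case: (Theta Pr b P p) => [r||].
  - rewrite -EFinM !lte_fin mulrAC ltr_pdivlMr//; lra.
  - by rewrite ltry.
  - rewrite gt0_muleNy; first by rewrite ltNge leNye.
    by rewrite lte_fin divr_gt0.
split; last first.
  have -> : D = 2 * (D / 2) by field.
  have Da' : 0 <= D / 2 < alpha by rewrite divr_ge0//= ltr_pdivrMr// mulrC.
  exact: (chaos_decay p1q Da' DT).
have p2 : p <= 2 by exact: le_trans q2.
have := lt_le_trans DT (_ : _ <= (d%:R * (p - 1) * ln b%:R)%:E)%E.
rewrite lte_fin => h.
have : D / 2 * p < d%:R * (p - 1).
  rewrite -(ltr_pM2r lnb); apply: h; rewrite /Theta.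
  have := limsup_ge1 (ltW p1); rewrite -lne_ge0; case: (lne _) => [r| |//].
    by rewrite -EFinB !lee_fin; lra.
  by rewrite leNye.
have d0 : 0 <= d%:R :> R by [].
move=> h1; rewrite -(ltr_pM2r pp); apply: (@lt_le_trans _ _ (2 * (d%:R * (p - 1)))); first by lra.
have -> : 2 * (d%:R * (p - 1)) = d%:R * (2 * (p - 1)) by ring.
by rewrite ler_wpM2l//; lra.
Qed.

End fourier_dimension.

Set Strict Implicit.
Unset Implicit Arguments.

Theorem theorem2 (R : realType) (dO : measure_display)
    (Omega : measurableType dO) (Pr : probability Omega R)
    (d b : nat) (hd : (1 <= d)%N) (hb : (2 <= b)%N)
    (P : nat -> d.-tuple R -> Omega -> R) (p0 alpha0 : R)
    (mu : R.-ftker Omega ~> d.-tuple R)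
    (hp0 : 1 < p0 <= 2) (halpha0 : 0 < alpha0 <= 1)
    (Pmeas : forall m,
       measurable_fun (ccube d `*` [set: Omega]) (fun z => P m z.1 z.2))
    (Pindep : independent_processes Pr [set: nat] (fun=> ccube d) P)
    (Pge0 : forall m t w, ccube d t -> 0 <= P m t w)
    (Pmean1 : forall m t, ccube d t -> ('E_Pr[P m t] = 1)%E)
    (A1 : assumption1 Pr b P)
    (A2 : assumption2 Pr b P p0)
    (A3 : assumption3 Pr b P p0 alpha0)
    (hmu : is_multiplicative_chaos Pr P mu) :
  (0 < fourier_dim_bound Pr b P p0 alpha0)%E /\
  {ae Pr, forall w, nonzero_measure (mu w) ->
     polynomial_fourier_decay (mu w) /\
     (fourier_dim_bound Pr b P p0 alpha0 <= fourier_dim (mu w))%E}.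
Proof.
have bound0 := fourier_dim_bound_gt0 hb Pmeas Pge0 Pmean1 hp0 halpha0 A2.
split => //.
set bound := fourier_dim_bound _ _ _ _ _ in bound0 *.
have boundoo : (bound < +oo)%E by rewrite /bound gt_min ltry.
have [B BE] : exists B, bound = B%:E.
  by case: bound bound0 boundoo => [r _ _|//|//]; exists r.
have B0 : 0 < B by move: bound0; rewrite BE.
(* A countable family of exponents increasing to the bound, so that one null set serves them all;
   starting at 2 keeps [D 0] positive. *)
pose D n := B * (1 - n.+2%:R^-1).
have Dgt0 n : 0 < D n.
  by rewrite mulr_gt0// subr_gt0 invf_lt1// ltr1n.
have DB n : ((D n)%:E < bound)%E.
  by rewrite BE lte_fin /D gtr_pMr// ltrBlDr ltrDl invr_gt0.
have decay n := chaos_decay_lt_bound hd hb Pmeas Pindep Pge0 Pmean1 hp0 halpha0 A1 A2 A3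
  hmu.2 (ltW (Dgt0 n)) (DB n).
have := ae_foralln (fun n => (decay n).2).
apply: filterS => w Dw nz; split; first by split=> //; exists (D 0%N).
apply/lee_mul01Pr; first exact: ltW.
(* With this [n], [n.+2] exceeds the inverse of [1 - r], so [r * B <= D n]. *)
move=> r /andP[r0 r1]; pose n := Num.truncn (1 - r)^-1.
apply: (@le_trans _ _ (D n)%:E); last first.
  apply: ereal_sup_ubound; exists (D n) => //=; split=> //.
  by rewrite ltW//= (decay n).1.
rewrite BE -EFinM lee_fin /D mulrC ler_pM2l// lerBrDr -lerBrDl.
rewrite -[leRHS]invrK lef_pV2 ?posrE ?invr_gt0 ?subr_gt0//.
apply: (le_trans (ltW (truncnS_gt _))); by rewrite ler_nat.
Qed.
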